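(* For every integer $n \ge 2$, the Jacobian operator $J \colon W^{1,n}(\mathbb{R}^n,\mathbb{R}^n) \to \mathcal{H}^1(\mathbb{R}^n)$ is not surjective.
   Context: For $u = (u_1,\dots,u_n)$, $Ju = \det(\partial_j u_i)_{i,j=1}^n$. $W^{1,n}(\mathbb{R}^n,\mathbb{R}^n)$ is the usual inhomogeneous Sobolev space. The real Hardy space is $\mathcal{H}^1(\mathbb{R}^n) = \{h \in \mathcal{S}'(\mathbb{R}^n) : \sup_{t>0}|h*\eta_t| \in L^1(\mathbb{R}^n)\}$, where $\eta \in C_c^\infty(\mathbb{R}^n)$ is fixed with $\int\eta\neq 0$ and $\eta_t(x) = t^{-n}\eta(x/t)$. It is known that $J$ maps $W^{1,n}(\mathbb{R}^n,\mathbb{R}^n)$ into $\mathcal{H}^1(\mathbb{R}^n)$. *)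

(* Defs.v *)
From HB Require Import structures.
From mathcomp Require Import all_boot all_order all_algebra.
From mathcomp Require Import all_classical all_reals all_analysis.

Set Implicit Arguments.
Unset Strict Implicit.
Unset Printing Implicit Defensive.
Import Order.TTheory GRing.Theory Num.Theory.
Import numFieldNormedType.Exports.

Local Open Scope classical_set_scope.
Local Open Scope ring_scope.

(* R^n is 'rV[R]_n. Its sigma-algebra is generated by the coordinates, as the
   library does for n.-tuple R; this is the Borel sigma-algebra. *)
Definition rV_display : measure_display -> measure_display.
Proof. exact. Qed.

Section measurable_rV.
Context (R : realType) (n : nat).

Let coors : 'I_n -> 'rV[R]_n -> R := fun i x => x ord0 i.

Let rV_set0 : g_sigma_preimage coors set0.
Proof. exact: sigma_algebra0. Qed.

Let rV_setC A : g_sigma_preimage coors A -> g_sigma_preimage coors (~` A).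
Proof. exact: sigma_algebraC. Qed.

Let rV_bigcup (F : _^nat) : (forall i, g_sigma_preimage coors (F i)) ->
  g_sigma_preimage coors (\bigcup_i (F i)).
Proof. exact: sigma_algebra_bigcup. Qed.

HB.instance Definition _ := @isMeasurable.Build
  (rV_display default_measure_display)
  'rV[R]_n (g_sigma_preimage coors) rV_set0 rV_setC rV_bigcup.

Lemma measurable_coord (i : 'I_n) :
  measurable_fun [set: 'rV[R]_n] (fun x : 'rV[R]_n => x ord0 i).
Proof.
move=> _ Y mY; rewrite setTI; apply: sub_sigma_algebra => /=.
rewrite -bigcup_seq/=; exists i => /=; first by rewrite mem_index_enum.
by exists Y => //; rewrite setTI.
Qed.

Lemma measurable_fun_rV d (T : measurableType d) (f : T -> 'rV[R]_n) :
  (forall i, measurable_fun [set: T] (fun t => f t ord0 i)) ->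
  measurable_fun [set: T] f.
Proof.
move=> mf _ A; rewrite setTI.
suff : g_sigma_preimage coors `<=` [set B | measurable (f @^-1` B)] by apply.
apply: smallest_sub.
  split => /=.
  - by rewrite preimage_set0.
  - by move=> B mB; rewrite setTD preimage_setC; exact: measurableC.
  - by move=> F mF; rewrite preimage_bigcup; exact: bigcup_measurable.
rewrite -bigcup_seq => B [i _ [C mC <-]] /=.
rewrite setTI -comp_preimage -[X in measurable X]setTI.
exact: mf.
Qed.

End measurable_rV.

Section lebesgue_cons.
Context (R : realType) (n : nat).

Definition rV_cons (p : R * 'rV[R]_n) : 'rV[R]_n.+1 :=
  row_mx (const_mx p.1 : 'rV[R]_1) p.2.

Definition rV_uncons (x : 'rV[R]_n.+1) : R * 'rV[R]_n :=
  (x ord0 ord0, \row_j x ord0 (lift ord0 j)).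

Lemma rV_cons0 p : rV_cons p ord0 ord0 = p.1.
Proof.
rewrite /rV_cons (_ : ord0 = lshift n ord0 :> 'I_(1 + n)); last exact: val_inj.
by rewrite (row_mxEl (const_mx p.1 : 'rV[R]_1)) mxE.
Qed.

Lemma rV_consS p j : rV_cons p ord0 (lift ord0 j) = p.2 ord0 j.
Proof. by rewrite /rV_cons -rshift1 (row_mxEr (const_mx p.1 : 'rV[R]_1)). Qed.

Lemma rV_consK : cancel rV_cons rV_uncons.
Proof.
move=> [a v]; rewrite /rV_uncons rV_cons0 /=; congr pair.
by apply/rowP => j; rewrite mxE rV_consS.
Qed.

Lemma measurable_rV_cons :
  measurable_fun [set: R * 'rV[R]_n] rV_cons.
Proof.
apply: measurable_fun_rV => i.
case: (unliftP ord0 i) => [j|] ->.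
  rewrite (_ : (fun p => _) = (fun x : 'rV[R]_n => x ord0 j) \o snd).
    by apply: measurableT_comp => //; exact: measurable_coord.
  by apply/funext => p; exact: rV_consS.
by rewrite (_ : (fun p => _) = fst)//; apply/funext => p; exact: rV_cons0.
Qed.

Lemma measurable_rV_uncons : measurable_fun [set: 'rV[R]_n.+1] rV_uncons.
Proof.
apply/measurable_fun_pairP; split; first exact: measurable_coord.
apply: measurable_fun_rV => i /=.
rewrite (_ : (fun x => _) = fun x : 'rV[R]_n.+1 => x ord0 (lift ord0 i)).
  exact: measurable_coord.
by apply/funext => x; rewrite mxE.
Qed.

Variable m : {sigma_finite_measure set 'rV[R]_n -> \bar R}.

Definition lebesgue_cons : set 'rV[R]_n.+1 -> \bar R :=
  pushforward (@lebesgue_measure R \x m)%E rV_cons.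

Let mpreim A : measurable A -> measurable (rV_cons @^-1` A).
Proof.
by move=> mA; rewrite -[X in measurable X]setTI; exact: measurable_rV_cons.
Qed.

Let lebesgue_cons0 : lebesgue_cons set0 = 0%E.
Proof. by rewrite /lebesgue_cons /pushforward preimage_set0 measure0. Qed.

Let lebesgue_cons_ge0 A : (0 <= lebesgue_cons A)%E.
Proof. by rewrite /lebesgue_cons /pushforward; exact: measure_ge0. Qed.

Let lebesgue_cons_sigma_additive : semi_sigma_additive lebesgue_cons.
Proof.
move=> F mF tF mUF; rewrite /lebesgue_cons /pushforward preimage_bigcup.
apply: measure_semi_sigma_additive.
- by move=> k; exact: mpreim.
- apply/trivIsetP => /= i j _ _ ij; rewrite -preimage_setI.
  by move/trivIsetP : tF => /(_ _ _ _ _ ij) ->//; rewrite preimage_set0.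
- by rewrite -preimage_bigcup; exact: mpreim.
Qed.

HB.instance Definition _ := isMeasure.Build _ _ _ lebesgue_cons
  lebesgue_cons0 lebesgue_cons_ge0 lebesgue_cons_sigma_additive.

Let lebesgue_cons_sigma_finite : sigma_finite setT lebesgue_cons.
Proof.
have /sigma_finiteP[F [FT ndF mF]] := sigma_finiteT (@lebesgue_measure R).
have /sigma_finiteP[G [GT ndG mG]] := sigma_finiteT m.
exists (fun k => rV_uncons @^-1` (F k `*` G k)).
  rewrite -preimage_bigcup; apply/esym; rewrite -subTset => x _.
  have : (\bigcup_k F k) (rV_uncons x).1 by rewrite -FT.
  move=> [k _ Fk]; have : (\bigcup_k G k) (rV_uncons x).2 by rewrite -GT.
  move=> [l _ Gl]; exists (maxn k l) => //; split.
    by move: Fk; apply/subsetPset/ndF/leq_maxl.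
  by move: Gl; apply/subsetPset/ndG/leq_maxr.
move=> k; have [mFk Fk] := mF k; have [mGk Gk] := mG k; split.
  rewrite -[X in measurable X]setTI; apply: measurable_rV_uncons => //.
  exact: measurableX.
rewrite /lebesgue_cons /pushforward -comp_preimage.
rewrite (_ : rV_uncons \o rV_cons = id) ?preimage_id.
  by rewrite product_measure1E// lte_mul_pinfty// ge0_fin_numE.
by apply/funext => p /=; rewrite rV_consK.
Qed.

HB.instance Definition _ :=
  Measure_isSigmaFinite.Build _ _ _ lebesgue_cons lebesgue_cons_sigma_finite.

End lebesgue_cons.

(* Lebesgue measure on R^n, the n-fold product of [lebesgue_measure]. *)
Fixpoint lebesgue_rV (R : realType) (n : nat) :
    {sigma_finite_measure set 'rV[R]_n -> \bar R} :=
  match n with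
  | 0%N => \d_(0 : 'rV[R]_0)
  | n'.+1 => lebesgue_cons (lebesgue_rV R n')
  end.

Lemma lebesgue_rV_box (R : realType) (n : nat) (a b : 'rV[R]_n) :
  (forall i, a ord0 i <= b ord0 i) ->
  lebesgue_rV R n [set x | forall i, x ord0 i \in `[a ord0 i, b ord0 i]] =
  (\prod_i (b ord0 i - a ord0 i))%:E.
Proof.
elim: n a b => [|n IHn] a b ab.
  rewrite big_ord0 /= diracE mem_set//=; by case.
pose a' : 'rV[R]_n := \row_j a ord0 (lift ord0 j).
pose b' : 'rV[R]_n := \row_j b ord0 (lift ord0 j).
have ab' i : a' ord0 i <= b' ord0 i by rewrite !mxE.
have mI i : measurable [set x : 'rV[R]_n | x ord0 i \in `[a' ord0 i, b' ord0 i]].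
  rewrite [X in measurable X](_ : _ = setT `&`
    (fun x : 'rV[R]_n => x ord0 i) @^-1` `[a' ord0 i, b' ord0 i]%classic).
    by apply: measurable_coord => //; exact: measurable_itv.
  by rewrite setTI; apply/seteqP; split.
rewrite /= /lebesgue_cons /pushforward.
rewrite (_ : _ @^-1` _ = `[a ord0 ord0, b ord0 ord0]%classic `*`
    [set x : 'rV[R]_n | forall i, x ord0 i \in `[a' ord0 i, b' ord0 i]]); last first.
  apply/seteqP; split => [p /= pab|p /= [p1 p2] i].
    split; first by have := pab ord0; rewrite rV_cons0.
    by move=> i; have := pab (lift ord0 i); rewrite rV_consS !mxE.
  case: (unliftP ord0 i) => [j|] ->; last by rewrite rV_cons0.
  by rewrite rV_consS; have := p2 j; rewrite !mxE.
rewrite product_measure1E//; last first.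
  rewrite (_ : mkset _ = \bigcap_i [set x : 'rV[R]_n |
      x ord0 i \in `[a' ord0 i, b' ord0 i]]).
    exact: fin_bigcap_measurable.
  by apply/seteqP; split => x /= xab i => [_|]; [exact: xab|exact: (xab i I)].
rewrite IHn// big_ord_recl EFinM; congr (_ * _)%E.
  rewrite [LHS](lebesgue_measure_itv `[a ord0 ord0, b ord0 ord0])/= lte_fin.
  by have := ab ord0; rewrite le_eqVlt => /predU1P[->|->]//; rewrite ltxx subrr.
by congr EFin; apply: eq_bigr => i _; rewrite !mxE.
Qed.

Section calculus.
Context {R : realType} {n : nat}.
Local Notation Rn := 'rV[R]_n.
Local Notation mu := (lebesgue_rV R n).
Implicit Types f g phi psi : Rn -> R.

Definition partial (j : 'I_n) f : Rn -> R := 'D_(delta_mx ord0 j) f.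

(* The derivative of [f] along the directions in [s], a multi-index given as a
   list: a multi-index of length k corresponds to lists of size k. *)
Definition iter_partial (s : seq 'I_n) f : Rn -> R := foldr partial f s.

Definition smooth f := forall s : seq 'I_n,
  continuous (iter_partial s f) /\
  forall (j : 'I_n) x, derivable (iter_partial s f) x (delta_mx ord0 j).

Definition test_function f :=
  smooth f /\ compact (closure [set x | f x != 0]).

Definition schwartz_seminorm (k : nat) (s : seq 'I_n) f : \bar R :=
  ereal_sup (range (fun x => (`|x| ^+ k * `|iter_partial s f x|)%:E)).

Definition schwartz f :=
  smooth f /\ forall k s, (schwartz_seminorm k s f < +oo)%E.

(* A tempered distribution is given by its values on Schwartz functions; the
   values of [T] on other functions are irrelevant.  Continuity is with respect
   to the topology generated by the seminorms [schwartz_seminorm k s]. *)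
Definition tempered (T : (Rn -> R) -> R) :=
  (forall (a : R) phi psi, schwartz phi -> schwartz psi ->
     T (fun x => a * phi x + psi x) = a * T phi + T psi) /\
  (forall phi, schwartz phi -> forall e : R, 0 < e ->
     exists (N : nat) (d : R), 0 < d /\
       forall psi, schwartz psi ->
         (forall k s, (k <= N)%N -> (size s <= N)%N ->
            (schwartz_seminorm k s (fun x => psi x - phi x)%R < d%:E)%E) ->
         `|T psi - T phi| < e).

Definition dilate (eta : Rn -> R) (t : R) : Rn -> R :=
  fun x => t ^- n * eta (t^-1 *: x).

Definition conv (T : (Rn -> R) -> R) phi : Rn -> R :=
  fun x => T (fun y => phi (x - y)).

Definition maximal_function (eta : Rn -> R) (T : (Rn -> R) -> R) (x : Rn) :
    \bar R :=
  ereal_sup [set `|conv T (dilate eta t) x|%:E | t in [set t : R | 0 < t]].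

Definition hardy1 (eta : Rn -> R) (T : (Rn -> R) -> R) :=
  tempered T /\ mu.-integrable setT (maximal_function eta T).

Definition distribution_of f : (Rn -> R) -> R :=
  fun phi => \int[mu]_x (f x * phi x).

Definition distribution_eq (S T : (Rn -> R) -> R) :=
  forall phi, schwartz phi -> S phi = T phi.

Definition is_weak_partial (j : 'I_n) f g :=
  forall phi, test_function phi ->
    \int[mu]_x (f x * partial j phi x) = - \int[mu]_x (g x * phi x).

Definition weak_partials_Lp (p : R) (j : 'I_n) f : set (Rn -> R) :=
  [set g | g \in Lfun mu p%:E /\ is_weak_partial j f g].

Definition sobolev1 (p : R) f :=
  f \in Lfun mu p%:E /\ forall j, weak_partials_Lp p j f !=set0.

(* Weak derivatives are unique up to a null set; [get] picks a
   representative. *)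
Definition weak_partial (p : R) (j : 'I_n) f : Rn -> R :=
  get (weak_partials_Lp p j f).

Definition sobolev1n (u : Rn -> Rn) :=
  forall i, sobolev1 n%:R (fun x => u x ord0 i).

Definition jacobian_operator (u : Rn -> Rn) : Rn -> R :=
  fun x => \det (\matrix_(i, j) weak_partial n%:R j (fun y => u y ord0 i) x).

End calculus.

(* Main.v *)
Require Import Defs.
From HB Require Import structures.
From mathcomp Require Import all_boot all_order all_algebra.
From mathcomp Require Import all_classical all_reals all_analysis.
From mathcomp Require Import perm measurable_realfun zify ring lra.
Import Order.TTheory GRing.Theory Num.Theory.
Import numFieldNormedType.Exports.

Local Open Scope classical_set_scope.
Local Open Scope ring_scope.

Set Implicit Arguments.
Unset Strict Implicit.
Unset Printing Implicit Defensive.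

(** The integral of a Jacobian of a [W^{1,n}] map vanishes.  Applied to
    [(phi u_0, u_1, ..., u_{n-1})] this bounds the pairing of [Ju] with a test
    function [phi] by [C sup |grad phi|], where [C] depends on [u] only.  For
    the functional [sum_k 2^-k D_k], where [D_k] is the dipole formed by [eta]
    at scale [4^k] and centres [c 4^k] and [- c 4^k], there is no such bound:
    it belongs to the Hardy space since the [D_k] have uniformly bounded norms,
    but its value at the probe [eta (4^-k x - c)] is [2^-k \int eta^2], whereas
    the gradient of that probe is [O(4^-k)]. *)

(** * Open sets and continuous functions for the coordinate sigma-algebra *)

Section borel_rV.
Context {R : realType} {n : nat}.
Local Notation Rn := 'rV[R]_n.

(** The gradient bound says that [Ju] is the divergence of an integrable field, [u_0] times the
    first row of cofactors. It uses [u_0] itself in L^n, so it is the inhomogeneous part of the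
    Sobolev norm that obstructs surjectivity. The obstacle is the vanishing of the integral for
    merely weakly differentiable maps. The rows are made rough one at a time: the cofactors along a
    row form a weakly divergence free field, because the claim already holds when that row is the
    gradient of a test function, and such a field annihilates weak gradients of the dual exponent.
    This last fact rests on continuity of translations in L^n. A dipole is used because its
    cancellation makes the maximal function decay like |x|^(-n-1), which is integrable at infinity.
    The weights must be summable and yet decay more slowly than the gradients of the probes, whence
    2 against 4; the ratio 4 also makes the supports disjoint, so that each probe sees a single
    dipole. The given [eta] plays every part: kernel of the maximal function, profile of the
    dipoles, probe and, squared and rescaled, mollifier. *)

Lemma rV_norm_lt (x : Rn) (e : R) : 0 < e ->
  (forall i, `|x ord0 i| < e) -> `|x| < e.
Proof.
move=> e0 xe; rewrite [ltLHS]/Num.norm /= mx_normrE.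
by apply/bigmax_ltP; split => // -[i j] _ /=; rewrite ord1.
Qed.

Lemma rV_coord_le (x : Rn) i : `|x ord0 i| <= `|x|.
Proof.
rewrite [leRHS]/Num.norm /= mx_normrE.
by apply/bigmax_geP; right => /=; exists (ord0, i).
Qed.

Lemma rV_norm_le (x : Rn) (e : R) : 0 <= e ->
  (forall i, `|x ord0 i| <= e) -> `|x| <= e.
Proof.
move=> e0 xe; rewrite [leLHS]/Num.norm /= mx_normrE.
by apply/bigmax_leP; split => // -[i j] _ /=; rewrite ord1.
Qed.

(** The sigma-algebra only knows coordinates, so an open set is written as the union of the
    countably many boxes with rational centre and radius 1/(l+1) that it contains. Cubes suffice
    because they are the balls of the matrix norm. *)
Lemma open_measurable_rV (U : set Rn) : open U -> measurable U.
Proof.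
move=> oU.
pose box (p : 'rV[rat]_n * nat) : set Rn :=
  \bigcap_(i in [set: 'I_n])
    ((fun x : Rn => x ord0 i) @^-1` ball (ratr (p.1 ord0 i) : R) p.2.+1%:R^-1).
have mbox p : measurable (box p).
  apply: fin_bigcap_measurable => // i _.
  rewrite -[X in measurable X]setTI; apply: measurable_coord => //.
  by apply: measurable_realfun.open_measurable; exact: ball_open.
rewrite (_ : U = \bigcup_p (if `[< box p `<=` U >] then box p else set0)).
  apply: countable_bigcupT_measurable => //.
  by move=> p; case: ifP.
apply/seteqP; split => [x Ux|x [p _]]; last first.
  by case: ifPn => // /asboolP pU; exact: pU.
have /nbhs_ballP[e /= e0 xeU] := oU _ Ux.
have [m _ me] := near_infty_natSinv_lt (PosNum e0).
have {}me : m.+1%:R^-1 < e by have := me m (leqnn _).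
(* The box has radius below half of 1/(m+1) and its centre is that close to [x], so all of its
   points are within 1/(m+1) < e of [x]. *)
have m0 : 0 < m.+1%:R^-1 / 2 :> R by rewrite divr_gt0.
have [l _ le] := near_infty_natSinv_lt (PosNum m0).
have {}le : l.+1%:R^-1 < m.+1%:R^-1 / 2 :> R by have := le l (leqnn _).
have /choice[q xq] : forall i : 'I_n, exists q : rat,
    `|x ord0 i - ratr q| < l.+1%:R^-1.
  move=> i; have : x ord0 i < x ord0 i + l.+1%:R^-1 by rewrite ltrDl.
  by move=> /rat_in_itvoo[q]; rewrite in_itv/= => /andP[q1 q2]; exists q;
    rewrite ltr0_norm ?subr_lt0// opprB ltrBlDl.
exists (\row_i q i, l) => //; case: asboolP => [_|].
  by move=> i _ /=; rewrite mxE /ball/= distrC; exact: xq.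
apply: contra_notP => _ y /= by_.
apply: xeU; rewrite -ball_normE/=; apply: (rV_norm_lt e0) => i.
rewrite !mxE; have := by_ i I; rewrite /ball/= mxE distrC => yq.
rewrite -(subrK (ratr (q i)) (x ord0 i)) -addrA.
apply: le_lt_trans (ler_normD _ _) _; apply: lt_trans me.
by rewrite [ltRHS](splitr m.+1%:R^-1) ltrD// ?(lt_trans (xq i))// distrC (lt_trans yq).
Qed.

Lemma continuous_measurable_rV (f : Rn -> R) :
  continuous f -> measurable_fun [set: Rn] f.
Proof.
move=> cf; apply: (measurability _ (RGenOpens.measurableE R)).
move=> /= _ [_ [a [b ->]] <-]; rewrite setTI; apply: open_measurable_rV.
by move/continuousP : cf; apply; exact: interval_open.
Qed.
End borel_rV.

(** * Translation invariance of Lebesgue measure *)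

Section translation.
Context {R : realType}.

Definition shiftR (a : R) : measurableTypeR R -> measurableTypeR R := fun x => x + a.

Lemma measurable_shiftR a : measurable_fun [set: measurableTypeR R] (shiftR a).
Proof. by apply: measurable_funD. Qed.
HB.instance Definition _ a := @isMeasurableFun.Build _ _ _ _ _ (measurable_shiftR a).

Lemma lebesgue_measure_shift a (A : set R) : measurable A ->
  pushforward lebesgue_measure (shiftR a) A = lebesgue_measure A.
Proof.
move=> mA; apply/esym/lebesgue_measure_unique => //= _ [[b c]] _ <-.
rewrite /pushforward (_ : _ @^-1` _ = `]b - a, c - a]%classic).
  rewrite !lebesgue_measure_itv/= !lte_fin ltrD2r.
  by case: ifP => // _; rewrite !EFinN; congr EFin; ring.
by apply/seteqP; split => x /=; rewrite !in_itv/= /shiftR ltrBlDr lerBrDr.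
Qed.

Definition shift_rV n (a : 'rV[R]_n) : 'rV[R]_n -> 'rV[R]_n := fun x => x + a.

Lemma measurable_shift_rV n (a : 'rV[R]_n) :
  measurable_fun [set: 'rV[R]_n] (shift_rV a).
Proof.
apply: measurable_fun_rV => i; rewrite /shift_rV.
under eq_fun do rewrite mxE.
by apply: measurable_funD => //; exact: measurable_coord.
Qed.
HB.instance Definition _ n (a : 'rV[R]_n) :=
  @isMeasurableFun.Build _ _ _ _ _ (measurable_shift_rV a).

(** Induction on the dimension: through [rV_cons] a translation acts separately on the first
    coordinate and on the others, and a product measure is determined by its values on
    rectangles. *)
Lemma lebesgue_rV_shift n (a : 'rV[R]_n) (A : set 'rV[R]_n) : measurable A ->
  pushforward (lebesgue_rV R n) (shift_rV a) A = lebesgue_rV R n A.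
Proof.
elim: n a A => [|n IHn] a A mA.
  rewrite /pushforward (_ : _ @^-1` _ = A)//; apply/seteqP.
  by rewrite /shift_rV; split => x /=; rewrite (thinmx0 a) addr0.
pose a' : 'rV[R]_n := (rV_uncons a).2.
pose s := fun p : R * 'rV[R]_n => (shiftR (a ord0 ord0) p.1, shift_rV a' p.2).
have ms : measurable_fun setT s.
  apply: measurable_fun_pair.
    exact: (measurableT_comp (measurable_shiftR _)).
  exact: (measurableT_comp (measurable_shift_rV _)).
pose s' : {mfun _ >-> _} := HB.pack s (isMeasurableFun.Build _ _ _ _ s ms).
have mpre B : measurable B -> measurable (@rV_cons R n @^-1` B).
  by move=> mB; rewrite -[X in measurable X]setTI; exact: measurable_rV_cons.
rewrite /= /lebesgue_cons /pushforward.
rewrite [RHS](@product_measure_unique _ _ _ _ _ _ _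
  (pushforward (lebesgue_measure \x lebesgue_rV R n)%E s')); last 2 first.
- move=> B C mB mC.
  transitivity ((@lebesgue_measure R \x lebesgue_rV R n)%E
    ((shiftR (a ord0 ord0) @^-1` B) `*` (shift_rV a' @^-1` C))) => //.
  have mB' : measurable (shiftR (a ord0 ord0) @^-1` B).
    by rewrite -[X in measurable X]setTI; exact: measurable_shiftR.
  have mC' : measurable (shift_rV a' @^-1` C).
    by rewrite -[X in measurable X]setTI; exact: measurable_shift_rV.
  rewrite product_measure1E//; congr (_ * _)%E.
    exact: lebesgue_measure_shift.
  exact: IHn.
- exact: mpre.
rewrite /pushforward; congr product_measure1.
apply/seteqP; suff E p : shift_rV a (rV_cons p) = rV_cons (s p).
  by split => p; rewrite /preimage/= E.
apply/rowP => i; rewrite /shift_rV mxE.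
case: (unliftP ord0 i) => [j|] ->; rewrite ?rV_consS ?rV_cons0 //=.
by rewrite /shift_rV !mxE.
Qed.

End translation.

Section integral_shift.
Context {R : realType} {n : nat}.
Local Notation Rn := 'rV[R]_n.
Local Notation mu := (lebesgue_rV R n).

Lemma ge0_integral_shift (a : Rn) (f : Rn -> \bar R) :
  measurable_fun setT f -> (forall x, 0 <= f x)%E ->
  (\int[mu]_x f (x + a)%R = \int[mu]_x f x)%E.
Proof.
move=> mf f0.
transitivity (\int[pushforward mu (shift_rV a)]_x f x)%E.
  by rewrite ge0_integral_pushforward//; exact: measurable_shift_rV.
by apply: eq_measure_integral => A mA _; rewrite -[RHS](lebesgue_rV_shift a).
Qed.

End integral_shift.

(** * Integrals of real functions with values in the extended reals *)

Section lower_integral_of_real_functions.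
Context d (T : measurableType d) (R : realType) (mu : {measure set T -> \bar R}).
Implicit Types f g : T -> R.

(** Kept in the extended reals so that finiteness can be expressed as [< +oo]; the real-valued
    integral applies [fine], which turns an infinite value into 0. *)
Definition lint f : \bar R := (\int[mu]_x (f x)%:E)%E.

Lemma lint_ge0 f : (forall x, 0 <= f x) -> (0 <= lint f)%E.
Proof. by move=> f0; apply: integral_ge0 => x _; rewrite lee_fin. Qed.

Lemma le_lint f g : measurable_fun setT f -> measurable_fun setT g ->
  (forall x, 0 <= f x) -> (forall x, f x <= g x) -> (lint f <= lint g)%E.
Proof.
move=> mf mg f0 fg; apply: ge0_le_integral => //.
- by move=> x _; rewrite lee_fin.
- exact/measurable_EFinP.
- exact/measurable_EFinP.
- by move=> x _; rewrite lee_fin.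
Qed.

Lemma lintD f g : measurable_fun setT f -> measurable_fun setT g ->
  (forall x, 0 <= f x) -> (forall x, 0 <= g x) ->
  lint (fun x => f x + g x) = (lint f + lint g)%E.
Proof.
move=> mf mg f0 g0; rewrite /lint -ge0_integralD//.
- by move=> x _; rewrite lee_fin.
- exact/measurable_EFinP.
- by move=> x _; rewrite lee_fin.
- exact/measurable_EFinP.
Qed.

Lemma lintZ (k : R) f : measurable_fun setT f -> (forall x, 0 <= f x) -> 0 <= k ->
  lint (fun x => k * f x) = (k%:E * lint f)%E.
Proof.
move=> mf f0 k0; rewrite /lint -ge0_integralZl_EFin//.
- by move=> x _; rewrite lee_fin.
- exact/measurable_EFinP.
Qed.

Lemma lint_integrable f : measurable_fun setT f ->
  (lint (fun x => (`|f x|)%R) < +oo)%E -> mu.-integrable setT (EFin \o f).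
Proof.
by move=> mf fi; apply/integrableP; split; first exact/measurable_EFinP.
Qed.

Lemma integrable_lint f : mu.-integrable setT (EFin \o f) ->
  (lint (fun x => (`|f x|)%R) < +oo)%E.
Proof. by case/integrableP. Qed.

(* Young's inequality with a parameter, used in place of Hoelder's. *)
Lemma young_pow (p : nat) (a b s : R) : 0 <= a -> 0 <= b -> 0 < s ->
  a ^+ p * b <= s * a ^+ p.+1 + s ^- p * b ^+ p.+1.
Proof.
move=> a0 b0 s0; have [bsa|/ltW sab] := leP b (s * a).
  rewrite (@le_trans _ _ (s * a ^+ p.+1))//.
    by rewrite exprSr mulrCA ler_wpM2l// exprn_ge0.
  by rewrite lerDl mulr_ge0// ?invr_ge0 exprn_ge0// ltW.
rewrite (@le_trans _ _ (s ^- p * b ^+ p.+1))//.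
  rewrite exprSr mulrA ler_wpM2r// mulrC -exprVn -exprMn.
  rewrite lerXn2r// ?nnegrE// ?mulr_ge0// ?invr_ge0 ?(ltW s0)//.
  by rewrite ler_pdivlMr// mulrC.
by rewrite lerDr mulr_ge0// ?exprn_ge0// ltW.
Qed.

(** The sum is at most twice its larger term. *)
Lemma exprD_le (p : nat) (a b : R) : 0 <= a -> 0 <= b ->
  (a + b) ^+ p <= 2 ^+ p * (a ^+ p + b ^+ p).
Proof.
have H (c e : R) : 0 <= c -> c <= e -> (c + e) ^+ p <= 2 ^+ p * (c ^+ p + e ^+ p).
  move=> c0 ce; rewrite (@le_trans _ _ ((2 * e) ^+ p))//.
    by rewrite lerXn2r// ?nnegrE; lra.
  by rewrite exprMn ler_wpM2l// ?exprn_ge0// lerDr exprn_ge0.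
move=> a0 b0; have [ab|/ltW ab] := leP a b; first exact: H.
by rewrite addrC [X in _ * X]addrC; exact: H.
Qed.

(** Dominated convergence for [|f - f_ k| ^+ p] with majorant [(2 * h) ^+ p], the bound on [f] being
    inherited from the [f_ k]. The approximation arguments below ask for one good index only. *)
Lemma lint_dominated (f_ : (T -> R)^nat) f (h : T -> R) (p : nat) :
  (forall k, measurable_fun setT (f_ k)) -> measurable_fun setT f ->
  measurable_fun setT h -> (0 < p)%N ->
  (forall k x, `|f_ k x| <= h x) -> (lint (fun x => h x ^+ p)%R < +oo)%E ->
  (forall x, f_ ^~ x @ \oo --> f x) ->
  forall e : R, 0 < e ->
  exists k, (lint (fun x => `|f x - f_ k x| ^+ p)%R <= e%:E)%E.
Proof.
move=> mf_ mf mh p0 f_h hp f_f e e0.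
have h0 x : 0 <= h x by rewrite (le_trans _ (f_h 0%N x)).
have fh x : `|f x| <= h x.
  have cf : `|f_ k x| @[k --> \oo] --> `|f x| by apply: cvg_norm; exact: f_f.
  rewrite -(cvg_lim (@Rhausdorff R) cf); apply: limr_le; first exact: cvgP cf.
  by apply: nearW => k; exact: f_h.
have mX k : measurable_fun setT (fun x => `|f x - f_ k x| ^+ p).
  apply: measurable_funX; apply: measurableT_comp => //.
  by apply: measurable_funB.
have := @dominated_cvg _ _ _ mu setT measurableT
  (fun k x => (`|f x - f_ k x| ^+ p)%:E) (cst 0%E) (fun x => ((2 * h x) ^+ p)%:E).
have -> : (\int[mu]_x cst 0 x)%E = 0%E :> \bar R by exact: integral0.
move=> /(_ _ _ _ _ _)/fine_cvgP; case.
- by move=> k; exact/measurable_EFinP.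
- move=> x _; apply: cvg_EFin; first exact: nearW.
  rewrite (_ : 0 = `|f x - f x| ^+ p); last by rewrite subrr normr0 expr0n gtn_eqF.
  apply: (cvg_comp _ (fun y : R => y ^+ p)); last exact: exprn_continuous.
  by apply: cvg_norm; apply: cvgB; [exact: cvg_cst|exact: f_f].
- by [].
- apply/integrableP; split.
    by apply/measurable_EFinP/measurable_funX/measurable_funM.
  under eq_integral do rewrite /= ger0_norm ?exprn_ge0 ?mulr_ge0// exprMn.
  rewrite -/(lint (fun x => 2 ^+ p * h x ^+ p)) lintZ//.
  + by rewrite lte_mul_pinfty// lee_fin exprn_ge0.
  + exact: measurable_funX.
  + by move=> x; rewrite exprn_ge0.
- move=> k x _; rewrite lee_fin ger0_norm ?exprn_ge0//.
  rewrite lerXn2r// ?nnegrE// ?mulr_ge0//.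
  rewrite (le_trans (ler_normB _ _))// mulr2n mulrDl mul1r lerD//.
move=> [k1 _ k1f] /cvgrPdist_le/(_ _ e0)[k2 _ k2e].
(* From [k1] on the integral is finite, so [fine] loses nothing; from [k2] on it is at most [e]. *)
exists (maxn k1 k2).
have := k1f (maxn k1 k2) (leq_maxl _ _); rewrite /lint => ?.
rewrite -[X in (X <= _)%E]fineK// lee_fin.
have := k2e (maxn k1 k2) (leq_maxr _ _); rewrite /= sub0r normrN.
exact/le_trans/ler_norm.
Qed.

End lower_integral_of_real_functions.

(** * Continuity of translations in L^p: closure properties *)

Section translation_continuity.
Context {R : realType} {n : nat}.
Local Notation Rn := 'rV[R]_n.
Local Notation mu := (lebesgue_rV R n).
Implicit Types f g : Rn -> R.

Lemma measurable_fun_shift (z : Rn) f : measurable_fun setT f ->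
  measurable_fun setT (fun x : Rn => f (x + z)).
Proof. by move=> mf; exact: (measurableT_comp mf (measurable_shift_rV z)). Qed.

Lemma lint_shift (z : Rn) f : measurable_fun setT f -> (forall x, 0 <= f x) ->
  lint mu (fun x : Rn => f (x + z)) = lint mu f.
Proof.
move=> mf f0; apply: (ge0_integral_shift z (f := EFin \o f)).
  exact/measurable_EFinP.
by move=> x; rewrite lee_fin.
Qed.

Variable p : nat.
Hypothesis p0 : (0 < p)%N.

Lemma measurable_distX f g : measurable_fun setT f -> measurable_fun setT g ->
  measurable_fun setT (fun x : Rn => `|f x - g x| ^+ p).
Proof.
move=> mf mg; apply: measurable_funX; apply: measurableT_comp => //.
exact: measurable_funB.
Qed.

(** The p-th power of the norm stands for the norm: only smallness matters, and all exponents remain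
    natural numbers. *)
Definition transl_cont f := forall e : R, 0 < e -> exists2 d : R, 0 < d &
  forall z : Rn, `|z| < d -> (lint mu (fun x : Rn => `|f (x + z) - f x| ^+ p)%R <= e%:E)%E.

Lemma transl_contD f g : measurable_fun setT f -> measurable_fun setT g ->
  transl_cont f -> transl_cont g -> transl_cont (fun x => f x + g x).
Proof.
move=> mf mg cf cg e e0.
have e'0 : 0 < e / (2 ^+ p * 2) by rewrite divr_gt0// mulr_gt0// exprn_gt0.
have [d1 d10 fd1] := cf _ e'0; have [d2 d20 gd2] := cg _ e'0.
exists (Num.min d1 d2) => [|z]; first by rewrite lt_min d10.
rewrite lt_min => /andP[/fd1 fz /gd2 gz].
have mX (h : Rn -> R) : measurable_fun setT h ->
    measurable_fun setT (fun x : Rn => `|h (x + z) - h x| ^+ p).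
  by move=> mh; apply: measurable_distX => //; exact: measurable_fun_shift.
apply: (@le_trans _ _ (lint mu (fun x : Rn =>
    2 ^+ p * (`|f (x + z) - f x| ^+ p + `|g (x + z) - g x| ^+ p))%R)).
  apply: le_lint => //.
  - by apply: mX; exact: measurable_funD.
  - by apply: measurable_funM => //; apply: measurable_funD; exact: mX.
  - move=> x; rewrite opprD addrACA.
    apply: le_trans (exprD_le _ (normr_ge0 _) (normr_ge0 _)).
    by rewrite lerXn2r// ?nnegrE ?addr_ge0// ler_normD.
rewrite lintZ ?lintD ?exprn_ge0//; do ?exact: mX.
- apply: (@le_trans _ _ ((2 ^+ p)%:E * ((e / (2 ^+ p * 2))%:E + (e / (2 ^+ p * 2))%:E))%E).
    by rewrite lee_pmul2l// ?lte_fin ?exprn_gt0// leeD.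
  rewrite -EFinD -EFinM lee_fin.
  have : (2:R) ^+ p != 0 by rewrite expf_neq0.
  by move=> ?; rewrite le_eqVlt; apply/orP; left; apply/eqP; field.
- by apply: measurable_funD; exact: mX.
Qed.

Lemma transl_contZ (k : R) f : measurable_fun setT f ->
  transl_cont f -> transl_cont (fun x => k * f x).
Proof.
move=> mf cf e e0.
have k0 : 0 < `|k| ^+ p + 1 by rewrite ltr_pwDr// exprn_ge0.
have [d d0 fd] := cf _ (divr_gt0 e0 k0); exists d => // z /fd fz.
rewrite (_ : (fun x => _) = fun x => `|k| ^+ p * `|f (x + z) - f x| ^+ p); last first.
  by apply/funext => x; rewrite -mulrBr normrM exprMn.
rewrite lintZ ?exprn_ge0//.
- apply: (@le_trans _ _ ((`|k| ^+ p)%:E * (e / (`|k| ^+ p + 1))%:E)%E).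
    by rewrite lee_wpmul2l// lee_fin exprn_ge0.
  rewrite -EFinM lee_fin mulrCA ger_pMr// ler_pdivrMr// mul1r lerDl//.
- by apply: measurable_distX => //; exact: measurable_fun_shift.
Qed.

Lemma transl_cont_sum (I : Type) (s : seq I) (f_ : I -> Rn -> R) :
  (forall i, measurable_fun setT (f_ i)) -> (forall i, transl_cont (f_ i)) ->
  transl_cont (fun x => \sum_(i <- s) f_ i x).
Proof.
move=> mf cf; elim: s => [|i s IHs].
  move=> e e0; exists 1 => // z _; rewrite (_ : (fun x => _) = cst 0).
    by rewrite /lint integral0 lee_fin ltW.
  by apply/funext => x; rewrite !big_nil subrr normr0 expr0n gtn_eqF.
rewrite (_ : (fun x => _) = fun x => f_ i x + \sum_(j <- s) f_ j x).
  by apply: transl_contD => //; exact: measurable_sum.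
by apply/funext => x; rewrite big_cons.
Qed.

(** The difference [f (x + z) - f x] passes through [g (x + z)] and [g x]; translation invariance
    makes the two outer errors equal. *)
Lemma transl_cont_approx f : measurable_fun setT f ->
  (forall e : R, 0 < e -> exists g, [/\ measurable_fun setT g, transl_cont g &
    (lint mu (fun x : Rn => `|f x - g x| ^+ p)%R <= e%:E)%E]) -> transl_cont f.
Proof.
move=> mf fg e e0.
(* Three integrals have to be controlled, and each of the two splittings of a sum costs a factor
   [2 ^+ p]. *)
have e'0 : 0 < e / (4 ^+ p * 3) by rewrite divr_gt0// mulr_gt0// exprn_gt0.
have [g [mg cg fge]] := fg _ e'0; have [d d0 gd] := cg _ e'0.
exists d => // z /gd gz.
have mfg : measurable_fun setT (fun x : Rn => `|f x - g x| ^+ p).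
  exact: measurable_distX.
have mg' : measurable_fun setT (fun x : Rn => `|g (x + z) - g x| ^+ p).
  by apply: measurable_distX => //; exact: measurable_fun_shift.
have mfgz : measurable_fun setT (fun x : Rn => `|f (x + z) - g (x + z)| ^+ p).
  exact: (measurable_fun_shift z mfg).
apply: (@le_trans _ _ (lint mu (fun x : Rn => 4 ^+ p * (`|f (x + z) - g (x + z)| ^+ p +
    (`|g (x + z) - g x| ^+ p + `|f x - g x| ^+ p)))%R)).
  apply: le_lint => //.
  - by apply: measurable_distX => //; exact: measurable_fun_shift.
  - apply: measurable_funM => //; apply: measurable_funD => //.
    exact: measurable_funD.
  - move=> x; apply: (@le_trans _ _ ((`|f (x + z) - g (x + z)| +
        (`|g (x + z) - g x| + `|f x - g x|)) ^+ p)).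
      rewrite lerXn2r// ?nnegrE ?addr_ge0//.
      rewrite (_ : f (x + z) - f x = (f (x + z) - g (x + z)) +
        ((g (x + z) - g x) - (f x - g x))); last by ring.
      rewrite (le_trans (ler_normD _ _))// lerD2l.
      by rewrite (le_trans (ler_normB _ _)).
    apply: le_trans (exprD_le _ _ _) _ => //.
    rewrite (_ : 4 = 2 * 2 :> R); last by ring.
    rewrite exprMn -mulrA ler_wpM2l ?exprn_ge0// mulrDr lerD//.
      by rewrite ler_peMl ?exprn_ge0// exprn_ege1// ler1n.
    exact: exprD_le.
rewrite lintZ ?lintD ?exprn_ge0//; first last.
- by apply: measurable_funD => //; exact: measurable_funD.
- exact: measurable_funD.
rewrite (lint_shift z mfg); last by move=> x; rewrite exprn_ge0.
set e' := e / _ in fge gz *.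
apply: (@le_trans _ _ ((4 ^+ p)%:E * (e'%:E + (e'%:E + e'%:E)))%E).
  by rewrite lee_pmul2l// ?lte_fin ?exprn_gt0// !leeD.
rewrite -!EFinD -EFinM lee_fin /e'.
have : (4:R) ^+ p != 0 by rewrite expf_neq0.
by move=> ?; rewrite le_eqVlt; apply/orP; left; apply/eqP; field.
Qed.

Lemma transl_cont_lim (f_ : (Rn -> R)^nat) f (h : Rn -> R) :
  (forall k, measurable_fun setT (f_ k)) -> measurable_fun setT f ->
  measurable_fun setT h ->
  (forall k x, `|f_ k x| <= h x) -> (lint mu (fun x : Rn => h x ^+ p)%R < +oo)%E ->
  (forall x, f_ ^~ x @ \oo --> f x) -> (forall k, transl_cont (f_ k)) ->
  transl_cont f.
Proof.
move=> mf_ mf mh f_h hp f_f cf_; apply: transl_cont_approx => // e e0.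
have [k ke] := lint_dominated mf_ mf mh p0 f_h hp f_f e0.
by exists (f_ k).
Qed.

End translation_continuity.

(** * Continuity of translations for every function in L^p *)

Section translation_continuity_Lp.
Context {R : realType} {n : nat}.
Local Notation Rn := 'rV[R]_n.
Local Notation mu := (lebesgue_rV R n).
Variable p : nat.
Hypothesis p0 : (0 < p)%N.

Lemma lint_indic (A : set Rn) : measurable A -> lint mu \1_A = mu A.
Proof. by move=> mA; rewrite /lint integral_indic// setIT. Qed.

(** If exactly one of [x] and [x + z] lies in [U], that point is at distance at most |z| from the
    complement. The points of [U] within 1/(m+1) of the complement form sets that decrease to the
    empty set, so their measures tend to 0. *)
Lemma transl_cont_open (U : set Rn) : open U -> (mu U < +oo)%E ->
  transl_cont p \1_U.
Proof.
move=> oU Uoo e e0.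
have mU : measurable U by exact: open_measurable_rV.
pose V (m : nat) : set Rn := [set x | forall y, `|y - x| < m.+1%:R^-1 -> U y].
have mV m : measurable (V m).
  rewrite -[V m]setCK; apply: measurableC; apply: open_measurable_rV.
  rewrite (_ : ~` V m = \bigcup_(y in ~` U) ball y m.+1%:R^-1).
    by apply: bigcup_open => y _; exact: ball_open.
  apply/seteqP; split => [x /existsNP[y /not_implyP[yx Uy]]|x [y Uy yx] Vx].
    by exists y => //; rewrite -ball_normE.
  by apply: Uy; apply: Vx; move: yx; rewrite -ball_normE.
have mUV m : measurable (U `\` V m) by exact: measurableD.
have : (mu \o (fun m => U `\` V m)) m @[m --> \oo] --> mu (\bigcap_m (U `\` V m)).
  apply: nonincreasing_cvg_mu => //.
  - by apply: le_lt_trans Uoo; apply: le_measure; rewrite ?inE//; exact: mUV.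
  - exact: bigcapT_measurable.
  - move=> k m km; apply/subsetPset => x [Ux Vx]; split => //.
    apply: contra_not Vx => Vx y yx; apply: Vx; apply: lt_le_trans yx _.
    by rewrite lef_pV2 ?posrE// ler_nat.
rewrite (_ : \bigcap_m _ = set0); last first.
  rewrite -subset0 => x UVx; have Ux : U x by have [] := UVx 0%N I.
  have /nbhs_ballP[r /= r0 rU] := oU _ Ux.
  have [m _ me] := near_infty_natSinv_lt (PosNum r0).
  have [_] := UVx m I; apply => y yx; apply: rU; rewrite -ball_normE /= distrC.
  exact: lt_trans yx (me m (leqnn _)).
rewrite measure0 => /fine_cvgP[[k1 _ k1f] /cvgrPdist_le/(_ (e / 2))].
rewrite divr_gt0// => /(_ isT)[k2 _ k2e].
pose k := maxn k1 k2.
have Vk : (mu (U `\` V k) <= (e / 2)%:E)%E.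
  have := k1f k (leq_maxl _ _); rewrite /= => ?.
  rewrite -[X in (X <= _)%E]fineK// lee_fin.
  have := k2e k (leq_maxr _ _); rewrite /= sub0r normrN.
  exact/le_trans/ler_norm.
exists k.+1%:R^-1 => // z zk.
have mUVz : measurable_fun setT (fun x : Rn => \1_(U `\` V k) (x + z) : R).
  by apply: measurable_fun_shift; exact: measurable_indic.
apply: (@le_trans _ _ (lint mu
    (fun x : Rn => \1_(U `\` V k) x + \1_(U `\` V k) (x + z))%R)).
  apply: le_lint => //.
  - by apply: measurable_distX => //; apply: measurable_fun_shift;
      exact: measurable_indic.
  - by apply: measurable_funD => //; exact: measurable_indic.
  - move=> x; rewrite !indicE.
    have [Ux|Ux] := boolP (x \in U); have [Uz|Uz] := boolP (x + z \in U);
      rewrite ?subrr ?normr0 ?expr0n ?gtn_eqF ?addr_ge0//.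
    + have -> : x \in U `\` V k.
        rewrite inE; split; first by rewrite -in_setE.
        by move=> Vx; move/negP: Uz; apply; rewrite inE; apply: Vx;
          rewrite addrAC subrr add0r.
      by rewrite sub0r normrN normr1 expr1n lerDl.
    + have -> : x + z \in U `\` V k.
        rewrite inE; split; first by rewrite -in_setE.
        move=> Vx; move/negP: Ux; apply; rewrite inE; apply: Vx.
        by rewrite opprD addrA subrr sub0r normrN.
      by rewrite subr0 normr1 expr1n lerDr.
rewrite lintD//.
rewrite (lint_shift z (f := \1_(U `\` V k)))//.
by rewrite lint_indic// (splitr e) EFinD leeD.
Qed.

Lemma ball_lty (r : R) : (mu (ball (0%R : Rn) r) < +oo)%E.
Proof.
have [r0|r0] := leP r 0.
  rewrite (_ : ball _ _ = set0) ?measure0// -subset0 => x; rewrite -ball_normE /=.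
  by rewrite ltNge (le_trans r0).
have mb := open_measurable_rV (ball_open (0 : Rn) r).
pose a : Rn := const_mx (- r); pose b : Rn := const_mx r.
have := @lebesgue_rV_box R n a b.
have : forall i, a ord0 i <= b ord0 i by move=> i; rewrite !mxE; lra.
move=> ab /(_ ab); set B := (X in mu X) => Bb.
have mB : measurable B.
  rewrite (_ : B = \bigcap_(i in [set: 'I_n])
      ((fun x : Rn => x ord0 i) @^-1` `[a ord0 i, b ord0 i]%classic)).
    apply: fin_bigcap_measurable => // i _.
    by rewrite -[X in measurable X]setTI; exact: measurable_coord.
  by apply/seteqP; split => x /= xab i => [_|]; [exact: xab|exact: (xab i I)].
apply: (@le_lt_trans _ _ (mu B)); last by rewrite Bb ltry.
apply: le_measure; rewrite ?inE// => x; rewrite -ball_normE /= sub0r normrN => xr i.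
by rewrite !mxE in_itv/= -ler_norml (le_trans (rV_coord_le x i))// ltW.
Qed.

(** The pi-lambda theorem, starting from open sets. Cutting to a fixed [B] of finite measure keeps
    all indicators p-integrable and turns complements into differences from [\1_B]. *)
Lemma transl_cont_indic_setI (B A : set Rn) : open B -> (mu B < +oo)%E ->
  measurable A -> transl_cont p \1_(A `&` B).
Proof.
move=> oB Boo.
have mB : measurable B by exact: open_measurable_rV.
(* The pi-lambda theorem needs a generating family stable under intersection: the open sets generate
   the coordinate sigma-algebra too. *)
have mopen : @measurable _ Rn = <<s [set U : set Rn | open U] >>.
  apply/seteqP; split; last first.
    apply: smallest_sub; first exact: sigma_algebra_measurable.
    by move=> U /open_measurable_rV.
  apply: smallest_sub; first exact: smallest_sigma_algebra.
  rewrite -bigcup_seq => C [i _ [D mD <-]] /=; rewrite setTI.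
  have : (@lebesgue_stieltjes_measure.ocitv R).-sigma.-measurable D by exact: mD.
  rewrite RGenOpens.measurableE; move: D {mD}.
  apply: smallest_sub => [|_ [a [b ->]]]; last first.
    apply: sub_sigma_algebra => /=.
    move/continuousP : (@coord_continuous R 1 n ord0 i); apply.
    exact: interval_open.
  split => [|D|F].
  - by rewrite /= preimage_set0; exact: sigma_algebra0.
  - by move=> /= D0; rewrite setTD preimage_setC -setTD; exact: sigma_algebraCD.
  - by move=> /= D0; rewrite preimage_bigcup; exact: sigma_algebra_bigcup.
move=> mA; have := mA; rewrite mopen; move: A {mA}.
apply: (@dynkin_induction _ Rn _ (fun A => transl_cont p \1_(A `&` B)) mopen).
- by move=> U V /= oU oV; exact: openI.
- by rewrite setTI; exact: transl_cont_open.
- move=> U /= oU; apply: transl_cont_open; first exact: openI.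
  apply: le_lt_trans Boo; apply: le_measure; rewrite ?inE//.
  by apply: measurableI => //; exact: open_measurable_rV.
- move=> S mS cS.
  rewrite (_ : \1_(_) = (fun x => \1_B x + (-1) * \1_(S `&` B) x)).
    apply: transl_contD => //.
    - by apply: measurable_funM => //; apply: measurable_indic; exact: measurableI.
    - exact: transl_cont_open.
    - by apply: transl_contZ => //; apply: measurable_indic; exact: measurableI.
  apply/funext => x; rewrite mulN1r !indicE !in_setI in_setC.
  by case: (x \in S); case: (x \in B) => /=; rewrite ?subrr ?subr0.
- move=> F mF tF cF.
  have mFB k : measurable (F k `&` B) by exact: measurableI.
  (* By disjointness the partial sums are indicators of finite unions cut to [B]; all are bounded by
     [\1_B], so they converge dominatedly. *)
  pose f_ N (x : Rn) := \sum_(0 <= i < N) (\1_(F i `&` B) x : R).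
  have f_1 N x : f_ N x = \1_((\bigcup_(i in [set k | (k < N)%N]) F i) `&` B) x.
    rewrite /f_ big_mkord.
    elim: N => [|N IHN].
      rewrite big_ord0 indicE memNset//= => -[[i /=]]; by rewrite ltn0.
    rewrite big_ord_recr /= IHN !indicE !in_setI.
    have [Bx|_] := boolP (x \in B); last by rewrite !andbF addr0.
    rewrite !andbT.
    have [Fx|Fx] := boolP (x \in F N).
      rewrite memNset ?add0r ?mem_set//.
        by exists N => /=; [exact: ltnSn|move: Fx; rewrite inE].
      move=> [i /= iN Fi]; move/trivIsetP : tF => /(_ i N I I).
      rewrite (ltn_eqF iN) => /(_ isT) E.
      by have : (F i `&` F N) x; [split => //; move: Fx; rewrite inE|rewrite E].
    rewrite addr0; congr (_%:R); congr nat_of_bool; apply/idP/idP; rewrite !inE.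
      by move=> [i /= iN Fi]; exists i => //=; exact: ltnW.
    move=> [i /=]; rewrite ltnS leq_eqVlt => /predU1P[-> FNx|iN Fi].
      by move/negP: Fx; rewrite inE.
    by exists i.
  have mf_ N : measurable_fun setT (f_ N).
    by apply: measurable_sum => i; exact: measurable_indic.
  apply: (@transl_cont_lim _ _ _ p0 f_ _ \1_B) => //.
  - by apply: measurable_indic; apply: measurableI => //; exact: bigcupT_measurable.
  - move=> N x; rewrite f_1 ger0_norm// !indicE in_setI.
    by rewrite ler_nat; case: (x \in B); rewrite ?andbF// andbT leq_b1.
  - rewrite (_ : (fun x => _) = \1_B) ?lint_indic//.
    by apply/funext => x; rewrite indicE; case: (x \in B); rewrite ?expr1n ?expr0n ?gtn_eqF.
  - move=> x; apply: cvg_near_cst.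
    have [[k _ Fk]|NF] := pselect ((\bigcup_k F k) x).
      exists k.+1 => // N /= kN; rewrite f_1 !indicE !in_setI.
      congr (nat_of_bool (_ && _))%:R.
      by apply/idP/idP; rewrite !inE => _; exists k.
    apply: nearW => N; rewrite f_1 !indicE !in_setI.
    congr (nat_of_bool (_ && _))%:R.
    by apply/idP/idP; rewrite !inE => -[i _ Fi]; exfalso; apply: NF; exists i.
  - by move=> N; apply: transl_cont_sum => // i; exact: measurable_indic.
Qed.

Import HBNNSimple.

(** Positive and negative parts are treated separately. Each is the limit of simple functions cut
    off to growing balls and is itself a majorant for them; a cut-off simple function is a finite
    combination of indicators of sets inside a ball. *)
Lemma transl_cont_Lp (f : Rn -> R) : measurable_fun setT f ->
  (lint mu (fun x => `|f x| ^+ p)%R < +oo)%E -> transl_cont p f.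
Proof.
suff H (g : Rn -> R) : measurable_fun setT g -> (forall x, 0 <= g x) ->
    (lint mu (fun x => g x ^+ p)%R < +oo)%E -> transl_cont p g.
  move=> mf fp.
  rewrite (_ : f = fun x => Num.max (f x) 0 + (-1) * Num.max (- f x) 0); last first.
    apply/funext => x; rewrite mulN1r; have [f0|f0] := leP 0 (f x).
      by rewrite max_r ?subr0// oppr_le0.
    by rewrite max_l ?opprK ?add0r// oppr_ge0 ltW.
  have mpos (h : Rn -> R) : measurable_fun setT h ->
    measurable_fun setT (fun x => Num.max (h x) 0).
    by move=> mh; apply: measurable_maxr => //; exact: measurable_cst.
  have mNf : measurable_fun setT (fun x => - f x) by exact: measurableT_comp.
  have cpos (h : Rn -> R) : measurable_fun setT h -> (forall x, `|h x| = `|f x|) ->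
      transl_cont p (fun x => Num.max (h x) 0).
    move=> mh hf; apply: H; first exact: mpos.
      by move=> x; rewrite le_max lexx orbT.
    apply: le_lt_trans fp; apply: le_lint.
    - by apply: measurable_funX; exact: mpos.
    - by apply: measurable_funX; exact: measurableT_comp.
    - by move=> x; rewrite exprn_ge0// le_max lexx orbT.
    - move=> x; rewrite lerXn2r ?nnegrE ?le_max ?lexx ?orbT//.
      by rewrite -hf ge_max ler_norm normr_ge0.
  apply: transl_contD => //.
  - exact: mpos.
  - by apply: measurable_funM => //; exact: mpos.
  - exact: cpos.
  - by apply: transl_contZ => //; [exact: mpos|apply: cpos => // x; rewrite normrN].
move=> mg g0 gp.
have mg' : measurable_fun setT (EFin \o g) by exact/measurable_EFinP.
pose B k := ball (0 : Rn) k%:R.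
have mB k : measurable (B k) by apply: open_measurable_rV; exact: ball_open.
pose s := nnsfun_approx measurableT mg'.
have sg k x : s k x <= g x.
  rewrite -lee_fin.
  rewrite /s nnsfun_approxE; apply: le_approx => // y _.
  by rewrite lee_fin.
have sE k x : s k x * \1_(B k) x =
    \sum_(y <- finmap.enum_fset (fset_set (range (s k)))) y * \1_(s k @^-1` [set y] `&` B k) x.
  rewrite {1}fimfunE fsbig_finite// big_distrl /=; apply: eq_bigr => y _.
  by rewrite -mulrA; congr (_ * _); rewrite !indicE in_setI -natrM mulnb.
apply: (@transl_cont_lim _ _ _ p0 (fun k x => s k x * \1_(B k) x) _ g) => //.
- by move=> k; apply: measurable_funM => //; exact: measurable_indic.
- move=> k x; rewrite ger0_norm ?mulr_ge0//.
  by rewrite (le_trans _ (sg k x))// ler_piMr// indicE lern1 leq_b1.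
- move=> x.
  rewrite -[g x]mulr1; apply: cvgM.
    have /fine_cvgP[_] : (EFin \o (fun k => s k x)) k @[k --> \oo] --> (g x)%:E.
      by apply: (cvg_nnsfun_approx measurableT mg') => // y _; rewrite /= lee_fin.
    exact.
  apply: cvg_near_cst.
  exists (Num.truncn `|x|).+1 => // k /= xk; rewrite indicE mem_set// /B -ball_normE /=.
  rewrite sub0r normrN (lt_le_trans (truncnS_gt _))// ler_nat//.
- move=> k; rewrite (_ : (fun x : Rn => s k x * \1_(B k) x) = fun x =>
    \sum_(y <- finmap.enum_fset (fset_set (range (s k)))) y * \1_(s k @^-1` [set y] `&` B k) x); last first.
    by apply/funext => x; exact: sE.
  apply: transl_cont_sum => // y.
    by apply: measurable_funM => //; apply: measurable_indic; exact: measurableI.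
  apply: transl_contZ => //; first by apply: measurable_indic; exact: measurableI.
  by apply: transl_cont_indic_setI => //; [exact: ball_open|exact: ball_lty].
Qed.
End translation_continuity_Lp.

(** * Directional derivatives as derivatives along lines *)

Section directional_derivatives.
Context {R : realType} {V : normedModType R}.
Implicit Types (f g : V -> R) (x v b : V).

(** Reduces directional derivatives, the only ones that [smooth] provides, to one real variable,
    where the chain rule and the mean value theorem apply. *)
Lemma is_derive_line f x v (t df : R) :
  is_derive (x + t *: v) v f df <-> is_derive t 1 (fun s : R => f (x + s *: v)) df.
Proof.
pose g (s : R) := f (x + s *: v).
have E : (fun h : R => h^-1 *: ((f \o shift (x + t *: v)) (h *: v) - f (x + t *: v))) =
    (fun h : R => h^-1 *: ((g \o shift t) (h *: (1 : R)) - g t)).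
  apply/funext => h; rewrite /g /=; congr (_ *: (f _ - _)).
  by rewrite scalerDl addrCA /GRing.scale /= mulr1.
have D : derivable f (x + t *: v) v = derivable g t 1 by rewrite /derivable E.
have dE : 'D_v f (x + t *: v) = 'D_1 g t by rewrite /derive E.
by split=> -[d1 d2]; split; [rewrite -D|rewrite -dE|rewrite D|rewrite dE].
Qed.

Lemma is_derive_lineP f x v (df : R) :
  is_derive x v f df <-> is_derive (0:R) 1 (fun s : R => f (x + s *: v)) df.
Proof. by rewrite -is_derive_line scale0r addr0. Qed.

Lemma is_derive_scale f x v (a df : R) : is_derive x v f df ->
  is_derive x (a *: v) f (df * a).
Proof.
move=> /is_derive_lineP fd; apply/is_derive_lineP.
rewrite (_ : (fun s => _) = (fun s : R => f (x + s *: v)) \o ( *%R a)); last first.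
  by apply/funext => s /=; rewrite scalerA mulrC.
apply: is_derive1_comp; first by rewrite mulr0.
have := @is_deriveZ R R^o R^o id a 0 1 1 (is_derive_id _ _).
by rewrite /GRing.scale /= mulr1.
Qed.

Lemma is_derive_affine f x v b (a df : R) : is_derive (a *: x + b) v f df ->
  is_derive x v (fun y => f (a *: y + b)) (a * df).
Proof.
move=> /(is_derive_scale a) /is_derive_lineP fd; apply/is_derive_lineP.
rewrite mulrC (_ : (fun s => _) = fun s : R => f (a *: x + b + s *: (a *: v)))//.
apply/funext => s; congr f.
by rewrite scalerDr !scalerA (mulrC a) addrAC.
Qed.

(** Locating [s] by its absolute value lets one statement cover both signs of [t]. *)
Lemma mean_value_line f x v (t : R) : (forall y, derivable f y v) ->
  exists s : R, `|s| <= `|t| /\ f (x + t *: v) - f x = t * 'D_v f (x + s *: v).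
Proof.
move=> fv; pose g (s : R) := f (x + s *: v).
have dg (s : R) : is_derive s 1 g ('D_v f (x + s *: v)).
  by apply/is_derive_line; exact: derivableP.
have cg : continuous g.
  by move=> s; apply: differentiable_continuous; apply/derivable1_diffP; case: (dg s).
have [t0|/ltW t0] := leP 0 t.
  have [s] := MVT_segment t0 (fun s _ => dg s) (continuous_subspaceT cg).
  rewrite in_itv/= => /andP[s0 st] E; exists s; split.
    by rewrite !ger0_norm.
  by move: E; rewrite /g scale0r addr0 subr0 mulrC.
have [s] := MVT_segment t0 (fun s _ => dg s) (continuous_subspaceT cg).
rewrite in_itv/= => /andP[s0 st] E; exists s; split.
  by rewrite !ler0_norm// lerN2.
by move: E; rewrite /g scale0r addr0 sub0r => E; rewrite -[LHS]opprB E; ring.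
Qed.

End directional_derivatives.

(** * Smooth functions: products, affine substitutions, symmetry of second derivatives *)

Section smooth_functions.
Context {R : realType} {n : nat}.
Local Notation Rn := 'rV[R]_n.
Implicit Types f g : Rn -> R.

Definition has_partials f := forall (j : 'I_n) x, derivable f x (delta_mx ord0 j).

Lemma is_derive_partial f j x : has_partials f ->
  is_derive x (delta_mx ord0 j) f (partial j f x).
Proof. by move=> fp; exact: derivableP. Qed.

(** The recursion peels off the derivative that is taken first, whereas [iter_partial] adds new ones
    outside. In this order the product rule feeds directly into an induction hypothesis. *)
Fixpoint Ck (k : nat) f : Prop :=
  match k with
  | 0%N => continuous f
  | k'.+1 => [/\ continuous f, has_partials f & forall j, Ck k' (partial j f)]
  end.

Lemma smooth_continuous f : smooth f -> continuous f.
Proof. by move=> /(_ [::])[]. Qed.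

Lemma smooth_has_partials f : smooth f -> has_partials f.
Proof. by move=> /(_ [::])[]. Qed.

Lemma smooth_partial j f : smooth f -> smooth (partial j f).
Proof. by move=> sf s; have := sf (rcons s j); rewrite /iter_partial foldr_rcons. Qed.

Lemma smoothP f : smooth f <-> forall k, Ck k f.
Proof.
split=> [sf k|Cf s].
  elim: k f sf => [|k IHk] f sf; first exact: smooth_continuous.
  split=> [||j]; [exact: smooth_continuous|exact: smooth_has_partials|].
  by apply: IHk; exact: smooth_partial.
elim/last_ind: s f Cf => [|s j IHs] f Cf; first by have [] := Cf 1%N.
rewrite /iter_partial foldr_rcons; apply: IHs => k.
by have [_ _] := Cf k.+1; apply.
Qed.

Lemma CkW k f : Ck k.+1 f -> Ck k f.
Proof.
elim: k f => [|k IHk] f; first by case.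
by move=> [cf fp Cf]; split => // j; apply: IHk.
Qed.

Lemma partial_eq f df j : (forall x, is_derive x (delta_mx ord0 j) f (df x)) ->
  partial j f = df.
Proof. by move=> fd; apply/funext => x; case: (fd x). Qed.

Lemma is_derive_partialD f g j x : has_partials f -> has_partials g ->
  is_derive x (delta_mx ord0 j) (fun y => f y + g y) (partial j f x + partial j g x).
Proof.
by move=> fp gp; apply: (@is_deriveD _ _ _ f g); exact: is_derive_partial.
Qed.

Lemma is_derive_partialM f g j x : has_partials f -> has_partials g ->
  is_derive x (delta_mx ord0 j) (fun y => f y * g y)
    (partial j f x * g x + f x * partial j g x).
Proof.
move=> fp gp; rewrite addrC [_ * g x]mulrC.
by apply: (@is_deriveM _ _ f g); exact: is_derive_partial.
Qed.

Lemma is_derive_partial_affine f j (a : R) b x : has_partials f ->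
  is_derive x (delta_mx ord0 j) (fun y => f (a *: y + b))
    (a * partial j f (a *: x + b)).
Proof. by move=> fp; apply: is_derive_affine; exact: is_derive_partial. Qed.

Lemma partial_cst (c : R) j : partial j (cst c : Rn -> R) = cst 0.
Proof. by apply: partial_eq => x; exact: is_derive_cst. Qed.

Lemma Ck_cst k (c : R) : Ck k (cst c).
Proof.
elim: k c => [|k IHk] c /=; first exact: cst_continuous.
split=> [|j x|j]; [exact: cst_continuous|exact: derivable_cst|].
by rewrite partial_cst; exact: IHk.
Qed.

Lemma CkD k f g : Ck k f -> Ck k g -> Ck k (fun x => f x + g x).
Proof.
elim: k f g => [|k IHk] f g /=; first by move=> cf cg x; apply: (continuousD (cf x) (cg x)).
move=> [cf fp Cf] [cg gp Cg]; split=> [|j x|j].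
- by move=> x; apply: (continuousD (cf x) (cg x)).
- by case: (is_derive_partialD j x fp gp).
- rewrite (partial_eq (fun x => is_derive_partialD j x fp gp)).
  exact: IHk.
Qed.

Lemma CkM k f g : Ck k f -> Ck k g -> Ck k (fun x => f x * g x).
Proof.
elim: k f g => [|k IHk] f g; first by move=> cf cg x; apply: (continuousM (cf x) (cg x)).
move=> Cf' Cg'; have [cf fp Cf] := Cf'; have [cg gp Cg] := Cg'; split=> [|j x|j].
- by move=> x; apply: (continuousM (cf x) (cg x)).
- by case: (is_derive_partialM j x fp gp).
- rewrite (partial_eq (fun x => is_derive_partialM j x fp gp)).
  by apply: CkD; apply: IHk; do ?[exact: Cf|exact: Cg|exact: CkW].
Qed.

Lemma Ck_affine k f (a : R) b : Ck k f -> Ck k (fun x => f (a *: x + b)).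
Proof.
have ca : continuous (fun x : Rn => a *: x + b).
  move=> x; apply: (@continuousD _ _ _ (fun x : Rn => a *: x) (cst b)).
    exact: scaler_continuous.
  exact: cst_continuous.
elim: k f => [|k IHk] f.
  by move=> cf x; apply: (continuous_comp (ca x)); exact: cf.
move=> [cf fp Cf]; split=> [|j x|j].
- by move=> x; apply: (continuous_comp (ca x)); exact: cf.
- by case: (is_derive_partial_affine j a b x fp).
- rewrite (partial_eq (fun x => is_derive_partial_affine j a b x fp)).
  by apply: CkM; [exact: Ck_cst|by apply: IHk; exact: Cf].
Qed.

Lemma smooth_cst (c : R) : smooth (cst c : Rn -> R).
Proof. by apply/smoothP => k; exact: Ck_cst. Qed.

Lemma smoothM f g : smooth f -> smooth g -> smooth (fun x => f x * g x).
Proof. by move=> /smoothP Cf /smoothP Cg; apply/smoothP => k; exact: CkM. Qed.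

Lemma smooth_affine f (a : R) b : smooth f -> smooth (fun x => f (a *: x + b)).
Proof. by move=> /smoothP Cf; apply/smoothP => k; exact: Ck_affine. Qed.

Lemma smooth_prod (I : Type) (s : seq I) (P : pred I) (f_ : I -> Rn -> R) :
  (forall i, P i -> smooth (f_ i)) -> smooth (fun x => \prod_(i <- s | P i) f_ i x).
Proof.
move=> sf; elim: s => [|i s IHs].
  rewrite (_ : (fun x => _) = cst 1); first exact: smooth_cst.
  by apply/funext => x; rewrite big_nil.
rewrite (_ : (fun x => _) = if P i then fun x => f_ i x * \prod_(k <- s | P k) f_ k x
    else fun x => \prod_(k <- s | P k) f_ k x); last first.
  by case: ifPn => Pi; apply/funext => x; rewrite big_cons ?Pi ?(negbTE Pi).
case: ifPn => [Pi|_]; last exact: IHs.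
by apply: smoothM; [exact: sf|exact: IHs].
Qed.

Lemma partialM f g j x : has_partials f -> has_partials g ->
  partial j (fun y => f y * g y) x = partial j f x * g x + f x * partial j g x.
Proof. by move=> fp gp; case: (is_derive_partialM j x fp gp). Qed.

Lemma partial_affine f j (a : R) b x : has_partials f ->
  partial j (fun y => f (a *: y + b)) x = a * partial j f (a *: x + b).
Proof. by move=> fp; case: (is_derive_partial_affine j a b x fp). Qed.

Lemma partial_prod (I : eqType) (s : seq I) (f_ : I -> Rn -> R) j x : uniq s ->
  (forall i, smooth (f_ i)) ->
  partial j (fun y => \prod_(i <- s) f_ i y) x =
  \sum_(i <- s) partial j (f_ i) x * \prod_(k <- s | k != i) f_ k x.
Proof.
move=> + sf; elim: s => [_|i s IHs /= /andP[iNs us]].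
  rewrite big_nil (_ : (fun y => _) = cst 1) ?partial_cst//.
  by apply/funext => y; rewrite big_nil.
rewrite (_ : (fun y => _) = fun y => f_ i y * \prod_(k <- s) f_ k y); last first.
  by apply/funext => y; rewrite big_cons.
have sp := smooth_prod s (P := xpredT) (fun i _ => sf i).
rewrite (partialM j x (smooth_has_partials (sf i)) (smooth_has_partials sp)).
rewrite (IHs us) big_cons big_cons eqxx /=; congr (_ * _ + _).
  rewrite [RHS]big_seq_cond [LHS]big_seq; apply: eq_bigl => k.
  case: (boolP (k \in s)) => //= ks; apply/esym; by apply: contraNneq iNs => <-.
rewrite big_distrr /= big_seq [RHS]big_seq; apply: eq_bigr => k ks.
by rewrite big_cons (eq_sym i) (memPn iNs)// mulrCA.
Qed.

Lemma norm_delta_le (j : 'I_n) : `|delta_mx ord0 j : Rn| <= 1.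
Proof.
apply: rV_norm_le => [|i]; first exact: ler01.
rewrite mxE normr_nat lern1; exact: leq_b1.
Qed.

(** Two mean value steps: one in direction [j] for the increment of [f] in direction [i], then one
    in direction [i] for [partial j f]. *)
Lemma second_difference f i j (h : R) x : smooth f ->
  exists p : Rn, `|x - p| <= `|h| * 2 /\
    f (x + h *: delta_mx ord0 i + h *: delta_mx ord0 j) - f (x + h *: delta_mx ord0 i)
      - f (x + h *: delta_mx ord0 j) + f x = h * (h * partial i (partial j f) p).
Proof.
move=> sf; set ei : Rn := delta_mx ord0 i; set ej : Rn := delta_mx ord0 j.
have fp := smooth_has_partials sf.
pose g (y : Rn) := f (1 *: y + h *: ei) - f y.
pose dg (y : Rn) := 1 * partial j f (1 *: y + h *: ei) - partial j f y.
have gd y : is_derive y ej g (dg y).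
  exact: (is_deriveB (is_derive_partial_affine j 1 (h *: ei) y fp) (is_derive_partial j y fp)).
have [s [sh Es]] := @mean_value_line _ _ g x ej h (fun y => @ex_derive _ _ _ _ _ _ _ (gd y)).
have [t [th Et]] := @mean_value_line _ _ (partial j f) (x + s *: ej) ei h
  (@smooth_has_partials _ (smooth_partial j sf) i).
exists (x + s *: ej + t *: ei); split.
  rewrite !opprD !addrA subrr sub0r -opprD normrN mulr2n mulrDr mulr1.
  apply: le_trans (ler_normD _ _) _; rewrite !normrZ.
  by apply: lerD; [apply: le_trans sh|apply: le_trans th]; rewrite ler_piMr// norm_delta_le.
transitivity (g (x + h *: ej) - g x).
  rewrite /g !scale1r [x + h *: ej + _]addrAC.
  move: (f (x + h *: ei + h *: ej)) (f (x + h *: ei)) (f (x + h *: ej)) (f x).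
  by move=> *; ring.
rewrite Es -[X in h * X = _]/(partial j g _) (partial_eq gd) /dg mul1r scale1r.
by rewrite Et.
Qed.

(** The second difference is symmetric in [i] and [j], so the two mixed derivatives agree when taken
    at suitable points [p] and [q] within [2 |h|] of [x]; continuity identifies them at [x]. *)
Lemma schwarz f i j : smooth f -> partial i (partial j f) = partial j (partial i f).
Proof.
move=> sf; apply/funext => x; apply/eqP; rewrite -subr_eq0 -normr_le0.
apply/ler_addgt0Pl => e e0; rewrite addr0.
have e2 : 0 < e / 2 by rewrite divr_gt0.
have c1 := @smooth_continuous _ (smooth_partial i (smooth_partial j sf)) x.
have c2 := @smooth_continuous _ (smooth_partial j (smooth_partial i sf)) x.
have /cvgrPdist_le/(_ _ e2)/nbhs_ballP[d1 /= d10 D1] := c1.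
have /cvgrPdist_le/(_ _ e2)/nbhs_ballP[d2 /= d20 D2] := c2.
pose h := Num.min d1 d2 / 4.
have h0 : 0 < h by rewrite divr_gt0// lt_min d10.
have hd1 : `|h| * 2 < d1.
  have m1 : Num.min d1 d2 <= d1 by rewrite ge_min lexx.
  by rewrite gtr0_norm// /h; lra.
have hd2 : `|h| * 2 < d2.
  have m2 : Num.min d1 d2 <= d2 by rewrite ge_min lexx orbT.
  by rewrite gtr0_norm// /h; lra.
have [p [px Ep]] := second_difference i j h x sf.
have [q [qx Eq]] := second_difference j i h x sf.
have E : partial i (partial j f) p = partial j (partial i f) q.
  apply: (mulfI (lt0r_neq0 h0)); apply: (mulfI (lt0r_neq0 h0)).
  apply: (etrans (esym Ep)); apply: etrans Eq.
  have -> := addrAC x (h *: delta_mx ord0 i) (h *: delta_mx ord0 j).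
  by rewrite -!addrA; congr (_ + _); rewrite addrA [X in X + _]addrC -addrA.
have := D1 p; rewrite -ball_normE /= => /(_ (le_lt_trans px hd1)).
have := D2 q; rewrite -ball_normE /= => /(_ (le_lt_trans qx hd2)).
rewrite -E; move: (partial i (partial j f) p) (partial i (partial j f) x) (partial j (partial i f) x).
move=> A B C; clear -e0; rewrite !ler_norml => /andP[? ?] /andP[? ?]; apply/andP; split; lra.
Qed.

End smooth_functions.

(** * Test functions as smooth functions of bounded support *)

Section test_functions.
Context {R : realType} {n : nat}.
Local Notation Rn := 'rV[R]_n.
Local Notation mu := (lebesgue_rV R n).
Implicit Types f g : Rn -> R.

(** A substitute for compactness of the closed support, equivalent to it in finite dimension and
    easier to carry through products and derivatives. *)
Definition bsupp f := exists r : R, forall x, f x != 0 -> `|x| <= r.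

Lemma bsuppW f g : (forall x, f x = 0 -> g x = 0) -> bsupp f -> bsupp g.
Proof.
move=> fg [r fr]; exists r => x gx; apply: fr.
by apply: contra_neq gx; exact: fg.
Qed.

Lemma closed_norm_le (r : R) : closed [set x : Rn | `|x| <= r].
Proof.
rewrite (_ : [set _ | _] = (fun x : Rn => `|x|) @^-1` [set y : R | y <= r])//.
apply: preimage_closed; last exact: closed_le.
by move=> x _; exact: norm_continuous.
Qed.

Lemma compact_norm_le (r : R) : compact [set x : Rn | `|x| <= r].
Proof.
apply: bounded_closed_compact; last exact: closed_norm_le.
exists r; split; first exact: num_real.
by move=> M rM x /= /le_trans; apply; exact: ltW.
Qed.

Lemma test_functionP f : test_function f <-> smooth f /\ bsupp f.
Proof.
split=> -[sf].
  move=> /compact_bounded [M [_ MM]]; split => //; exists (M + 1) => x fx.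
  by apply: MM; [rewrite ltrDl|exact: subset_closure].
move=> [r fr]; split => //.
apply: (@subclosed_compact _ _ [set x : Rn | `|x| <= r]).
- exact: closed_closure.
- exact: compact_norm_le.
- by rewrite closureE => x; apply; split; [exact: closed_norm_le|exact: fr].
Qed.

Lemma bsupp_bounded f : continuous f -> bsupp f ->
  exists2 M : R, 0 < M & forall x, `|f x| <= M.
Proof.
move=> cf [r fr].
have /compact_bounded[M [_ MM]] : compact (f @` [set x : Rn | `|x| <= r]).
  by apply: continuous_compact; [exact: continuous_subspaceT|exact: compact_norm_le].
exists (`|M| + 1) => [|x]; first by rewrite ltr_pwDr.
have [->|fx] := eqVneq (f x) 0; first by rewrite normr0 addr_ge0.
apply: MM; last by exists x => //; exact: fr.
by rewrite (le_lt_trans (ler_norm _))// ltrDl.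
Qed.

(** The complement of a closed ball is open, so [f] agrees with 0 near every point outside the
    ball. *)
Lemma bsupp_partial j f : bsupp f -> bsupp (partial j f).
Proof.
move=> [r fr]; exists r => x; apply: contraNT; rewrite -ltNge => rx.
rewrite /partial (@near_eq_derive _ _ _ f (cst 0)) ?derive_cst//.
have : open (~` [set y : Rn | `|y| <= r]) by apply: closed_openC; exact: closed_norm_le.
move=> oc; have Nx : (~` [set y : Rn | `|y| <= r]) x.
  by move=> /=; rewrite leNgt rx.
apply: filterS (oc _ Nx) => y yr; apply: contra_notP yr => /eqP; exact: fr.
Qed.

Lemma test_partial j f : test_function f -> test_function (partial j f).
Proof.
move=> /test_functionP[sf bf]; apply/test_functionP; split.
  exact: smooth_partial.
exact: bsupp_partial.
Qed.

Lemma testM f g : test_function f -> smooth g -> test_function (fun x => f x * g x).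
Proof.
move=> /test_functionP[sf bf] sg; apply/test_functionP; split.
  exact: smoothM.
by apply: bsuppW bf => x ->; rewrite mul0r.
Qed.

Lemma test_affine f (a : R) b : a != 0 -> test_function f ->
  test_function (fun x => f (a *: x + b)).
Proof.
move=> a0 /test_functionP[sf [r fr]]; apply/test_functionP; split.
  exact: smooth_affine.
exists ((r + `|b|) / `|a|) => x /fr xr.
rewrite ler_pdivlMr ?normr_gt0// mulrC -normrZ -[X in `|X|](addrK b).
by rewrite (le_trans (ler_normB _ _))// lerD2r.
Qed.

Lemma test_schwartz f : test_function f -> schwartz f.
Proof.
move=> tf; have /test_functionP[sf bf] := tf; split => // k s.
have [ss [r fr]] : smooth (iter_partial s f) /\ bsupp (iter_partial s f).
  elim: s => [//|j s [IH1 IH2]]; split; first exact: smooth_partial.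
  exact: bsupp_partial.
have [M M0 fM] := bsupp_bounded (@smooth_continuous _ _ _ ss) (ex_intro _ r fr).
apply: (@le_lt_trans _ _ (`|r| ^+ k * M)%:E); last by rewrite ltry.
apply: ge_ereal_sup => _ [x _ <-]; rewrite lee_fin.
have [->|fx] := eqVneq (iter_partial s f x) 0.
  by rewrite normr0 mulr0 mulr_ge0// ltW.
rewrite ler_pM ?exprn_ge0// lerXn2r// ?nnegrE// (le_trans (fr x fx))//.
exact: ler_norm.
Qed.

Lemma bsupp_lint f (M : R) : measurable_fun setT f -> bsupp f ->
  (forall x, `|f x| <= M) -> (lint mu (fun x => `|f x|)%R < +oo)%E.
Proof.
move=> mf [r fr] fM.
have M0 : 0 <= M by rewrite (le_trans _ (fM 0)).
have mB : measurable (ball (0 : Rn) (r + 1)).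
  by apply: open_measurable_rV; exact: ball_open.
apply: (@le_lt_trans _ _ (lint mu (fun x => M * \1_(ball (0 : Rn) (r + 1)) x)%R)).
  apply: le_lint => //.
  - exact: measurableT_comp.
  - by apply: measurable_funM.
  - move=> x; have [->|fx] := eqVneq (f x) 0.
      by rewrite normr0 mulr_ge0.
    rewrite indicE mem_set ?mulr1//.
    by rewrite -ball_normE /= sub0r normrN (le_lt_trans (fr x fx))// ltrDl.
rewrite lintZ// lint_indic// lte_mul_pinfty//.
exact: ball_lty.
Qed.

End test_functions.

(** * Fubini for iterated integrals with real values *)

Section real_fubini.
Context d1 d2 (T1 : measurableType d1) (T2 : measurableType d2) (R : realType).
Variables (m1 : {sigma_finite_measure set T1 -> \bar R})
  (m2 : {sigma_finite_measure set T2 -> \bar R}).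
Variable F : T1 * T2 -> R.
Hypothesis mF : measurable_fun setT F.
Hypothesis hF : (\int[m1]_x \int[m2]_y (`|F (x, y)|)%:E < +oo)%E.
Hypothesis F1 : forall x, m2.-integrable setT (fun y => (F (x, y))%:E).

Lemma integrable_prod_real : (m1 \x m2)%E.-integrable setT (EFin \o F).
Proof. by apply/integrable12ltyP => //; exact/measurable_EFinP. Qed.

(** Every slice is integrable, not just almost every one; hence [fine] is faithful for each [x] and
    no exceptional null set appears. *)
Lemma EFin_Rintegral2 x :
  (\int[m2]_y F (x, y))%:E = (\int[m2]_y (F (x, y))%:E)%E.
Proof. by rewrite /Rintegral fineK//; exact: integrable_fin_num. Qed.

Lemma integrable_Rintegral2 :
  m1.-integrable setT (fun x => (\int[m2]_y F (x, y))%:E).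
Proof.
rewrite (_ : (fun x => _) = fubini_F m2 (EFin \o F)).
  exact: integrable_fubini_F integrable_prod_real.
by apply/funext => x; rewrite EFin_Rintegral2.
Qed.

Lemma normr_Rintegral2 :
  ((`|\int[m1]_x \int[m2]_y F (x, y)|)%:E <=
   \int[m1]_x \int[m2]_y (`|F (x, y)|)%:E)%E.
Proof.
rewrite EFin_normr_Rintegral//; last exact: integrable_Rintegral2.
have mi := measurable_int _ integrable_Rintegral2.
apply: le_trans (le_abse_integral _ _ _) _ => //.
apply: ge0_le_integral => //.
- exact: measurableT_comp.
- have mF' : measurable_fun setT (fun z => (`|F z|)%:E).
    by apply/measurable_EFinP; exact: measurableT_comp.
  have F0 z : (0 <= (`|F z|)%:E)%E by rewrite lee_fin.
  exact: (measurable_fun_fubini_tonelli_F _ mF' F0).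
- move=> x _; rewrite EFin_Rintegral2.
  apply: le_trans (le_abse_integral _ _ _) _ => //.
  exact: measurable_int (F1 x).
Qed.

Lemma Rintegral_swap :
  (forall y, m1.-integrable setT (fun x => (F (x, y))%:E)) ->
  \int[m1]_x \int[m2]_y F (x, y) = \int[m2]_y \int[m1]_x F (x, y).
Proof.
move=> F2; rewrite /Rintegral; congr fine.
transitivity (\int[m1]_x \int[m2]_y (F (x, y))%:E)%E.
  by apply: eq_integral => x _; rewrite fineK//; exact: integrable_fin_num.
rewrite (Fubini integrable_prod_real).
by apply: eq_integral => x _; rewrite fineK//; exact: integrable_fin_num.
Qed.

End real_fubini.

Lemma integrable_Rintegral1 d1 d2 (T1 : measurableType d1) (T2 : measurableType d2)
    (R : realType) (m1 : {sigma_finite_measure set T1 -> \bar R})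
    (m2 : {sigma_finite_measure set T2 -> \bar R}) (F : T1 * T2 -> R) :
  measurable_fun setT F -> (\int[m1]_x \int[m2]_y (`|F (x, y)|)%:E < +oo)%E ->
  (forall y, m1.-integrable setT (fun x => (F (x, y))%:E)) ->
  m2.-integrable setT (fun y => (\int[m1]_x F (x, y))%:E).
Proof.
move=> mF hF F2; have mF' : measurable_fun setT (EFin \o F) by exact/measurable_EFinP.
apply: (@integrable_Rintegral2 _ _ _ _ _ m2 m1 (fun z => F (z.2, z.1))) => //.
  by apply: (measurableT_comp mF); exact: measurable_fun_pair.
have H := (integrable21ltyP m1 m2 mF').1 (integrable_prod_real mF hF).
exact: H.
Qed.

(** * L^p functions with natural exponents and their local integrability *)

Section Lp_functions.
Context {R : realType} {n : nat}.
Local Notation Rn := 'rV[R]_n.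
Local Notation mu := (lebesgue_rV R n).
Implicit Types f g : Rn -> R.

Definition Lpow (p : nat) f :=
  measurable_fun setT f /\ (lint mu (fun x => `|f x| ^+ p)%R < +oo)%E.

Lemma le_1_expr (a : R) p : 0 <= a -> (0 < p)%N -> a <= 1 + a ^+ p.
Proof.
move=> a0 p0; have [a1|a1] := leP a 1.
  by rewrite (le_trans a1)// lerDl exprn_ge0.
by rewrite (le_trans (ler_eXnr p0 (ltW a1)))// lerDr.
Qed.

(** The majorant is [|q| + M h]. This serves L^p functions, with [h = |f|^p], as well as fields [K]
    bounded by [H ^+ m], with [h = H ^+ m.+1]. *)
Lemma loc_integrable_mul (k q h : Rn -> R) :
  measurable_fun setT k -> measurable_fun setT h -> (forall x, 0 <= h x) ->
  (lint mu h < +oo)%E -> (forall x, `|k x| <= 1 + h x) ->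
  continuous q -> bsupp q ->
  mu.-integrable setT (fun x => (k x * q x)%:E).
Proof.
move=> mk mh h0 hoo kh cq bq.
have [M M0 qM] := bsupp_bounded cq bq.
have mq := continuous_measurable_rV cq.
have mnq : measurable_fun setT (fun x => `|q x|) by exact: measurableT_comp.
have := @lint_integrable _ _ _ mu (fun x => k x * q x); apply.
  exact: measurable_funM.
apply: (@le_lt_trans _ _ (lint mu (fun x => `|q x| + M * h x)%R)).
  apply: le_lint => //.
  - by apply: measurableT_comp => //; exact: measurable_funM.
  - by apply: measurable_funD => //; exact: measurable_funM.
  - move=> x; rewrite normrM (le_trans (ler_wpM2r _ (kh x)))//.
    by rewrite mulrDl mul1r lerD2l mulrC ler_wpM2r.
rewrite lintD//; last 2 first.
- exact: measurable_funM.
- by move=> x; rewrite mulr_ge0// ltW.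
rewrite lintZ//; last exact: ltW.
rewrite lte_add_pinfty//; first exact: (bsupp_lint mq bq qM).
by rewrite lte_mul_pinfty// lee_fin ltW.
Qed.

Lemma Lpow_loc_integrable p f q : (0 < p)%N -> Lpow p f -> continuous q -> bsupp q ->
  mu.-integrable setT (fun x => (f x * q x)%:E).
Proof.
move=> p0 [mf fp]; apply: (loc_integrable_mul (h := fun x => `|f x| ^+ p)) => //.
  by apply: measurable_funX; exact: measurableT_comp.
by move=> x; exact: le_1_expr.
Qed.

Lemma measurable_sub_rV : measurable_fun setT (fun z : Rn * Rn => z.2 - z.1).
Proof.
apply: measurable_fun_rV => i.
rewrite (_ : (fun z => _) = fun z : Rn * Rn => z.2 ord0 i - z.1 ord0 i); last first.
  by apply/funext => z; rewrite !mxE.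
apply: measurable_funB.
  exact: (measurableT_comp (@measurable_coord R n i) measurable_snd).
exact: (measurableT_comp (@measurable_coord R n i) measurable_fst).
Qed.

Lemma measurable_add_rV : measurable_fun setT (fun z : Rn * Rn => z.1 + z.2).
Proof.
apply: measurable_fun_rV => i.
rewrite (_ : (fun z => _) = fun z : Rn * Rn => z.1 ord0 i + z.2 ord0 i); last first.
  by apply/funext => z; rewrite !mxE.
apply: measurable_funD.
  exact: (measurableT_comp (@measurable_coord R n i) measurable_fst).
exact: (measurableT_comp (@measurable_coord R n i) measurable_snd).
Qed.

(* Substitute y = x + z and exchange the order of integration. *)
Lemma lint_kernel (Phi : Rn * Rn -> R) (q : Rn -> R) :
  measurable_fun setT Phi -> (forall z, 0 <= Phi z) ->
  measurable_fun setT q -> (forall z, 0 <= q z) ->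
  (\int[mu]_x \int[mu]_y (Phi (x, y) * q (y - x))%:E =
   \int[mu]_z ((q z)%:E * lint mu (fun x => Phi (x, x + z)%R)))%E.
Proof.
move=> mPhi Phi0 mq q0.
transitivity (\int[mu]_x \int[mu]_z (Phi (x, (z + x)%R) * q z)%:E)%E.
  apply: eq_integral => x _.
  rewrite -(@ge0_integral_shift _ _ x).
  - by apply: eq_integral => z _; rewrite addrK.
  - apply/measurable_EFinP; apply: measurable_funM.
      exact: measurableT_comp.
    apply: (measurableT_comp mq).
    by rewrite -[X in measurable_fun _ X]/(shift_rV (- x)); exact: measurable_shift_rV.
  - by move=> y; rewrite lee_fin mulr_ge0.
have mG : measurable_fun setT (fun z : Rn * Rn => (Phi (z.1, z.2 + z.1) * q z.2)%:E).
  apply/measurable_EFinP; apply: measurable_funM; last exact: measurableT_comp.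
  apply: (measurableT_comp mPhi); apply: measurable_fun_pair => //.
  under eq_fun do rewrite addrC; exact: measurable_add_rV.
rewrite (@sfinite_Fubini _ _ _ _ _ mu mu
  (fun z : Rn * Rn => (Phi (z.1, z.2 + z.1) * q z.2)%:E)) //; last first.
  by move=> z; rewrite lee_fin mulr_ge0.
apply: eq_integral => z _; rewrite /lint -ge0_integralZl_EFin//=.
- by apply: eq_integral => x _; rewrite -EFinM addrC mulrC.
- by move=> x _; rewrite lee_fin.
- apply/measurable_EFinP; apply: (measurableT_comp mPhi).
  by apply: measurable_fun_pair => //; exact: measurable_shift_rV.
Qed.

End Lp_functions.

(** * Pairing a field with a mollified function *)

Section mollification.
Context {R : realType} {n : nat}.
Local Notation Rn := 'rV[R]_n.
Local Notation mu := (lebesgue_rV R n).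

Variables (m : nat) (H K g : Rn -> R).
Hypothesis LH : Lpow m.+1 H.
Hypothesis H0 : forall x, 0 <= H x.
Hypothesis mK : measurable_fun setT K.
Hypothesis KH : forall x, `|K x| <= H x ^+ m.
Hypothesis Lg : Lpow m.+1 g.

Let mH : measurable_fun setT H. Proof. by case: LH. Qed.
Let mg : measurable_fun setT g. Proof. by case: Lg. Qed.
Let mHp : measurable_fun setT (fun x => H x ^+ m.+1).
Proof. exact: measurable_funX. Qed.
Let mgp : measurable_fun setT (fun x => `|g x| ^+ m.+1).
Proof. by apply: measurable_funX; exact: measurableT_comp. Qed.
Let H_lty : (lint mu (fun x => H x ^+ m.+1)%R < +oo)%E.
Proof.
case: LH => _; rewrite (_ : (fun x => `|H x| ^+ m.+1) = (fun x => H x ^+ m.+1))//.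
by apply/funext => x; rewrite ger0_norm.
Qed.

Let mF (q : Rn -> R) : measurable_fun setT q ->
  measurable_fun setT (fun z : Rn * Rn => K z.1 * g z.2 * q (z.2 - z.1)).
Proof.
move=> mq; apply: measurable_funM.
  by apply: measurable_funM; exact: measurableT_comp.
exact: (measurableT_comp mq measurable_sub_rV).
Qed.

(** The bound of [K] by [H ^+ m] expresses, without fractional exponents, that [K] lies in the dual
    of L^(m+1). Young's inequality with parameter 1 replaces the product [K x * g y] by a sum of
    powers, and each power is integrable against the kernel. *)
Lemma young_kernel_lty (q : Rn -> R) : continuous q -> bsupp q ->
  (\int[mu]_x \int[mu]_y (`|K x * g y * q (y - x)%R|)%:E < +oo)%E.
Proof.
move=> cq bq; have mq := continuous_measurable_rV cq.
have [M _ qM] := bsupp_bounded cq bq.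
have mnq : measurable_fun setT (fun x => `|q x|) by exact: measurableT_comp.
pose Phi (z : Rn * Rn) := H z.1 ^+ m.+1 + `|g z.2| ^+ m.+1.
have mPhi : measurable_fun setT Phi.
  apply: measurable_funD.
    exact: (measurableT_comp mHp measurable_fst).
  exact: (measurableT_comp mgp measurable_snd).
have Phi0 z : 0 <= Phi z by rewrite addr_ge0// exprn_ge0.
have mPq : measurable_fun setT (fun z => (Phi z * `|q (z.2 - z.1)|)%:E).
  apply/measurable_EFinP; apply: measurable_funM => //.
  exact: (measurableT_comp mnq measurable_sub_rV).
have Pq0 z : (0 <= (Phi z * `|q (z.2 - z.1)|)%:E)%E by rewrite lee_fin mulr_ge0.
have mFq : measurable_fun setT (fun z : Rn * Rn => (`|K z.1 * g z.2 * q (z.2 - z.1)|)%:E).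
  by apply/measurable_EFinP; apply: measurableT_comp => //; exact: mF.
apply: (@le_lt_trans _ _ (\int[mu]_x \int[mu]_y (Phi (x, y) * `|q (y - x)|)%:E)%E).
  apply: ge0_le_integral => //.
  - by move=> x _; apply: integral_ge0 => y _; rewrite lee_fin.
  - have F0 (z : Rn * Rn) : (0 <= (`|K z.1 * g z.2 * q (z.2 - z.1)|)%:E)%E.
      by rewrite lee_fin.
    exact: (measurable_fun_fubini_tonelli_F _ mFq F0).
  - exact: (measurable_fun_fubini_tonelli_F _ mPq Pq0).
  - move=> x _; apply: ge0_le_integral => //.
    + exact: (measurableT_comp mFq (pair1_measurable x)).
    + exact: (measurableT_comp mPq (pair1_measurable x)).
    + move=> y _; rewrite lee_fin normrM ler_wpM2r// normrM.
      apply: (@le_trans _ _ (H x ^+ m * `|g y|)); first by rewrite ler_wpM2r.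
      have := @young_pow R m (H x) `|g y| 1 (H0 x) (normr_ge0 _) ltr01.
      by rewrite expr1n invr1 !mul1r.
rewrite (lint_kernel mPhi Phi0 mnq)//.
(* By translation invariance the inner integral does not depend on [z]. *)
rewrite (eq_integral (fun z => ((`|q z|)%:E * (lint mu (fun x => H x ^+ m.+1)%R +
    lint mu (fun x => `|g x| ^+ m.+1)%R))%E)); last first.
  move=> z _; congr (_ * _)%E; rewrite /Phi /= lintD//.
  - by rewrite (lint_shift z mgp).
  - exact: (measurable_fun_shift z mgp).
  - by move=> x; rewrite exprn_ge0.
rewrite ge0_integralZr//.
- rewrite lte_mul_pinfty//.
  + by apply: integral_ge0 => z _; rewrite lee_fin.
  + rewrite ge0_fin_numE; first exact: bsupp_lint qM.
    by apply: integral_ge0 => z _; rewrite lee_fin.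
  + by case: Lg => _ ?; rewrite lte_add_pinfty.
- exact/measurable_EFinP.
- by rewrite adde_ge0// lint_ge0// => x; rewrite exprn_ge0.
Qed.

Lemma mollify_integrable (q : Rn -> R) x : continuous q -> bsupp q ->
  mu.-integrable setT (fun y => (K x * g y * q (y - x)%R)%:E).
Proof.
move=> cq [r qr].
rewrite (_ : (fun y => _) = fun y => (g y * (K x * q (y - x)))%:E); last first.
  by apply/funext => y; rewrite mulrAC mulrC.
apply: (@Lpow_loc_integrable _ _ m.+1) => //.
  move=> y; apply: continuousM; first exact: cst_continuous.
  apply: (@continuous_comp _ _ _ (fun y : Rn => y - x) q y); last exact: cq.
  by apply: (@continuousB _ _ _ id (cst x)) => //; exact: cst_continuous.
exists (r + `|x|) => y; rewrite mulf_eq0 negb_or => /andP[_ /qr yx].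
by rewrite -[y](subrK x) (le_trans (ler_normD _ _))// lerD2r.
Qed.

Variable rho : Rn -> R.
Hypotheses (crho : continuous rho) (brho : bsupp rho) (rho0 : forall z, 0 <= rho z).
Hypothesis rho1 : lint mu rho = 1%:E.

Let mrho : measurable_fun setT rho. Proof. exact: continuous_measurable_rV. Qed.

Lemma Rintegral_shift_rho x : \int[mu]_y rho (y - x) = 1.
Proof.
rewrite /Rintegral -[LHS]/(fine (lint mu (fun y => rho (y + (- x))))).
by rewrite lint_shift// rho1.
Qed.

Lemma integrable_KG : mu.-integrable setT (fun x => (K x * g x)%:E).
Proof.
apply: (@lint_integrable _ _ _ mu (fun x => K x * g x)).
  exact: measurable_funM.
apply: (@le_lt_trans _ _ (lint mu (fun x => H x ^+ m.+1 + `|g x| ^+ m.+1)%R)).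
  apply: le_lint => //.
  - by apply: measurableT_comp => //; exact: measurable_funM.
  - exact: measurable_funD.
  - move=> x; rewrite normrM.
    apply: (@le_trans _ _ (H x ^+ m * `|g x|)); first by rewrite ler_wpM2r.
    have := @young_pow R m (H x) `|g x| 1 (H0 x) (normr_ge0 _) ltr01.
    by rewrite expr1n invr1 !mul1r.
rewrite lintD//; last by move=> x; rewrite exprn_ge0.
by case: Lg => _ ?; rewrite lte_add_pinfty.
Qed.

Lemma integrable_mollify :
  mu.-integrable setT (fun x => (\int[mu]_y (K x * g y * rho (y - x)))%:E).
Proof.
apply: (@integrable_Rintegral2 _ _ _ _ _ mu mu
  (fun z : Rn * Rn => K z.1 * g z.2 * rho (z.2 - z.1))).
- exact: mF.
- exact: young_kernel_lty.
- by move=> x; exact: mollify_integrable.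
Qed.

(** The error is the double integral of [K x * (g x - g y) * rho (y - x)]. Young's inequality with
    parameter [s] splits it into a power of [H] with factor [s] and the translation moduli of [g]
    with factor [s ^- m]; thus [s] can be made small first and [e] afterwards, depending on [s]. *)
Lemma mollify_error (s e : R) : 0 < s -> 0 <= e ->
  (forall z, rho z != 0 -> (lint mu (fun x => `|g (x + z) - g x| ^+ m.+1)%R <= e%:E)%E) ->
  `|\int[mu]_x (K x * g x) - \int[mu]_x \int[mu]_y (K x * g y * rho (y - x))| <=
  s * fine (lint mu (fun x => H x ^+ m.+1)) + s ^- m * e.
Proof.
move=> s0 e0 rhoe.
have sm0 : 0 <= s ^- m by rewrite invr_ge0 exprn_ge0// ltW.
pose G (z : Rn * Rn) := K z.1 * (g z.1 - g z.2) * rho (z.2 - z.1).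
have mG : measurable_fun setT G.
  apply: measurable_funM.
    apply: measurable_funM; first exact: measurableT_comp.
    by apply: measurable_funB; exact: measurableT_comp.
  exact: (measurableT_comp mrho measurable_sub_rV).
have rhox x : mu.-integrable setT (fun y => (K x * g x * rho (y - x))%:E).
  apply: (@integrableZl _ _ _ mu setT measurableT (K x * g x)
    (fun y => (rho (y - x))%:E)).
  apply: (@lint_integrable _ _ _ mu (fun y => rho (y - x))).
    by apply: (measurable_fun_shift (- x)).
  rewrite (_ : (fun y => _) = (fun y => rho (y + (- x)))).
    by rewrite lint_shift// rho1 ltry.
  by apply/funext => y; rewrite ger0_norm.
have GE x y : G (x, y) = K x * g x * rho (y - x) - K x * g y * rho (y - x).
  by rewrite /G /=; ring.
have G1 x : mu.-integrable setT (fun y => (G (x, y))%:E).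
  rewrite (_ : (fun y => _) = (fun y => (K x * g x * rho (y - x))%:E) \-
    (fun y => (K x * g y * rho (y - x))%:E))%E.
    by apply: integrableB => //; exact: mollify_integrable.
  by apply/funext => y; rewrite GE.
pose Phi (z : Rn * Rn) := s * H z.1 ^+ m.+1 + s ^- m * `|g z.2 - g z.1| ^+ m.+1.
have mPhi : measurable_fun setT Phi.
  apply: measurable_funD; apply: measurable_funM => //.
    exact: (measurableT_comp mHp measurable_fst).
  apply: measurable_funX; apply: measurableT_comp => //.
  by apply: measurable_funB; exact: measurableT_comp.
have Phi0 z : 0 <= Phi z by rewrite addr_ge0// mulr_ge0 ?exprn_ge0// ltW.
have mPq : measurable_fun setT (fun z => (Phi z * rho (z.2 - z.1))%:E).
  apply/measurable_EFinP; apply: measurable_funM => //.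
  exact: (measurableT_comp mrho measurable_sub_rV).
have Pq0 z : (0 <= (Phi z * rho (z.2 - z.1))%:E)%E by rewrite lee_fin mulr_ge0.
have mnG : measurable_fun setT (fun z : Rn * Rn => (`|G z|)%:E).
  by apply/measurable_EFinP; exact: measurableT_comp.
set B := s * _ + _.
have GB : (\int[mu]_x \int[mu]_y (`|G (x, y)|)%:E <= B%:E)%E.
  apply: (@le_trans _ _ (\int[mu]_x \int[mu]_y (Phi (x, y) * rho (y - x))%:E)%E).
    apply: ge0_le_integral => //.
    - by move=> x _; apply: integral_ge0 => y _; rewrite lee_fin.
    - have nG0 z : (0 <= (`|G z|)%:E)%E by rewrite lee_fin.
      exact: (measurable_fun_fubini_tonelli_F _ mnG nG0).
    - exact: (measurable_fun_fubini_tonelli_F _ mPq Pq0).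
    - move=> x _; apply: ge0_le_integral => //.
      + exact: (measurableT_comp mnG (pair1_measurable x)).
      + exact: (measurableT_comp mPq (pair1_measurable x)).
      + move=> y _; rewrite lee_fin normrM (ger0_norm (rho0 _)) ler_wpM2r// normrM.
        apply: (@le_trans _ _ (H x ^+ m * `|g y - g x|)).
          by rewrite distrC ler_wpM2r.
        exact: young_pow.
  rewrite (lint_kernel mPhi Phi0 mrho)//.
  apply: (@le_trans _ _ (\int[mu]_z ((rho z)%:E * B%:E))%E).
    have mS : measurable_fun setT (fun z => lint mu (fun x : Rn => Phi (x, x + z))).
      have mP' : measurable_fun setT (fun z : Rn * Rn => (Phi (z.1, z.1 + z.2))%:E).
        apply/measurable_EFinP; apply: (measurableT_comp mPhi).
        by apply: measurable_fun_pair => //; exact: measurable_add_rV.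
      have P'0 (z : Rn * Rn) : (0 <= (Phi (z.1, (z.1 + z.2)%R))%:E)%E by rewrite lee_fin.
      exact: (measurable_fun_fubini_tonelli_G _ mP' P'0).
    apply: ge0_le_integral => //.
    - by move=> z _; rewrite mule_ge0 ?lee_fin// lint_ge0.
    - by apply: emeasurable_funM => //; exact/measurable_EFinP.
    - by apply: emeasurable_funM => //; exact/measurable_EFinP.
    (* The modulus of [g] is controlled only where [rho] is nonzero; elsewhere the weight removes
       the term. *)
    - move=> z _; have [->|rz] := eqVneq (rho z) 0; first by rewrite !mul0e.
      rewrite lee_wpmul2l ?lee_fin// /Phi /= lintD//; first last.
      + by move=> x; rewrite mulr_ge0// exprn_ge0.
      + by move=> x; rewrite mulr_ge0 ?exprn_ge0// ltW.
      + apply: measurable_funM => //; apply: measurable_distX => //.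
        exact: measurable_fun_shift.
      + exact: measurable_funM.
      rewrite /B EFinD; apply: leeD.
        rewrite lintZ//; [|by move=> x; rewrite exprn_ge0|exact: ltW].
        by rewrite EFinM fineK// ge0_fin_numE// lint_ge0// => x; rewrite exprn_ge0.
      rewrite lintZ//; last by apply: measurable_distX => //; exact: measurable_fun_shift.
      by rewrite EFinM lee_wpmul2l ?lee_fin//; exact: rhoe.
  rewrite ge0_integralZr//; first by rewrite -/(lint mu rho) rho1 mul1e.
  - exact/measurable_EFinP.
  - by move=> z _; rewrite lee_fin.
  - rewrite lee_fin; apply: addr_ge0; apply: mulr_ge0 => //; first exact: ltW.
    by apply: fine_ge0; apply: lint_ge0 => x; rewrite exprn_ge0.
(* As [rho] has integral 1, [K x * g x] is itself an average against [rho (y - x)]. *)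
rewrite (_ : _ - _ = \int[mu]_x \int[mu]_y G (x, y)).
  rewrite -lee_fin; apply: (le_trans _ GB).
  apply: normr_Rintegral2 => //.
  by apply: le_lt_trans GB _; rewrite ltry.
rewrite -RintegralB//; [|exact: integrable_KG|exact: integrable_mollify].
apply: eq_Rintegral => x _.
under [RHS]eq_Rintegral do rewrite GE.
rewrite RintegralB//; [|exact: rhox|exact: mollify_integrable].
congr (_ - _); rewrite RintegralZl//; first by rewrite Rintegral_shift_rho mulr1.
apply: (@lint_integrable _ _ _ mu (fun y => rho (y - x))).
  by apply: (measurable_fun_shift (- x)).
rewrite (_ : (fun y => _) = (fun y => rho (y + (- x)))).
  by rewrite lint_shift// rho1 ltry.
by apply/funext => y; rewrite ger0_norm.
Qed.

End mollification.

(** * A mollifier made from [eta] *)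

Section mollifier.
Context {R : realType} {n : nat}.
Local Notation Rn := 'rV[R]_n.
Local Notation mu := (lebesgue_rV R n).

Lemma lint_gt0 (q : Rn -> R) x0 : continuous q -> (forall x, 0 <= q x) ->
  0 < q x0 -> (0 < lint mu q)%E.
Proof.
move=> cq q0 qx0.
have q2 : 0 < q x0 / 2 by rewrite divr_gt0.
have /cvgrPdist_lt/(_ _ q2)/nbhs_ballP[d /= d0 D] := cq x0.
pose a : Rn := \row_i (x0 ord0 i - d / 2); pose b : Rn := \row_i (x0 ord0 i + d / 2).
have ab i : a ord0 i <= b ord0 i by rewrite !mxE; lra.
pose B : set Rn := [set x | forall i, x ord0 i \in `[a ord0 i, b ord0 i]].
have Bb : mu B = (\prod_i (b ord0 i - a ord0 i))%:E by exact: lebesgue_rV_box.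
have mB : measurable B.
  rewrite (_ : B = \bigcap_(i in [set: 'I_n])
      ((fun x : Rn => x ord0 i) @^-1` `[a ord0 i, b ord0 i]%classic)).
    apply: fin_bigcap_measurable => // i _.
    by rewrite -[X in measurable X]setTI; exact: measurable_coord.
  by apply/seteqP; split => x /= xab i => [_|]; [exact: xab|exact: (xab i I)].
apply: (@lt_le_trans _ _ (lint mu (fun x => q x0 / 2 * \1_B x))).
  rewrite lintZ//; last exact: ltW.
  rewrite lint_indic// Bb -EFinM lte_fin mulr_gt0// prodr_gt0// => i _.
  by rewrite !mxE; lra.
apply: le_lint => //.
- exact: measurable_funM.
- exact: continuous_measurable_rV.
- by move=> x; rewrite mulr_ge0// ltW.
- move=> x; rewrite indicE; case: (boolP (x \in B)) => [|_]; last by rewrite mulr0.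
  rewrite inE mulr1 => xB; have := D x; rewrite -ball_normE /= => /(_ _).
  have -> : `|x0 - x| < d.
    apply: rV_norm_lt => // i; have := xB i; rewrite !mxE in_itv/= ltr_norml.
    by move=> /andP[? ?]; apply/andP; split; lra.
  by move=> /(_ isT); rewrite ltr_norml => /andP[_ ?]; lra.
Qed.

(** The square of a rescaled [eta] is nonnegative, smooth and not identically 0; normalizing its
    integral yields the mollifier. *)
Lemma exists_mollifier (eta : Rn -> R) (d : R) : test_function eta ->
  \int[mu]_x eta x != 0 -> 0 < d ->
  exists rho : Rn -> R, [/\ test_function rho, forall z, 0 <= rho z,
    forall z, rho z != 0 -> `|z| < d & lint mu rho = 1%:E].
Proof.
move=> teta eta0 d0; have [seta [r etar]] := (test_functionP eta).1 teta.
have [x0 x00] : exists x0, eta x0 != 0.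
  apply: contrapT => /forallNP eta00; move/eqP: eta0; apply.
  rewrite (_ : eta = cst 0) ?Rintegral_cst ?mul0r//.
  by apply/funext => x; apply/eqP/negPn/negP; exact: eta00.
(* If [q z] is nonzero, then [a |z| <= r < |r| + 1 = a d]. *)
pose a := (`|r| + 1) / d.
have a0 : 0 < a by rewrite divr_gt0// ltr_pwDr.
pose q (z : Rn) := eta (a *: z + 0) * eta (a *: z + 0).
have tq : test_function q.
  apply: testM; first by apply: test_affine => //; rewrite gt_eqF.
  exact: smooth_affine.
have [sq bq] := (test_functionP q).1 tq.
have cq : continuous q := @smooth_continuous _ _ _ sq.
have mq := continuous_measurable_rV cq.
have q0 z : 0 <= q z by rewrite /q -expr2 sqr_ge0.
have qgt : (0 < lint mu q)%E.
  apply: (@lint_gt0 q (a^-1 *: x0)) => //.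
  rewrite /q scalerA divff ?gt_eqF// scale1r addr0 -expr2.
  by rewrite lt_neqAle sqr_ge0 eq_sym sqrf_eq0 x00.
have [M _ qM] := bsupp_bounded cq bq.
have qlt : (lint mu q < +oo)%E.
  have := bsupp_lint mq bq qM; congr (lint _ _ < _)%E.
  by apply/funext => x; rewrite ger0_norm.
pose c := fine (lint mu q).
have cE : lint mu q = c%:E by rewrite fineK// ge0_fin_numE// ltW.
have c0 : 0 < c by rewrite -lte_fin -cE.
exists (fun z => q z * c^-1); split.
- by apply: testM => //; exact: smooth_cst.
- by move=> z; rewrite mulr_ge0// invr_ge0 ltW.
- move=> z; rewrite !mulf_eq0 !negb_or => /andP[/andP[/etar + _] _].
  rewrite addr0 normrZ gtr0_norm// /a => zr.
  rewrite -(ltr_pM2l a0) (le_lt_trans zr)// /a divfK ?gt_eqF//.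
  by rewrite (le_lt_trans (ler_norm r))// ltrDl.
- rewrite (_ : (fun z => _) = fun z => c^-1 * q z); last first.
    by apply/funext => z; rewrite mulrC.
  rewrite lintZ// ?invr_ge0 ?(ltW c0)// cE -EFinM mulVf// gt_eqF//.
Qed.

End mollifier.

(** * Finite sums under the real integral *)

Section finite_sums_of_integrals.
Context d (T : measurableType d) (R : realType) (mu : {measure set T -> \bar R}).

Lemma integrable_sum_real (I : Type) (s : seq I) (f : I -> T -> R) :
  (forall i, mu.-integrable setT (EFin \o f i)) ->
  mu.-integrable setT (fun x => (\sum_(i <- s) f i x)%:E).
Proof.
move=> fi; rewrite (_ : (fun x => _) = fun x => (\sum_(i <- s) (f i x)%:E)%E).
  by apply: integrable_sum => // i _; exact: fi.
by apply/funext => x; rewrite sumEFin.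
Qed.

Lemma Rintegral_sum (I : Type) (s : seq I) (f : I -> T -> R) :
  (forall i, mu.-integrable setT (EFin \o f i)) ->
  \int[mu]_x (\sum_(i <- s) f i x) = \sum_(i <- s) \int[mu]_x f i x.
Proof.
move=> fi; elim: s => [|i s IHs].
  rewrite big_nil (_ : (fun x => _) = cst 0) ?Rintegral_cst ?mul0r//.
  by apply/funext => x; rewrite big_nil.
rewrite big_cons -IHs -RintegralD//; last exact: integrable_sum_real.
by apply: eq_Rintegral => x _; rewrite big_cons.
Qed.

End finite_sums_of_integrals.

(** * Weakly divergence free fields annihilate weak gradients *)

Section divergence_free_fields.
Context {R : realType} {n : nat}.
Local Notation Rn := 'rV[R]_n.
Local Notation mu := (lebesgue_rV R n).

(** The reciprocal of [1 + \sum_j (d j)^-1] is a lower bound that makes sense for the empty family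
    too. *)
Lemma common_lower_bound (k : nat) (d : 'I_k -> R) : (forall j, 0 < d j) ->
  exists2 e : R, 0 < e & forall j, e <= d j.
Proof.
move=> d0; pose S := 1 + \sum_j (d j)^-1.
have S0 : 0 < S by rewrite ltr_pwDl// sumr_ge0// => j _; rewrite invr_ge0 ltW.
exists S^-1 => [|j]; first by rewrite invr_gt0.
rewrite -[leRHS]invrK lef_pV2 ?posrE ?invr_gt0// /S (bigD1 j)//= addrCA lerDl.
by rewrite addr_ge0// sumr_ge0// => i _; rewrite invr_ge0 ltW.
Qed.

Variables (m : nat) (eta : Rn -> R).
Hypothesis teta : test_function eta.
Hypothesis eta0 : \int[mu]_x eta x != 0.
Variables (H w : Rn -> R) (K g : 'I_n -> Rn -> R).
Hypothesis LH : Lpow m.+1 H.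
Hypothesis H0 : forall x, 0 <= H x.
Hypothesis mK : forall j, measurable_fun setT (K j).
Hypothesis KH : forall j x, `|K j x| <= H x ^+ m.
Hypothesis Lw : Lpow m.+1 w.
Hypothesis Lg : forall j, Lpow m.+1 (g j).
Hypothesis wg : forall j, is_weak_partial j w (g j).
Hypothesis divK : forall psi, test_function psi ->
  \int[mu]_x (\sum_j K j x * partial j psi x) = 0.

Let K_loc j x : `|K j x| <= 1 + H x ^+ m.+1.
Proof.
apply: le_trans (KH j x) _; case: m => [|k]; first by rewrite expr0 lerDl exprn_ge0.
have := @young_pow R k.+1 (H x) 1 1 (H0 x) ler01 ltr01.
by rewrite mulr1 mul1r !expr1n invr1 mulr1 addrC.
Qed.

Let H_lty : (lint mu (fun x => H x ^+ m.+1)%R < +oo)%E.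
Proof.
case: LH => _; rewrite (_ : (fun x => `|H x| ^+ m.+1) = (fun x => H x ^+ m.+1))//.
by apply/funext => x; rewrite ger0_norm.
Qed.

Let K_integrable j q : continuous q -> bsupp q ->
  mu.-integrable setT (fun x => (K j x * q x)%:E).
Proof.
move=> cq bq; apply: (loc_integrable_mul (h := fun x => H x ^+ m.+1)) => //.
- by apply: measurable_funX; case: LH.
- by move=> x; rewrite exprn_ge0.
Qed.

(** For fixed [x] the weak derivative of [w] moves onto [rho (y - x)]. After Fubini [y] is fixed,
    and the derivative is, up to sign, that of the test function [psi y] in the variable [x],
    against which [divK] applies. *)
Lemma sum_mollified_eq0 (rho : Rn -> R) : test_function rho ->
  \sum_j \int[mu]_x \int[mu]_y (K j x * g j y * rho (y - x)) = 0.
Proof.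
move=> trho; have [srho brho] := (test_functionP rho).1 trho.
have prho := @smooth_has_partials _ _ _ srho.
have tp j : test_function (partial j rho) by exact: test_partial.
have cp j : continuous (partial j rho).
  by have [/smooth_continuous] := (test_functionP _).1 (tp j).
have bp j : bsupp (partial j rho) by have [] := (test_functionP _).1 (tp j).
have crho : continuous rho by exact: smooth_continuous.
pose F j (z : Rn * Rn) := K j z.1 * w z.2 * partial j rho (z.2 - z.1).
have mF j : measurable_fun setT (F j).
  apply: measurable_funM.
    apply: measurable_funM; first exact: (measurableT_comp (mK j) measurable_fst).
    by apply: (measurableT_comp _ measurable_snd); case: Lw.
  by apply: (measurableT_comp _ measurable_sub_rV); exact: continuous_measurable_rV.
have hF j : (\int[mu]_x \int[mu]_y (`|F j (x, y)|)%:E < +oo)%E.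
  exact: (young_kernel_lty LH H0 (mK j) (KH j) Lw (cp j) (bp j)).
have F1 j x : mu.-integrable setT (fun y => (F j (x, y))%:E).
  exact: (mollify_integrable _ Lw x (cp j) (bp j)).
(* Put in affine form for [test_affine] and [partial_affine]; the factor -1 is the source of the
   sign in [dpsi]. *)
pose psi y := fun x : Rn => rho ((-1) *: x + y).
have psiE x y : (-1) *: x + y = y - x by rewrite scaleN1r addrC.
have tpsi y : test_function (psi y) by apply: test_affine => //; rewrite oppr_eq0 oner_eq0.
have dpsi j y x : partial j (psi y) x = - partial j rho (y - x).
  by rewrite /psi partial_affine// psiE mulN1r.
have FE j x y : F j (x, y) = (- w y) * (K j x * partial j (psi y) x).
  by rewrite /F dpsi /=; ring.
have Kpsi j y : mu.-integrable setT (fun x => (K j x * partial j (psi y) x)%:E).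
  have [sp bpp] := (test_functionP _).1 (test_partial j (tpsi y)).
  by apply: K_integrable => //; exact: smooth_continuous.
have F2 j y : mu.-integrable setT (fun x => (F j (x, y))%:E).
  rewrite (_ : (fun x => _) = fun x => ((- w y)%:E * (K j x * partial j (psi y) x)%:E)%E).
    exact: integrableZl.
  by apply/funext => x; rewrite FE EFinM.
transitivity (- \sum_j \int[mu]_x \int[mu]_y F j (x, y)).
  rewrite -sumrN; apply: eq_bigr => j _.
  have int1 := @integrable_Rintegral2 _ _ _ _ _ mu mu (F j) (mF j) (hF j) (F1 j).
  rewrite -mulN1r -RintegralZl//; apply: eq_Rintegral => x _.
  rewrite -RintegralZl//; last exact: F1.
  pose phi (y : Rn) := rho (1 *: y + (- x)).
  have phiE y : 1 *: y + (- x) = y - x by rewrite scale1r.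
  have tphi : test_function phi by apply: test_affine => //; rewrite oner_eq0.
  have [sphi bphi] := (test_functionP _).1 tphi.
  have [spphi bpphi] := (test_functionP _).1 (test_partial j tphi).
  have := wg j tphi; have Hg := Lpow_loc_integrable (ltn0Sn m) (Lg j)
    (@smooth_continuous _ _ _ sphi) bphi.
  have Hw := Lpow_loc_integrable (ltn0Sn m) Lw (@smooth_continuous _ _ _ spphi) bpphi.
  move=> E.
  transitivity (\int[mu]_y (K j x * (g j y * phi y))).
    by apply: eq_Rintegral => y _; rewrite /phi phiE mulrA.
  have HKw := integrableZl measurableT (K j x) Hw.
  rewrite RintegralZl// -[X in _ * X]opprK -E mulrN -RintegralZl// -mulN1r -RintegralZl//.
  apply: eq_Rintegral => y _.
  by rewrite /F /= /phi partial_affine// phiE mul1r !mulrA.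
have sw j := @Rintegral_swap _ _ _ _ _ mu mu (F j) (mF j) (hF j) (F1 j) (F2 j).
rewrite (eq_bigr _ (fun j _ => sw j)).
rewrite -(@Rintegral_sum _ _ _ mu _ _ (fun j y => \int[mu]_x F j (x, y))); last first.
  by move=> j; exact: (@integrable_Rintegral1 _ _ _ _ _ mu mu (F j) (mF j) (hF j) (F2 j)).
apply/eqP; rewrite oppr_eq0; apply/eqP.
rewrite (_ : (fun y => _) = cst 0) ?Rintegral_cst ?mul0r//.
apply/funext => y; rewrite -(@Rintegral_sum _ _ _ mu _ _ (fun j x => F j (x, y))); last first.
  by move=> j; exact: F2.
transitivity (\int[mu]_x ((- w y) * \sum_j (K j x * partial j (psi y) x))).
  by apply: eq_Rintegral => x _; rewrite big_distrr /=; apply: eq_bigr => j _; rewrite FE.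
rewrite RintegralZl ?divK ?mulr0//.
by apply: integrable_sum_real => j; exact: Kpsi.
Qed.

(** Subtracting the mollified pairing, which vanishes, leaves only the mollification errors;
    continuity of translations makes them small for all [g j] at once. *)
Lemma div_free_weak_gradient : \int[mu]_x (\sum_j K j x * g j x) = 0.
Proof.
apply/eqP; rewrite -normr_le0; apply/ler_addgt0Pl => e e0; rewrite addr0.
pose M := fine (lint mu (fun x => H x ^+ m.+1)).
have M0 : 0 <= M by apply: fine_ge0; apply: lint_ge0 => x; rewrite exprn_ge0.
(* Each error is at most [s * M + s ^- m * (s ^+ m * e')], hence at most [2 e'], and there are [n]
   of them. The added 1 here and in [s] keeps the denominators positive. *)
pose e' := e / (n%:R * 2 + 1).
have n0 : 0 < n%:R * 2 + 1 :> R by rewrite ltr_pwDr// mulr_ge0.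
have e'0 : 0 < e' by rewrite divr_gt0.
pose s := e' / (M + 1).
have s0 : 0 < s by rewrite divr_gt0// ltr_pwDr.
have ep : 0 < s ^+ m * e' by rewrite mulr_gt0// exprn_gt0.
have /choice[d dP] : forall j, exists d : R, 0 < d /\ forall z : Rn, `|z| < d ->
    (lint mu (fun x => `|g j (x + z) - g j x| ^+ m.+1)%R <= (s ^+ m * e')%:E)%E.
  move=> j; have [mg gp] := Lg j.
  by have [d d0 dP] := transl_cont_Lp (ltn0Sn m) mg gp ep; exists d.
have [d1 d10 d1d] := common_lower_bound (fun j => (dP j).1).
have [rho [trho rho0 rhod rho1]] := exists_mollifier teta eta0 d10.
have [srho brho] := (test_functionP rho).1 trho.
rewrite Rintegral_sum; last by move=> j; exact: (integrable_KG LH).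
rewrite -[X in `|X|]subr0 -[X in _ - X](sum_mollified_eq0 trho) -sumrB.
apply: le_trans (ler_norm_sum _ _ _) _.
apply: (@le_trans _ _ (\sum_(j < n) (e' * 2))).
  apply: ler_sum => j _.
  apply: le_trans (mollify_error LH H0 (mK j) (KH j) (Lg j)
    (@smooth_continuous _ _ _ srho) brho rho0 rho1 s0 (ltW ep) _) _.
    by move=> z /rhod zd; apply: (dP j).2; exact: lt_le_trans zd (d1d j).
  rewrite mulKf ?gt_eqF ?exprn_gt0// mulr2n mulrDr mulr1 lerD2r.
  by rewrite /s mulrAC -mulrA ler_piMr ?(ltW e'0)// ler_pdivrMr ?mul1r ?lerDl// ltr_pwDr.
rewrite sumr_const card_ord -[X in X <= _]mulr_natr.
have -> : e = e' * (n%:R * 2 + 1) by rewrite /e' divfK// gt_eqF.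
by rewrite -mulrA ler_pM2l// [2 * _]mulrC lerDl.
Qed.

End divergence_free_fields.

(** * Determinant bounds and closure properties of L^p *)

Section determinant_bounds.
Context {R : realType}.

Lemma det_le m (A : 'M[R]_m) (M : R) : (forall i j, `|A i j| <= M) ->
  `|\det A| <= (m`!)%:R * M ^+ m.
Proof.
move=> AM; apply: le_trans (ler_norm_sum _ _ _) _.
apply: (@le_trans _ _ (\sum_(s : 'S_m) M ^+ m)); last first.
  by rewrite sumr_const card_Sn mulr_natl.
apply: ler_sum => s _; rewrite normrM normrX normrN1 expr1n mul1r normr_prod.
rewrite -[X in M ^+ X](card_ord m) -prodr_const; apply: ler_prod => i _.
by rewrite normr_ge0 AM.
Qed.

Lemma cofactor_le m (A : 'M[R]_m.+1) i j (M : R) : (forall i j, `|A i j| <= M) ->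
  `|cofactor A i j| <= (m`!)%:R * M ^+ m.
Proof.
move=> AM; rewrite /cofactor normrM normrX normrN1 expr1n mul1r.
by apply: det_le => a b; rewrite !mxE.
Qed.

Lemma measurable_det d (T : measurableType d) m (A : T -> 'M[R]_m) :
  (forall i j, measurable_fun setT (fun x => A x i j)) ->
  measurable_fun setT (fun x => \det (A x)).
Proof.
move=> mA; apply: measurable_sum => s; apply: measurable_funM => //.
by apply: measurable_prod => i _; exact: mA.
Qed.

Lemma measurable_cofactor d (T : measurableType d) m (A : T -> 'M[R]_m.+1) i j :
  (forall i j, measurable_fun setT (fun x => A x i j)) ->
  measurable_fun setT (fun x => cofactor (A x) i j).
Proof.
move=> mA; apply: measurable_funM => //; apply: measurable_det => a b.
by under eq_fun do rewrite !mxE; exact: mA.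
Qed.

End determinant_bounds.

Section Lpow_closure.
Context {R : realType} {n : nat}.
Local Notation Rn := 'rV[R]_n.
Local Notation mu := (lebesgue_rV R n).
Implicit Types f g : Rn -> R.

Lemma Lpow_le (p : nat) f g : measurable_fun setT f -> Lpow p g ->
  (forall x, `|f x| <= `|g x|) -> Lpow p f.
Proof.
move=> mf [mg gp] fg; split => //; apply: le_lt_trans gp; apply: le_lint.
- by apply: measurable_funX; exact: measurableT_comp.
- by apply: measurable_funX; exact: measurableT_comp.
- by move=> x; rewrite exprn_ge0.
- by move=> x; rewrite lerXn2r ?nnegrE.
Qed.

Lemma LpowD (p : nat) f g : Lpow p f -> Lpow p g -> Lpow p (fun x => f x + g x).
Proof.
move=> [mf fp] [mg gp]; split; first exact: measurable_funD.
have mfp : measurable_fun setT (fun x => `|f x| ^+ p).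
  by apply: measurable_funX; exact: measurableT_comp.
have mgp : measurable_fun setT (fun x => `|g x| ^+ p).
  by apply: measurable_funX; exact: measurableT_comp.
apply: (@le_lt_trans _ _ (lint mu (fun x => 2 ^+ p * (`|f x| ^+ p + `|g x| ^+ p))%R)).
  apply: le_lint.
  - apply: measurable_funX; apply: measurableT_comp => //; exact: measurable_funD.
  - by apply: measurable_funM => //; exact: measurable_funD.
  - by move=> x; rewrite exprn_ge0.
  - move=> x; apply: le_trans (exprD_le _ (normr_ge0 _) (normr_ge0 _)).
    by rewrite lerXn2r ?nnegrE ?addr_ge0// ler_normD.
rewrite lintZ ?lintD ?exprn_ge0//.
- apply: lte_mul_pinfty => //; last exact: lte_add_pinfty.
- exact: measurable_funD.
Qed.

Lemma LpowZ (p : nat) (k : R) f : Lpow p f -> Lpow p (fun x => k * f x).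
Proof.
move=> [mf fp]; split; first exact: measurable_funM.
rewrite (_ : (fun x => _) = fun x => `|k| ^+ p * `|f x| ^+ p); last first.
  by apply/funext => x; rewrite normrM exprMn.
rewrite lintZ ?exprn_ge0//.
- by rewrite lte_mul_pinfty// lee_fin exprn_ge0.
- by apply: measurable_funX; exact: measurableT_comp.
Qed.

Lemma Lpow_norm (p : nat) f : Lpow p f -> Lpow p (fun x => `|f x|).
Proof.
move=> Lf; apply: (Lpow_le _ Lf); first by apply: measurableT_comp => //; case: Lf.
by move=> x; rewrite normr_id.
Qed.

Lemma Lpow0 (p : nat) : (0 < p)%N -> Lpow p (cst 0 : Rn -> R).
Proof.
move=> p0; split => //; rewrite (_ : (fun x => _) = cst 0).
  by rewrite /lint integral0.
by apply/funext => x; rewrite normr0 expr0n gtn_eqF.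
Qed.

Lemma Lpow_sum (p : nat) (I : Type) (s : seq I) (f : I -> Rn -> R) : (0 < p)%N ->
  (forall i, Lpow p (f i)) -> Lpow p (fun x => \sum_(i <- s) f i x).
Proof.
move=> p0 Lf; elim: s => [|i s IHs].
  rewrite (_ : (fun x => _) = cst 0); first exact: Lpow0.
  by apply/funext => x; rewrite big_nil.
rewrite (_ : (fun x => _) = fun x => f i x + \sum_(j <- s) f j x).
  exact: LpowD.
by apply/funext => x; rewrite big_cons.
Qed.

Lemma test_Lpow (p : nat) f : (0 < p)%N -> test_function f -> Lpow p f.
Proof.
move=> p0 /test_functionP[/smooth_continuous cf bf].
have mf := continuous_measurable_rV cf; split => //.
have [M M0 fM] := bsupp_bounded cf bf.
have mfp : measurable_fun setT (fun x => `|f x| ^+ p).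
  by apply: measurable_funX; exact: measurableT_comp.
have := @bsupp_lint R n (fun x => `|f x| ^+ p) (M ^+ p) mfp.
rewrite (_ : (fun x => `| `|f x| ^+ p |) = fun x => `|f x| ^+ p); last first.
  by apply/funext => x; rewrite ger0_norm ?exprn_ge0.
apply.
  by apply: bsuppW bf => x ->; rewrite normr0 expr0n gtn_eqF.
move=> x; rewrite ger0_norm ?exprn_ge0// lerXn2r ?nnegrE//.
exact: ltW.
Qed.

End Lpow_closure.

(** * The integral of a Jacobian determinant vanishes *)

Section null_lagrangian.
Context {R : realType} {m : nat}.
Hypothesis m0 : (0 < m)%N.
Local Notation Rn := 'rV[R]_m.+1.
Local Notation mu := (lebesgue_rV R m.+1).

(* The cofactors of a gradient are divergence free: transposing the first index
   with the one that is differentiated twice changes only the sign. *)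
Lemma piola (psi : 'I_m -> Rn -> R) x : (forall i, smooth (psi i)) ->
  \sum_(s : 'S_m.+1) (-1) ^+ s * partial (s ord0)
    (fun y => \prod_(i < m) partial (s (lift ord0 i)) (psi i) y) x = 0.
Proof.
move=> spsi.
under eq_bigr => s _.
  rewrite partial_prod ?index_enum_uniq//; last first.
    by move=> i; exact: smooth_partial.
  rewrite big_distrr /=; over.
rewrite exchange_big /= big1// => i _.
set S := (X in X = 0); suff : S = - S by move=> E; lra.
rewrite {1}/S (reindex_inj (mulgI (tperm ord0 (lift ord0 i)))) /= -sumrN.
apply: eq_bigr => s _.
rewrite odd_permM odd_tperm (_ : ord0 != lift ord0 i)// signr_addb /= expr1.
rewrite !permM tpermL tpermR schwarz// mulN1r mulNr; congr (- (_ * (_ * _))).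
apply: eq_bigr => k ki; rewrite permM tpermD//.
by apply: contra_neq ki => /lift_inj.
Qed.

(** The parameter of the induction measures roughness: [k = 0] still allows one weak row, the first,
    and [k = m] allows all rows to be weak. *)
Definition row_gradient (k : nat) (g : 'I_m.+1 -> 'I_m.+1 -> Rn -> R) (i : 'I_m.+1) :=
  if (i <= k)%N then exists2 u, Lpow m.+1 u & forall j, is_weak_partial j u (g i j)
  else exists2 psi, test_function psi & forall j, g i j = partial j psi.

(** In each term of the Leibniz formula the factors from the smooth rows multiply to a test
    function, onto which the weak derivative of the first row is moved; the resulting sum over
    permutations vanishes pointwise by [piola]. *)
Lemma Rintegral_det_test (g : 'I_m.+1 -> 'I_m.+1 -> Rn -> R) :
  (forall i j, Lpow m.+1 (g i j)) -> (forall i, row_gradient 0 g i) ->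
  \int[mu]_x \det (\matrix_(i, j) g i j x) = 0.
Proof.
move=> Lg gg.
have [u Lu ug] : exists2 u, Lpow m.+1 u & forall j, is_weak_partial j u (g ord0 j).
  by have := gg ord0.
have /choice[psi psiP] : forall i : 'I_m, exists psi, test_function psi /\
    forall j, g (lift ord0 i) j = partial j psi.
  by move=> i; have := gg (lift ord0 i); rewrite /row_gradient /= => -[psi tp E]; exists psi.
have tpsi i := (psiP i).1; have gE i := (psiP i).2.
have spsi i : smooth (psi i) by have [] := (test_functionP _).1 (tpsi i).
pose P (s : 'S_m.+1) x := \prod_(i < m) partial (s (lift ord0 i)) (psi i) x.
have tP s : test_function (P s).
  apply/test_functionP; split; first by apply: smooth_prod => i _; exact: smooth_partial.
  (* The product has bounded support because it has at least one factor, supplied by [m0]. *)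
  have [_] := (test_functionP _).1 (test_partial (s (lift ord0 (Ordinal m0))) (tpsi (Ordinal m0))).
  by apply: bsuppW => x E; rewrite /P (bigD1 (Ordinal m0))//= E mul0r.
have iP h q : Lpow m.+1 h -> test_function q -> mu.-integrable setT (fun x => (h x * q x)%:E).
  move=> Lh /test_functionP[/smooth_continuous cq bq].
  exact: (@Lpow_loc_integrable _ _ m.+1).
transitivity (\int[mu]_x (\sum_(s : 'S_m.+1) (-1) ^+ s * (g ord0 (s ord0) x * P s x))).
  apply: eq_Rintegral => x _; apply: eq_bigr => s _; congr (_ * _).
  rewrite big_ord_recl mxE; congr (_ * _); apply: eq_bigr => i _.
  by rewrite mxE gE.
have iZ (c : R) h q : Lpow m.+1 h -> test_function q ->
    mu.-integrable setT (fun x => (c * (h x * q x))%:E).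
  by move=> Lh tq; exact: (integrableZl measurableT c (iP _ _ Lh tq)).
rewrite Rintegral_sum; last by move=> s; exact: iZ.
transitivity (\sum_(s : 'S_m.+1) - \int[mu]_x ((-1) ^+ s * (u x * partial (s ord0) (P s) x))).
  apply: eq_bigr => s _; rewrite RintegralZl//; last exact: iP.
  rewrite RintegralZl//; last by apply: iP => //; exact: test_partial.
  by rewrite (ug _ _ (tP s)) mulrN opprK.
rewrite sumrN -Rintegral_sum; last by move=> s; apply: iZ => //; exact: test_partial.
rewrite (_ : (fun x => _) = cst 0) ?Rintegral_cst ?mul0r ?oppr0//.
apply/funext => x; rewrite -[RHS](mulr0 (u x)) -[X in _ = _ * X](piola x spsi) big_distrr /=.
by apply: eq_bigr => s _; rewrite mulrCA.
Qed.

Variable eta : Rn -> R.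
Hypothesis teta : test_function eta.
Hypothesis eta0 : \int[mu]_x eta x != 0.

(** The determinant is expanded along the last weak row. Pairing its cofactors with the gradient of
    a test function gives the determinant with that row replaced, which has one weak row fewer; so
    the induction hypothesis says exactly that the cofactors are divergence free. *)
Lemma Rintegral_det_row_gradient k (g : 'I_m.+1 -> 'I_m.+1 -> Rn -> R) :
  (forall i j, Lpow m.+1 (g i j)) -> (forall i, row_gradient k g i) ->
  \int[mu]_x \det (\matrix_(i, j) g i j x) = 0.
Proof.
elim: k g => [|k IHk] g Lg gg; first exact: Rintegral_det_test.
(* When [k.+1] is beyond the last index, no new row becomes weak. *)
have [km|mk] := ltnP k.+1 m.+1; last first.
  apply: IHk => // i; have := gg i; rewrite /row_gradient.
  have im := ltn_ord i; rewrite !ifT//; lia.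
pose i0 : 'I_m.+1 := Ordinal km.
have [w Lw wg] : exists2 u, Lpow m.+1 u & forall j, is_weak_partial j u (g i0 j).
  by have := gg i0; rewrite /row_gradient leqnn.
pose A x : 'M[R]_m.+1 := \matrix_(i, j) g i j x.
pose S x := \sum_i \sum_j `|g i j x|.
(* The factorial is put inside the power to fit the form [H ^+ m]; as [m > 0], it is at most its
   m-th power. *)
pose H x := (m`!)%:R * S x.
have LH : Lpow m.+1 H.
  apply: LpowZ; apply: Lpow_sum => // i; apply: Lpow_sum => // j.
  exact: Lpow_norm.
have S0 x : 0 <= S x by apply: sumr_ge0 => i _; apply: sumr_ge0.
have H0 x : 0 <= H x by rewrite mulr_ge0.
have mA i j : measurable_fun setT (fun x => A x i j).
  by under eq_fun do rewrite mxE; case: (Lg i j).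
have AS x i j : `|A x i j| <= S x.
  rewrite mxE /S (bigD1 i)//= (bigD1 j)//= -addrA lerDl.
  by rewrite addr_ge0// sumr_ge0// => a _; apply: sumr_ge0.
have KH j x : `|cofactor (A x) i0 j| <= H x ^+ m.
  apply: le_trans (cofactor_le i0 j (AS x)) _.
  rewrite exprMn ler_wpM2r ?exprn_ge0// ler_eXnr// ler1n fact_gt0//.
transitivity (\int[mu]_x (\sum_j cofactor (A x) i0 j * g i0 j x)).
  apply: eq_Rintegral => x _; rewrite (expand_det_row _ i0).
  by apply: eq_bigr => j _; rewrite mxE mulrC.
apply: (div_free_weak_gradient teta eta0 LH H0 _ KH Lw) => //.
  by move=> j; exact: measurable_cofactor.
move=> psi tpsi.
pose g' (i j : 'I_m.+1) := if i == i0 then partial j psi else g i j.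
transitivity (\int[mu]_x \det (\matrix_(i, j) g' i j x)).
  apply: eq_Rintegral => x _; rewrite (expand_det_row _ i0).
  apply: eq_bigr => j _; rewrite mxE /g' eqxx mulrC; congr (_ * _).
  rewrite /cofactor; congr (_ * \det _); apply/matrixP => a b.
  by rewrite !mxE eq_sym (negbTE (neq_lift _ _)).
apply: IHk => [i j|i].
  by rewrite /g'; case: eqP => // _; apply: test_Lpow => //; exact: test_partial.
rewrite /row_gradient /g'; have [->|ii0] := eqVneq i i0.
  by rewrite ltnn; exists psi.
have := gg i; rewrite /row_gradient.
by rewrite [(i <= k.+1)%N]leq_eqVlt ltnS -[_ == k.+1]/(i == i0) (negbTE ii0).
Qed.

Theorem Rintegral_det_weak_gradient (u : 'I_m.+1 -> Rn -> R)
    (g : 'I_m.+1 -> 'I_m.+1 -> Rn -> R) :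
  (forall i, Lpow m.+1 (u i)) -> (forall i j, Lpow m.+1 (g i j)) ->
  (forall i j, is_weak_partial j (u i) (g i j)) ->
  \int[mu]_x \det (\matrix_(i, j) g i j x) = 0.
Proof.
move=> Lu Lg ug; apply: (@Rintegral_det_row_gradient m) => // i.
by rewrite /row_gradient -ltnS ltn_ord; exists (u i).
Qed.

End null_lagrangian.

(** * Jacobians paired with test functions are controlled by the gradient *)

Section jacobian_estimate.
Context {R : realType} {m : nat}.
Hypothesis m0 : (0 < m)%N.
Local Notation Rn := 'rV[R]_m.+1.
Local Notation mu := (lebesgue_rV R m.+1).

Lemma Lfun_Lpow (f : Rn -> R) : f \in Lfun mu (m.+1%:R)%:E -> Lpow m.+1 f.
Proof.
move=> Lf; split; first by have := sub_Lfun_mfun Lf; rewrite inE.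
have := Lfun_integrable _ Lf; rewrite ler1n => /(_ isT)/integrable_lint.
congr (lint _ _ < _)%E; apply/funext => x.
by rewrite powR_mulrn// ger0_norm ?exprn_ge0.
Qed.

Lemma sobolev1_weak_partial (f : Rn -> R) j : sobolev1 m.+1%:R f ->
  Lpow m.+1 (weak_partial m.+1%:R j f) /\ is_weak_partial j f (weak_partial m.+1%:R j f).
Proof.
move=> [_ /(_ j) ex]; have [Lg wg] := @getPex _ (weak_partials_Lp m.+1%:R j f) ex.
by split => //; exact: Lfun_Lpow.
Qed.

Lemma Lpow_mul_bounded (p : nat) (f q : Rn -> R) (M : R) : Lpow p f ->
  measurable_fun setT q -> (forall x, `|q x| <= M) -> Lpow p (fun x => q x * f x).
Proof.
move=> Lf mq qM; apply: (@Lpow_le _ _ _ _ (fun x => M * f x)); last first.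
- move=> x; rewrite !normrM ler_wpM2r// (le_trans (qM x))// ler_norm//.
- exact: LpowZ.
- by apply: measurable_funM => //; case: Lf.
Qed.

(** The weak derivative of [u] is tested against [phi * psi], and the product rule is rearranged. *)
Lemma is_weak_partial_mul (j : 'I_m.+1) (u g phi : Rn -> R) :
  Lpow m.+1 u -> Lpow m.+1 g -> test_function phi -> is_weak_partial j u g ->
  is_weak_partial j (fun x => phi x * u x) (fun x => phi x * g x + partial j phi x * u x).
Proof.
move=> Lu Lg tphi ug psi tpsi.
have [sphi bphi] := (test_functionP _).1 tphi; have [spsi bpsi] := (test_functionP _).1 tpsi.
have iP h q : Lpow m.+1 h -> test_function q -> mu.-integrable setT (fun x => (h x * q x)%:E).
  move=> Lh /test_functionP[/smooth_continuous cq bq].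
  exact: (@Lpow_loc_integrable _ _ m.+1).
have tpp : test_function (fun x => phi x * psi x) by exact: testM.
have tdp : test_function (fun x => partial j phi x * psi x).
  by apply: testM => //; exact: test_partial.
have := ug _ tpp.
have -> : (fun x => u x * partial j (fun x => phi x * psi x) x) =
    (fun x => u x * (partial j phi x * psi x) + phi x * u x * partial j psi x).
  apply/funext => x; rewrite partialM; [ring| |]; exact: smooth_has_partials.
have i1 := iP _ _ Lu tdp.
have i2 : mu.-integrable setT (fun x => (phi x * u x * partial j psi x)%:E).
  rewrite (_ : (fun x => _) = fun x => (u x * (phi x * partial j psi x))%:E).
    by apply: iP => //; apply: testM => //; exact: smooth_partial.
  by apply/funext => x; rewrite mulrCA mulrA.
have i3 := iP _ _ Lg tpp.
rewrite (RintegralD measurableT i1 i2) => E.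
have E2 : \int[mu]_x (phi x * u x * partial j psi x) =
  (- (\int[mu]_x (g x * (phi x * psi x)))) - \int[mu]_x (u x * (partial j phi x * psi x)).
  by rewrite -E; ring.
rewrite E2 -opprD -(RintegralD measurableT i3 i1); congr (- _).
by apply: eq_Rintegral => x _; ring.
Qed.

Variable eta : Rn -> R.
Hypothesis teta : test_function eta.
Hypothesis eta0 : \int[mu]_x eta x != 0.

(** Expanding along the modified first row gives [phi] times the Jacobian plus a remainder [B] that
    contains only derivatives of [phi]. The remainder is bounded by [L] times an integrable function
    that depends on [u] alone. *)
Lemma jacobian_lipschitz_bound (u : Rn -> Rn) : sobolev1n u ->
  exists C : R, forall (phi : Rn -> R) (L : R), test_function phi -> 0 <= L ->
    (forall j x, `|partial j phi x| <= L) ->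
    `|distribution_of (jacobian_operator u) phi| <= C * L.
Proof.
move=> su; pose v i x := u x ord0 i.
pose g i j := weak_partial m.+1%:R j (v i).
have Lv i : Lpow m.+1 (v i) by apply: Lfun_Lpow; have [] := su i.
have Lg i j : Lpow m.+1 (g i j) := (sobolev1_weak_partial j (su i)).1.
have vg i j : is_weak_partial j (v i) (g i j) := (sobolev1_weak_partial j (su i)).2.
pose A x : 'M[R]_m.+1 := \matrix_(i, j) g i j x.
(* The summand [|v ord0 x|] is where [u] itself, and not only its gradient, has to be in L^n. *)
pose S x := `|v ord0 x| + \sum_i \sum_j `|g i j x|.
have SA0 x : 0 <= \sum_i \sum_j `|g i j x|.
  by apply: sumr_ge0 => i _; apply: sumr_ge0.
have S0 x : 0 <= S x by rewrite addr_ge0.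
have vS x : `|v ord0 x| <= S x by rewrite lerDl.
have AS x i j : `|A x i j| <= S x.
  apply: (@le_trans _ _ (\sum_i \sum_j `|g i j x|)); last by rewrite lerDr.
  rewrite mxE (bigD1 i)//= (bigD1 j)//= -addrA lerDl.
  by rewrite addr_ge0// sumr_ge0// => a _; apply: sumr_ge0.
have LS : Lpow m.+1 S.
  apply: LpowD; first exact: Lpow_norm.
  apply: Lpow_sum => // i; apply: Lpow_sum => // j; exact: Lpow_norm.
have mA i j : measurable_fun setT (fun x => A x i j).
  by under eq_fun do rewrite mxE; case: (Lg i j).
have mS : measurable_fun setT S by case: LS.
have mSn : measurable_fun setT (fun x => S x ^+ m.+1) by exact: measurable_funX.
have S_lty : (lint mu (fun x => S x ^+ m.+1)%R < +oo)%E.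
  case: LS => _; congr (lint _ _ < _)%E.
  by apply/funext => x; rewrite ger0_norm.
have iS (f : Rn -> R) (c : R) : measurable_fun setT f -> 0 <= c ->
    (forall x, `|f x| <= c * S x ^+ m.+1) -> mu.-integrable setT (EFin \o f).
  move=> mf c0 fc; apply: lint_integrable => //.
  apply: (@le_lt_trans _ _ (lint mu (fun x => c * S x ^+ m.+1))).
    apply: le_lint => //; [exact: measurableT_comp|exact: measurable_funM].
  rewrite lintZ//; last by move=> x; rewrite exprn_ge0.
  exact: lte_mul_pinfty.
(* There are [m.+1] cofactors, each a sum of m! products. *)
pose c := m.+1%:R * (m`!)%:R : R.
have c0 : 0 <= c by rewrite mulr_ge0.
exists (c * fine (lint mu (fun x => S x ^+ m.+1))) => phi L tphi L0 phiL.
have [sphi bphi] := (test_functionP _).1 tphi.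
have cphi : continuous phi by exact: smooth_continuous.
have [M M0 phiM] := bsupp_bounded cphi bphi.
have mphi := continuous_measurable_rV cphi.
have cdphi j : continuous (partial j phi).
  by apply: smooth_continuous; exact: smooth_partial.
have mdphi j := continuous_measurable_rV (cdphi j).
pose e j x := phi x * g ord0 j x + partial j phi x * v ord0 x.
pose v' i x := if i == ord0 then phi x * v ord0 x else v i x.
pose g' i j x := if i == ord0 then e j x else g i j x.
have mv0 : measurable_fun setT (v ord0) by case: (Lv ord0).
have det0 : \int[mu]_x \det (\matrix_(i, j) g' i j x) = 0.
  apply: (Rintegral_det_weak_gradient m0 teta eta0 (u := v')).
  - move=> i; rewrite /v'; case: eqP => // _.
    exact: (Lpow_mul_bounded (Lv ord0) mphi phiM).
  - move=> i j; rewrite /g'; case: eqP => // _; apply: LpowD.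
      exact: (Lpow_mul_bounded (Lg ord0 j) mphi phiM).
    exact: (Lpow_mul_bounded (Lv ord0) (mdphi j) (phiL j)).
  - move=> i j; rewrite /v' /g'; case: eqP => // _.
    exact: is_weak_partial_mul.
pose B x := \sum_j partial j phi x * v ord0 x * cofactor (A x) ord0 j.
have detE x : \det (\matrix_(i, j) g' i j x) = jacobian_operator u x * phi x + B x.
  rewrite (expand_det_row _ ord0).
  have cofE j : cofactor (\matrix_(i, j) g' i j x) ord0 j = cofactor (A x) ord0 j.
    by rewrite /cofactor; congr (_ * \det _); apply/matrixP => a b; rewrite !mxE.
  under eq_bigr => j _ do rewrite cofE mxE /g' eqxx /e mulrDl.
  rewrite big_split /=; congr (_ + _).
  rewrite /jacobian_operator (expand_det_row _ ord0) big_distrl /=.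
  by apply: eq_bigr => j _; rewrite mxE -mulrA mulrC.
have mB : measurable_fun setT B.
  apply: measurable_sum => j; apply: measurable_funM; last exact: measurable_cofactor.
  exact: measurable_funM.
have BS x : `|B x| <= L * (c * S x ^+ m.+1).
  apply: le_trans (ler_norm_sum _ _ _) _.
  apply: (@le_trans _ _ (\sum_(j < m.+1) L * ((m`!)%:R * S x ^+ m.+1))).
    apply: ler_sum => j _; rewrite 2!normrM -mulrA; apply: ler_pM => //.
    rewrite exprS mulrCA; apply: ler_pM => //.
    exact: cofactor_le (AS x).
  rewrite sumr_const card_ord -[X in X <= _]mulr_natl /c -!mulrA.
  by rewrite mulrCA.
have iB : mu.-integrable setT (EFin \o B).
  apply: (iS B (L * c)) => //; first by rewrite mulr_ge0.
  by move=> x; rewrite -mulrA.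
(* The bound [M] depends on [phi] but is used for integrability only; it does not enter the final
   constant. *)
have iJ : mu.-integrable setT (EFin \o (fun x => jacobian_operator u x * phi x)).
  apply: (iS _ ((m.+1`!)%:R * M)) => //.
  - by apply: measurable_funM => //; exact: measurable_det.
  - by rewrite mulr_ge0// ltW.
  - move=> x; rewrite normrM mulrAC; apply: ler_pM => //.
    exact: det_le (AS x).
have : \int[mu]_x (jacobian_operator u x * phi x) + \int[mu]_x B x = 0.
  rewrite -RintegralD// -[RHS]det0; apply: eq_Rintegral => x _.
  by rewrite detE.
move/eqP; rewrite addr_eq0 => /eqP; rewrite /distribution_of => ->; rewrite normrN.
apply: le_trans (le_normr_Rintegral measurableT iB) _.
rewrite -lee_fin.
have nB : (lint mu (fun x => `|B x|)%R <= (L * (c * fine (lint mu (fun x => S x ^+ m.+1))))%:E)%E.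
  apply: (@le_trans _ _ (lint mu (fun x => (L * c) * S x ^+ m.+1))).
    apply: le_lint => //; [exact: measurableT_comp|exact: measurable_funM|].
    by move=> x; rewrite -mulrA.
  rewrite lintZ ?mulr_ge0//; last by move=> x; rewrite exprn_ge0.
  rewrite [X in (_ <= X%:E)%E]mulrA [X in (_ <= X)%E]EFinM fineK// ge0_fin_numE// lint_ge0// => x.
  by rewrite exprn_ge0.
rewrite /Rintegral -/(lint mu (fun x => `|B x|)) fineK; first by rewrite [X in (_ <= X%:E)%E]mulrC.
rewrite ge0_fin_numE; last exact: lint_ge0.
by apply: le_lt_trans nB _; rewrite ltry.
Qed.

End jacobian_estimate.

(** * The lacunary functional and its temperedness *)

Section lacunary_functional.
Context {R : realType} {m : nat}.
Local Notation Rn := 'rV[R]_m.+1.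
Local Notation mu := (lebesgue_rV R m.+1).
Implicit Types phi psi : Rn -> R.

Lemma continuous_affine phi (a : R) (b : Rn) : continuous phi ->
  continuous (fun x : Rn => phi (a *: x + b)).
Proof. exact: (@Ck_affine _ _ 0%N). Qed.

Lemma bsupp_integrable phi : continuous phi -> bsupp phi ->
  mu.-integrable setT (EFin \o phi).
Proof.
move=> cp bp; have mp := continuous_measurable_rV cp.
have [M _ pM] := bsupp_bounded cp bp.
by apply: lint_integrable => //; exact: bsupp_lint pM.
Qed.

Variables (eta : Rn -> R) (r : R).
Hypothesis teta : test_function eta.

Let ceta : continuous eta.
Proof. by have [/smooth_continuous] := (test_functionP _).1 teta. Qed.
Let beta : bsupp eta. Proof. by have [] := (test_functionP _).1 teta. Qed.

(** When [eta] is supported in |x| <= r, its copy centred here has first coordinates in [r, 3r]. The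
    dilates of this interval by powers of 4 are pairwise disjoint, since 3 < 4. *)
Definition dipole_shift : Rn := (2 * r) *: delta_mx ord0 ord0.

(** The pairing of [phi] with [a^-n (eta (x/a - c) - eta (x/a + c))], where [c] is [dipole_shift],
    after substituting x = a y + a c and x = a y - a c. In this form the dilations fall on the
    argument of [phi]. *)
Definition dipole phi (a : R) : R :=
  \int[mu]_y (eta y * (phi (a *: y + a *: dipole_shift) - phi (a *: y - a *: dipole_shift))).

Definition dipole_term phi (k : nat) : R := 2^-1 ^+ k * dipole phi (4 ^+ k).

(* The l1 sum of dipoles at the scales [4 ^+ k] has a finite Hardy norm, but its
   first moments decay too slowly for a Jacobian. *)
Definition lacunary phi : R := limn (series (dipole_term phi)).

Let N := \int[mu]_y `|eta y|.

Lemma dipole_integrable phi a : continuous phi -> mu.-integrable setT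
  (fun y => (eta y * (phi (a *: y + a *: dipole_shift) - phi (a *: y - a *: dipole_shift)))%:E).
Proof.
move=> cp; apply: (@bsupp_integrable (fun y => eta y *
  (phi (a *: y + a *: dipole_shift) - phi (a *: y - a *: dipole_shift)))).
  move=> y; apply: (@continuousM _ _ eta); first exact: ceta.
  by apply: continuousB; exact: continuous_affine.
by apply: bsuppW beta => y ->; rewrite mul0r.
Qed.

Lemma dipole_le phi a (D : R) : continuous phi ->
  (forall y, eta y != 0 ->
    `|phi (a *: y + a *: dipole_shift) - phi (a *: y - a *: dipole_shift)| <= D) ->
  `|dipole phi a| <= D * N.
Proof.
move=> cp pD; apply: le_trans (le_normr_Rintegral measurableT (dipole_integrable a cp)) _.
have ieta : mu.-integrable setT (fun y => (`|eta y|)%:E).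
  apply: (@bsupp_integrable (fun y => `|eta y|)).
    by move=> y; apply: continuous_comp; [exact: ceta|exact: norm_continuous].
  by apply: bsuppW beta => y ->; rewrite normr0.
rewrite /N -RintegralZl//; apply: le_Rintegral => //.
- by have := integrable_norm (dipole_integrable a cp).
- exact: integrableZl ieta.
- move=> y _; rewrite normrM mulrC; have [->|ey] := eqVneq (eta y) 0.
    by rewrite normr0 !mulr0.
  by rewrite ler_wpM2r// pD.
Qed.

Lemma dipoleD phi psi a (b : R) : continuous phi -> continuous psi ->
  dipole (fun x => b * phi x + psi x) a = b * dipole phi a + dipole psi a.
Proof.
move=> cp cq; have ip := dipole_integrable a cp; have iq := dipole_integrable a cq.
have ibp := integrableZl measurableT b ip.
rewrite /dipole -(RintegralZl _ measurableT ip) -(RintegralD measurableT ibp iq).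
by apply: eq_Rintegral => y _; ring.
Qed.

Lemma N_ge0 : 0 <= N. Proof. exact: Rintegral_ge0. Qed.

Lemma dipole_term_le phi (M : R) k : continuous phi -> (forall x, `|phi x| <= M) ->
  `|dipole_term phi k| <= geometric (2 * M * N) 2^-1 k.
Proof.
move=> cp pM; rewrite /dipole_term /= normrM normrX ger0_norm ?invr_ge0// mulrC.
rewrite ler_wpM2r ?exprn_ge0 ?invr_ge0//; apply: dipole_le => // y _.
by rewrite (le_trans (ler_normB _ _))// mulr2n mulrDl mul1r lerD.
Qed.

Lemma half_lt1 : `|2^-1 : R| < 1.
Proof. by rewrite ger0_norm ?invr_ge0// invf_lt1// ltr1n. Qed.

Lemma dipole_series_cvg phi (M : R) : continuous phi -> (forall x, `|phi x| <= M) ->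
  cvgn (series (dipole_term phi)).
Proof.
move=> cp pM; apply: normed_cvg.
apply: (@series_le_cvg _ _ (geometric (2 * M * N) 2^-1)) => [k|k|k|].
- exact: normr_ge0.
- exact: le_trans (normr_ge0 _) (dipole_term_le k cp pM).
- exact: dipole_term_le.
- apply: is_cvg_geometric_series; exact: half_lt1.
Qed.

(** Each dipole contributes at most [2 M N], and the weights sum to 2. *)
Lemma lacunary_le phi (M : R) : continuous phi -> (forall x, `|phi x| <= M) ->
  `|lacunary phi| <= 4 * M * N.
Proof.
move=> cp pM; have nc : cvgn [normed series (dipole_term phi)].
  apply: (@series_le_cvg _ _ (geometric (2 * M * N) 2^-1)) => [k|k|k|].
  - exact: normr_ge0.
  - exact: le_trans (normr_ge0 _) (dipole_term_le k cp pM).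
  - exact: dipole_term_le.
  - apply: is_cvg_geometric_series; exact: half_lt1.
apply: le_trans (lim_series_norm nc) _.
apply: (@le_trans _ _ (limn (series (geometric (2 * M * N) 2^-1)))).
  apply: lim_series_le => //; first by apply: is_cvg_geometric_series; exact: half_lt1.
  by move=> k; exact: dipole_term_le.
rewrite (cvg_lim (@Rhausdorff R) (@cvg_geometric_series R (2 * M * N) _ half_lt1)).
by rewrite le_eqVlt; apply/orP; left; apply/eqP; field.
Qed.

(** The bounds on both functions make the two series converge, without which [limn] would carry no
    information. *)
Lemma lacunary_linear (b : R) phi psi (M M' : R) :
  continuous phi -> (forall x, `|phi x| <= M) ->
  continuous psi -> (forall x, `|psi x| <= M') ->
  lacunary (fun x => b * phi x + psi x) = b * lacunary phi + lacunary psi.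
Proof.
move=> cp pM cq qM; rewrite /lacunary.
have -> : dipole_term (fun x => b * phi x + psi x) = b *: dipole_term phi + dipole_term psi.
  by apply/funext => k; rewrite /dipole_term dipoleD// fctE /= mulrDr mulrCA.
have c1 := dipole_series_cvg cp pM; have c2 := dipole_series_cvg cq qM.
by rewrite (lim_seriesD (is_cvg_seriesZ (k := b) c1) c2) lim_seriesZ.
Qed.

Lemma schwartz_bounded phi : schwartz phi ->
  continuous phi /\ exists M : R, forall x, `|phi x| <= M.
Proof.
move=> [/smooth_continuous cp /(_ 0%N [::]) sp]; split => //.
have s0 x : ((`|phi x|)%:E <= schwartz_seminorm 0 [::] phi)%E.
  by apply: ereal_sup_ubound; exists x => //; rewrite expr0 mul1r.
exists (fine (schwartz_seminorm 0 [::] phi)) => x.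
rewrite -lee_fin fineK// ge0_fin_numE//; apply: le_trans (s0 0) => //.
Qed.

(** By [lacunary_le] the supremum norm alone controls the functional, so the seminorm of order 0
    suffices. The added 1 in [4 * N + 1] keeps the denominator positive. *)
Lemma tempered_lacunary : tempered lacunary.
Proof.
split=> [a phi psi /schwartz_bounded[cp [M pM]] /schwartz_bounded[cq [M' qM]]|].
  exact: lacunary_linear pM _ qM.
move=> phi /schwartz_bounded[cp [M pM]] e e0.
have N1 : 0 < 4 * N + 1 by rewrite ltr_pwDr// mulr_ge0// N_ge0.
exists 0%N, (e / (4 * N + 1)); split; first by rewrite divr_gt0.
move=> psi /schwartz_bounded[cq [M' qM]] /(_ 0%N [::] isT isT) pq.
have d x : `|psi x - phi x| <= e / (4 * N + 1).
  rewrite -lee_fin; apply: le_trans (ltW pq).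
  by apply: ereal_sup_ubound; exists x => //; rewrite expr0 mul1r.
have -> : lacunary psi - lacunary phi = lacunary (fun x => (-1) * phi x + psi x).
  by rewrite (lacunary_linear _ cp pM cq qM) mulN1r addrC.
apply: (@le_lt_trans _ _ (4 * (e / (4 * N + 1)) * N)).
  apply: lacunary_le.
    apply: (@CkD _ _ 0%N (fun x => (-1) * phi x) psi) => //.
    by apply: (@CkM _ _ 0%N (cst (-1)) phi) => //; exact: cst_continuous.
  by move=> x; rewrite mulN1r addrC.
rewrite mulrAC mulrA ltr_pdivrMr// mulrC ltr_pM2l//.
by rewrite ltrDl.
Qed.

End lacunary_functional.

(** * Cubes, Lipschitz bounds and series *)

Section auxiliary_bounds.
Context {R : realType} {n : nat}.
Local Notation Rn := 'rV[R]_n.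
Local Notation mu := (lebesgue_rV R n).

Definition cball (y0 : Rn) (rho : R) : set Rn := [set y | `|y - y0| <= rho].

Lemma measurable_cball y0 rho : measurable (cball y0 rho).
Proof.
rewrite -[cball _ _]setTI.
rewrite (_ : cball y0 rho = (fun y => `|y - y0|) @^-1` `]-oo, rho]%classic).
  have : measurable_fun setT (fun y : Rn => `|y - y0|); last by apply.
  apply: continuous_measurable_rV => y.
  apply: (@continuous_comp _ _ _ (fun y : Rn => y - y0) (fun y => `|y|)).
    by apply: (@continuousB _ _ _ id (cst y0)) => //; exact: cst_continuous.
  exact: norm_continuous.
by apply/seteqP; split => y /=; rewrite in_itv.
Qed.

Lemma lebesgue_cball y0 rho : 0 <= rho -> mu (cball y0 rho) = ((2 * rho) ^+ n)%:E.
Proof.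
move=> rho0; pose a : Rn := \row_i (y0 ord0 i - rho); pose b : Rn := \row_i (y0 ord0 i + rho).
have ab i : a ord0 i <= b ord0 i by rewrite !mxE; lra.
rewrite (_ : cball y0 rho = [set x | forall i, x ord0 i \in `[a ord0 i, b ord0 i]]).
  rewrite lebesgue_rV_box//; congr EFin.
  rewrite (eq_bigr (fun=> 2 * rho)) ?prodr_const ?card_ord// => i _.
  by rewrite !mxE; ring.
apply/seteqP; split => y /= yr.
  move=> i; have := le_trans (rV_coord_le (y - y0) i) yr.
  by rewrite !mxE in_itv/= ler_norml => /andP[? ?]; apply/andP; split; lra.
apply: rV_norm_le => // i; have := yr i; rewrite !mxE in_itv/= ler_norml.
by move=> /andP[? ?]; apply/andP; split; lra.
Qed.

Lemma test_partials_bounded (f : Rn -> R) : test_function f ->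
  exists2 L : R, 0 <= L & forall j x, `|partial j f x| <= L.
Proof.
move=> tf; have /choice[L LP] : forall j, exists M : R, 0 <= M /\ forall x, `|partial j f x| <= M.
  move=> j; have [/smooth_continuous c b] := (test_functionP _).1 (test_partial j tf).
  by have [M M0 fM] := bsupp_bounded c b; exists M; split => //; exact: ltW.
exists (\sum_j L j) => [|j x]; first by apply: sumr_ge0 => j _; exact: (LP j).1.
rewrite (bigD1 j)//= (le_trans ((LP j).2 x))// lerDl.
by apply: sumr_ge0 => i _; exact: (LP i).1.
Qed.

(** The coordinates of [h] are added one at a time; by the mean value theorem along an axis each
    costs at most [L |h|]. *)
Lemma partials_bounded_lipschitz (f : Rn -> R) (L : R) : has_partials f ->
  (forall j x, `|partial j f x| <= L) ->
  forall x h : Rn, `|f (x + h) - f x| <= n%:R * L * `|h|.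
Proof.
move=> fp fL x h; rewrite [X in x + X](row_sum_delta h).
suff H (s : seq 'I_n) : `|f (x + \sum_(j <- s) h 0 j *: delta_mx 0 j) - f x| <=
    (size s)%:R * L * `|h|.
  by apply: le_trans (H _) _; rewrite [index_enum _]unlock -enumT size_enum_ord.
elim: s => [|j s IHs]; first by rewrite big_nil addr0 subrr normr0 mulr0n !mul0r.
rewrite big_cons addrCA [h 0 j *: _ + _]addrC.
set y := x + _ in IHs *.
rewrite -(subrK (f y) (f _)) -addrA; apply: le_trans (ler_normD _ _) _.
rewrite /= -[(size s).+1]addn1 natrD !mulrDl [X in _ <= X]addrC lerD// mul1r.
have [t [_ ->]] := @mean_value_line _ _ f y (delta_mx 0 j) (h 0 j) (fun y => fp j y).
by rewrite normrM mulrC ler_pM// ?rV_coord_le// fL.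
Qed.

End auxiliary_bounds.

Section series_bounds.
Context {R : realType}.

Lemma norm_lim_series_le (u : R^nat) : cvgn (series u) ->
  ((`|limn (series u)|)%:E <= \sum_(k <oo) (`|u k|)%:E)%E.
Proof.
move=> cu; have S0 : (0 <= \sum_(k <oo) (`|u k|)%:E)%E.
  by apply: nneseries_ge0 => k _ _; rewrite lee_fin.
have [->|Soo] := eqVneq (\sum_(k <oo) (`|u k|)%:E)%E +oo%E; first by rewrite leey.
rewrite -[leRHS]fineK; last by rewrite ge0_fin_numE// ltey.
have cn : `|series u k| @[k --> \oo] --> `|limn (series u)| by apply: cvg_norm; exact: cu.
rewrite lee_fin -(cvg_lim (@Rhausdorff R) cn); apply: limr_le; first exact: cvgP cn.
apply: nearW => k; rewrite -lee_fin fineK; last by rewrite ge0_fin_numE// ltey.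
apply: (@le_trans _ _ (\sum_(0 <= i < k) (`|u i|)%:E)%E).
  by rewrite sumEFin lee_fin; exact: ler_norm_sum.
by apply: nneseries_lim_ge => i _ _; rewrite lee_fin.
Qed.

Lemma nneseries_term_le (u : (\bar R)^nat) k : (forall i, 0 <= u i)%E ->
  (u k <= \sum_(i <oo) u i)%E.
Proof.
move=> u0; apply: (@le_trans _ _ (\sum_(0 <= i < k.+1) u i)%E).
  by rewrite big_nat_recr//= leeDr// sume_ge0.
by apply: nneseries_lim_ge => i _ _.
Qed.

Lemma nneseries_half (c : R) : 0 <= c ->
  (\sum_(k <oo) (c * 2^-1 ^+ k)%:E)%E = (c * 2)%:E.
Proof.
move=> c0; apply/cvg_lim => //.
rewrite (_ : (fun n => _) = EFin \o series (geometric c 2^-1)); last first.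
  by apply/funext => k; rewrite /= sumEFin.
apply: cvg_EFin; first exact: nearW.
have := @cvg_geometric_series R c _ half_lt1.
by rewrite (_ : (1 - 2^-1)^-1 = 2 :> R)//; field.
Qed.

End series_bounds.

(** * Support, size and decay of a dipole against a dilated kernel *)

Section lacunary_maximal_function.
Context {R : realType} {m : nat}.
Local Notation Rn := 'rV[R]_m.+1.
Local Notation mu := (lebesgue_rV R m.+1).

Variables (eta : Rn -> R) (r : R).
Hypothesis teta : test_function eta.
Hypothesis r0 : 0 < r.
Hypothesis etar : forall x, eta x != 0 -> `|x| <= r.

Let c : Rn := dipole_shift r.

Let c_le : `|c| <= 2 * r.
Proof.
have r2 : 0 <= 2 * r by rewrite mulr_ge0// ltW.
by rewrite normrZ ger0_norm// ler_piMr// norm_delta_le.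
Qed.

Let ceta : continuous eta.
Proof. by have [/smooth_continuous] := (test_functionP _).1 teta. Qed.

(** The argument that [conv] passes on: [conv T (dilate eta t) x] unfolds to [T (kernel_at t x)]. *)
Definition kernel_at (t : R) (x : Rn) : Rn -> R := fun y => dilate eta t (x - y).

Lemma kernel_atE t x : kernel_at t x =
  fun y => t ^- m.+1 * eta ((- t^-1) *: y + t^-1 *: x).
Proof.
apply/funext => y; rewrite /kernel_at /dilate; congr (_ * eta _).
by rewrite scalerBr scaleNr addrC.
Qed.

Lemma kernel_at_neq0 t x y : 0 < t -> kernel_at t x y != 0 -> `|x - y| <= r * t.
Proof.
move=> t0; rewrite /kernel_at /dilate mulf_eq0 negb_or => /andP[_ /etar].
by rewrite normrZ ger0_norm ?invr_ge0 ?(ltW t0)// mulrC ler_pdivrMr.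
Qed.

Lemma continuous_kernel_at t x : continuous (kernel_at t x).
Proof.
rewrite kernel_atE; apply: (@CkM _ _ 0%N (cst (t ^- m.+1))).
  exact: cst_continuous.
exact: (@Ck_affine _ _ 0%N).
Qed.

Lemma kernel_at_le t x y (E : R) : 0 < t -> (forall z, `|eta z| <= E) ->
  `|kernel_at t x y| <= t ^- m.+1 * E.
Proof.
move=> t0 etaE; rewrite normrM ger0_norm ?invr_ge0 ?exprn_ge0 ?(ltW t0)//.
by rewrite ler_wpM2l// invr_ge0 exprn_ge0// ltW.
Qed.

(** Both halves of the dipole lie within [a r + 2 r a] of the origin, and the kernel reaches a
    distance [r t] from [x]. *)
Lemma dipole_kernel_support t a x : 0 < t -> 0 < a ->
  dipole eta r (kernel_at t x) a != 0 -> `|x| <= r * (3 * a + t).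
Proof.
move=> t0 a0; apply: contra_neqT; rewrite -ltNge => xr.
suff K0 y s : eta y != 0 -> `|s| <= 2 * r * a -> kernel_at t x (a *: y + s) = 0.
  rewrite /dipole (_ : (fun y => _) = cst 0) ?Rintegral_cst ?mul0r//.
  have ac : `|a *: dipole_shift r : Rn| <= 2 * r * a.
    by rewrite normrZ (gtr0_norm a0) mulrC ler_wpM2r// ltW.
  apply/funext => y; have [->|ey] := eqVneq (eta y) 0; first by rewrite mul0r.
  by rewrite !K0 ?normrN// subr0 mulr0.
move=> ey sr; apply/eqP/negPn/negP => /(kernel_at_neq0 t0) xy.
move: xr; apply/negP; rewrite -leNgt.
rewrite -(subrK (a *: y + s) x); apply: le_trans (ler_normD _ _) _.
have : `|a *: y + s| <= a * r + 2 * r * a.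
  apply: le_trans (ler_normD _ _) _; apply: lerD => //.
  by rewrite normrZ (gtr0_norm a0) ler_wpM2l ?etar// ltW.
by lra.
Qed.

(** The kernel has height at most [E t^-n], while the set of [y] at which it is nonzero has volume
    at most [(2 r t / a)^n] for each half: the powers of [t] cancel. This is the bound used for
    [t <= a]. *)
Lemma dipole_kernel_size (E : R) t a x : (forall z, `|eta z| <= E) -> 0 < t -> 0 < a ->
  `|dipole eta r (kernel_at t x) a| <= 2 * E ^+ 2 * (2 * r) ^+ m.+1 * a ^- m.+1.
Proof.
move=> etaE t0 a0; have E0 : 0 <= E by apply: le_trans (etaE 0).
have id := dipole_integrable r teta a (@continuous_kernel_at t x).
rewrite -lee_fin /dipole EFin_normr_Rintegral//.
apply: le_trans (le_abse_integral _ _ _) _ => //; first exact: measurable_int id.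
(* A cube containing every [y] for which [a *: y + s] lies in the support of the kernel. *)
pose B s := cball (a^-1 *: (x - s)) (r * t / a).
pose K := E * (t ^- m.+1 * E).
have K0 : 0 <= K by rewrite !mulr_ge0// invr_ge0 exprn_ge0// ltW.
have mB s : measurable (B s) by exact: measurable_cball.
have kB y s : `|kernel_at t x (a *: y + s)| <= t ^- m.+1 * E * \1_(B s) y.
  have [->|ky] := eqVneq (kernel_at t x (a *: y + s)) 0.
    by rewrite normr0 !mulr_ge0// invr_ge0 exprn_ge0// ltW.
  rewrite indicE mem_set ?mulr1; first exact: kernel_at_le.
  rewrite /B /cball /= ler_pdivlMr// -[X in _ * X](gtr0_norm a0) mulrC -normrZ.
  rewrite scalerBr scalerA divff ?gt_eqF// scale1r.
  by rewrite opprB addrA distrC; apply: kernel_at_neq0.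
apply: (@le_trans _ _ (lint mu (fun y => K * (\1_(B (a *: c)) y + \1_(B (- (a *: c))) y)))).
  apply: ge0_le_integral => //.
  - by apply: measurableT_comp => //; exact: measurable_int id.
  - by apply/measurable_EFinP; apply: measurable_funM => //; exact: measurable_funD.
  - move=> y _; rewrite lee_fin /= normrM /K -mulrA; apply: ler_pM => //.
    by rewrite mulrDr (le_trans (ler_normB _ _))// lerD.
rewrite lintZ ?lintD//; last exact: measurable_funD.
have rta : 0 <= r * t / a by rewrite divr_ge0 ?mulr_ge0// ltW.
rewrite !lint_indic// !lebesgue_cball// -EFinD -EFinM lee_fin.
rewrite le_eqVlt; apply/orP; left; apply/eqP.
have -> : (2 * (r * t / a)) ^+ m.+1 = (2 * r) ^+ m.+1 * t ^+ m.+1 * (a ^+ m.+1)^-1.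
  by rewrite !mulrA !exprMn exprVn.
rewrite /K.
have : t ^+ m.+1 != 0 by rewrite expf_neq0// gt_eqF.
have : a ^+ m.+1 != 0 by rewrite expf_neq0// gt_eqF.
move: (t ^+ m.+1) (a ^+ m.+1) ((2 * r) ^+ m.+1) => T A RR A0 T0.
by field; rewrite A0 T0.
Qed.

(** Here the cancellation enters: the two halves evaluate the kernel at points [4 r a] apart along
    the first axis, where its derivative is at most [L t^-(n+1)]. The gain of a factor [a / t] over
    the height is what makes the maximal function integrable. *)
Lemma dipole_kernel_decay (L : R) t a x : (forall j z, `|partial j eta z| <= L) ->
  0 < t -> 0 < a ->
  `|dipole eta r (kernel_at t x) a| <=
  4 * r * L * (\int[mu]_y `|eta y|) * (a * t ^- m.+2).
Proof.
move=> etaL t0 a0; have L0 : 0 <= L by apply: le_trans (etaL ord0 0).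
have [seta _] := (test_functionP _).1 teta.
have tm0 : 0 <= t ^- m.+1 by rewrite invr_ge0 exprn_ge0// ltW.
rewrite (_ : 4 * r * L * _ * _ =
  (4 * r * L * (a * t ^- m.+2)) * (\int[mu]_y `|eta y|)); last by ring.
apply: dipole_le => // [|y _]; first exact: continuous_kernel_at.
rewrite kernel_atE -mulrBr normrM (ger0_norm tm0).
set P := (- t^-1 *: (a *: y - a *: c) + t^-1 *: x).
have [s [_ ->]] : exists s : R, `|s| <= `|- (t^-1 * a * (4 * r))| /\
    eta (- t^-1 *: (a *: y + a *: dipole_shift r) + t^-1 *: x) - eta P =
    - (t^-1 * a * (4 * r)) * partial ord0 eta (P + s *: delta_mx ord0 ord0).
  rewrite (_ : _ + t^-1 *: x = P + (- (t^-1 * a * (4 * r))) *: delta_mx ord0 ord0).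
    apply: mean_value_line => z; exact: smooth_has_partials.
  rewrite /P /c /dipole_shift; apply/rowP => i; rewrite !mxE; ring.
have A0 : 0 <= t^-1 * a * (4 * r).
  by apply: mulr_ge0; apply: mulr_ge0; rewrite ?invr_ge0 ltW.
rewrite normrM normrN (ger0_norm A0).
apply: (@le_trans _ _ (t ^- m.+1 * (t^-1 * a * (4 * r) * L))).
  by rewrite ler_wpM2l// ler_wpM2l// etaL.
rewrite le_eqVlt; apply/orP; left; apply/eqP.
by rewrite [t ^+ m.+2]exprSr invfM; ring.
Qed.

End lacunary_maximal_function.

Lemma dyadic_bracket (R : realType) (a t : R) : 0 < a -> a < t ->
  exists l : nat, a * 2 ^+ l <= t <= a * 2 ^+ l.+1.
Proof.
move=> a0 at_; have ex : exists k, t <= a * 2 ^+ k.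
  exists (Num.truncn (t / a)).+1; rewrite mulrC -ler_pdivrMr//.
  apply: le_trans (ltW (truncnS_gt _)) _.
  by rewrite -natrX ler_nat ltnW// ltn_expl.
have [k tk kmin] := ex_minnP ex; case: k tk kmin => [|l] tk kmin.
  by move: tk; rewrite expr0 mulr1 leNgt at_.
exists l; rewrite tk andbT leNgt; apply/negP => /ltW /kmin.
by rewrite ltnn.
Qed.

(** * The lacunary functional belongs to the Hardy space *)

Section lacunary_hardy.
Context {R : realType} {m : nat}.
Local Notation Rn := 'rV[R]_m.+1.
Local Notation mu := (lebesgue_rV R m.+1).

Variables (eta : Rn -> R) (r : R).
Hypothesis teta : test_function eta.
Hypothesis r0 : 0 < r.
Hypothesis etar : forall x, eta x != 0 -> `|x| <= r.

(** The bound depends on [t] only through the dyadic index [l]. With n = m + 1, the cube has volume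
    of order [(a 2^l)^n], against the factor [a^-n 2^(-l(n+1))]; so the integral over the l-th cube
    is of order [2^-l], uniformly in [a]. *)
Lemma dipole_kernel_bound : exists2 C : R, 0 <= C & forall t a x, 0 < t -> 0 < a ->
  exists l, `|dipole eta r (kernel_at eta t x) a| <=
    C * a ^- m.+1 * 2^-1 ^+ (l * m.+2) * \1_(cball (0 : Rn) (4 * r * a * 2 ^+ l)) x.
Proof.
have [/smooth_continuous ceta beta] := (test_functionP _).1 teta.
have [E E0 etaE] := bsupp_bounded ceta beta.
have [L L0 etaL] := test_partials_bounded teta.
pose N := \int[mu]_y `|eta y|; have N0 : 0 <= N by exact: Rintegral_ge0.
pose C1 := 2 * E ^+ 2 * (2 * r) ^+ m.+1; pose C2 := 4 * r * L * N.
have r2 : 0 <= 2 * r by rewrite mulr_ge0// ltW.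
have r4 : 0 <= 4 * r by rewrite mulr_ge0// ltW.
have C10 : 0 <= C1 by rewrite mulr_ge0 ?exprn_ge0// mulr_ge0 ?exprn_ge0// ltW.
have C20 : 0 <= C2 by rewrite mulr_ge0// mulr_ge0.
have C220 : 0 <= C2 * 2 ^+ m.+2 by rewrite mulr_ge0 ?exprn_ge0.
exists (C1 + C2 * 2 ^+ m.+2) => [|t a x t0 a0]; first exact: addr_ge0.
have am : 0 <= a ^- m.+1 by rewrite invr_ge0 exprn_ge0// ltW.
have h0 k : 0 <= 2^-1 ^+ k :> R by rewrite exprn_ge0// invr_ge0.
have [->|D0] := eqVneq (dipole eta r (kernel_at eta t x) a) 0.
  exists 0%N; rewrite normr0 mulr_ge0// mulr_ge0// mulr_ge0// addr_ge0//.
have xr := dipole_kernel_support r0 etar t0 a0 D0.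
have indic1 l : r * (3 * a + t) <= 4 * r * a * 2 ^+ l ->
    \1_(cball (0 : Rn) (4 * r * a * 2 ^+ l)) x = 1 :> R.
  by move=> xl; rewrite indicE mem_set// /cball /= subr0 (le_trans xr).
have [ta|at_] := leP t a.
  exists 0%N; rewrite mul0n expr0 mulr1 indic1 ?mulr1.
    apply: le_trans (dipole_kernel_size teta r0 etar x etaE t0 a0) _.
    by rewrite ler_wpM2r// lerDl.
  rewrite [4 * r]mulrC -mulrA ler_pM2l// (_ : 4 * a = 3 * a + a) ?lerD2l//.
  by ring.
have [l /andP[lt tl]] := dyadic_bracket a0 at_.
(* Since [a 2^l <= t <= a 2^(l+1)], the upper end determines the cube and the lower end the decay;
   the factor [2 ^+ m.+2] in the constant pays for the difference. *)
exists l.+1; have p0 : 1 <= 2 ^+ l.+1 :> R by rewrite exprn_ege1// ler1n.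
rewrite indic1 ?mulr1; last first.
  rewrite [4 * r]mulrC -!mulrA ler_pM2l//.
  have : a <= a * 2 ^+ l.+1 by rewrite ler_peMr// ltW.
  rewrite (_ : 4 * (a * 2 ^+ l.+1) = 3 * (a * 2 ^+ l.+1) + a * 2 ^+ l.+1) => [aq|].
    by rewrite lerD// ler_wpM2l.
  by ring.
apply: le_trans (dipole_kernel_decay teta r0 x etaL t0 a0) _.
have al0 : 0 < a * 2 ^+ l by rewrite mulr_gt0// exprn_gt0.
apply: (@le_trans _ _ (C2 * (a * (a * 2 ^+ l) ^- m.+2))).
  rewrite ler_wpM2l// ler_pM2l// lef_pV2 ?posrE ?exprn_gt0//.
  by rewrite lerXn2r ?nnegrE// ltW.
apply: (@le_trans _ _ (C2 * 2 ^+ m.+2 * a ^- m.+1 * 2^-1 ^+ (l.+1 * m.+2))).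
  have aE : a ^+ m.+1 != 0 by rewrite expf_neq0// gt_eqF.
  have a1 : a != 0 by rewrite gt_eqF.
  rewrite le_eqVlt; apply/orP; left; apply/eqP.
  rewrite exprMn -exprM mulSn exprVn exprD [a ^+ m.+2]exprS.
  have B0 : (2 : R) ^+ m.+2 != 0 by rewrite expf_neq0.
  have D0' : (2 : R) ^+ (l * m.+2) != 0 by rewrite expf_neq0.
  move: aE a1 B0 D0'; move: (a ^+ m.+1) (2 ^+ m.+2) (2 ^+ (l * m.+2)) => A B D aE a1 B0 D0'.
  by field; rewrite aE a1 B0 D0'.
by rewrite ler_wpM2r// ler_wpM2r// lerDr.
Qed.

(** By linearity the difference is the functional at a difference of kernels, whose supremum norm is
    Lipschitz in the centre. *)
Let lip (t : R) : 0 < t -> exists2 K : R, 0 <= K & forall x x',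
  `|lacunary eta r (kernel_at eta t x) - lacunary eta r (kernel_at eta t x')| <= K * `|x - x'|.
Proof.
move=> t0; have [seta beta] := (test_functionP _).1 teta.
have ceta : continuous eta by exact: smooth_continuous.
have [E E0 etaE] := bsupp_bounded ceta beta.
have [L L0 etaL] := test_partials_bounded teta.
pose N := \int[mu]_y `|eta y|; have N0 : 0 <= N by exact: Rintegral_ge0.
have tm : 0 <= t ^- m.+1 by rewrite invr_ge0 exprn_ge0// ltW.
have tv : 0 <= t^-1 by rewrite invr_ge0 ltW.
pose B := t ^- m.+1 * (m.+1%:R * L * t^-1).
have B0 : 0 <= B by rewrite mulr_ge0// mulr_ge0// mulr_ge0.
exists (4 * B * N) => [|x x']; first by rewrite mulr_ge0// mulr_ge0.
have ck z := @continuous_kernel_at _ _ _ teta t z.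
have kb z y := kernel_at_le z y t0 etaE.
have -> : lacunary eta r (kernel_at eta t x) - lacunary eta r (kernel_at eta t x') =
    lacunary eta r (fun y => (-1) * kernel_at eta t x' y + kernel_at eta t x y).
  by rewrite (lacunary_linear r teta _ (ck x') (kb x') (ck x) (kb x)) mulN1r addrC.
rewrite [4 * B * N * _]mulrAC -[4 * B * _]mulrA.
apply: lacunary_le => // [|y].
  apply: (@CkD _ _ 0%N (fun y => (-1) * kernel_at eta t x' y)); last exact: ck.
  apply: (@CkM _ _ 0%N (cst (-1))); [exact: cst_continuous|exact: ck].
rewrite mulN1r addrC /kernel_at /dilate -mulrBr normrM (ger0_norm tm) -mulrA ler_wpM2l//.
have -> : t^-1 *: (x - y) = t^-1 *: (x' - y) + t^-1 *: (x - x').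
  by rewrite -scalerDr; congr (_ *: _); rewrite [RHS]addrC addrA subrK.
apply: le_trans (partials_bounded_lipschitz (@smooth_has_partials _ _ _ seta) etaL _ _) _.
by rewrite normrZ (ger0_norm tv) mulrA.
Qed.

Lemma continuous_lacunary_kernel t : 0 < t ->
  continuous (fun x : Rn => lacunary eta r (kernel_at eta t x)).
Proof.
move=> t0; have [K K0 KL] := lip t0.
have K1 : 0 < K + 1 by rewrite ltr_pwDr.
pose g (x : Rn) := lacunary eta r (kernel_at eta t x).
suff cg : continuous g by [].
move=> x; apply/cvgrPdist_le => [|e e0]; first exact: nbhs_filter.
apply/(nbhs_ballP x).
exists (e / (K + 1)) => [|y]; first by rewrite /= divr_gt0.
rewrite -ball_normE /= => xy; apply: le_trans (KL x y) _.
apply: (@le_trans _ _ ((K + 1) * `|x - y|)); first by rewrite ler_wpM2r// lerDl.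
by rewrite mulrC -ler_pdivlMr// ltW.
Qed.

(** The supremum is over uncountably many [t], but continuity in [x] makes each strict superlevel
    set a union of open sets. *)
Lemma measurable_maximal_lacunary :
  measurable_fun setT (maximal_function eta (lacunary eta r)).
Proof.
apply: (measurability _ (ErealGenOInfty.measurableE R)).
move=> /= _ [_ [a ->]] <-; rewrite setTI; apply: open_measurable_rV.
rewrite (_ : _ @^-1` _ = \bigcup_(t in [set t : R | 0 < t])
  [set x | a < `|lacunary eta r (kernel_at eta t x)|]).
  apply: bigcup_open => t /= t0.
  rewrite (_ : [set x | _] = (fun x => `|lacunary eta r (kernel_at eta t x)|) @^-1` `]a, +oo[%classic).
    move/continuousP : (fun x => continuous_comp (continuous_lacunary_kernel t0 (x := x))
      (@norm_continuous _ _ _)); apply.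
    exact: interval_open.
  by apply/seteqP; split => x /=; rewrite in_itv/= andbT.
apply/seteqP; split => [x /=|x [t /= t0 ax]].
  rewrite in_itv/= andbT => /ereal_sup_gt[_ [t /= t0 <-]]; rewrite lte_fin => ax.
  by exists t.
rewrite /= in_itv/= andbT; apply: (@lt_le_trans _ _ (`|lacunary eta r (kernel_at eta t x)|)%:E).
  by rewrite lte_fin.
by apply: ereal_sup_ubound; exists t.
Qed.

Lemma hardy1_lacunary : hardy1 eta (lacunary eta r).
Proof.
split; first exact: tempered_lacunary.
have [/smooth_continuous ceta beta] := (test_functionP _).1 teta.
have [E E0 etaE] := bsupp_bounded ceta beta.
have [C C0 CP] := dipole_kernel_bound.
have h0 k : 0 <= 2^-1 ^+ k :> R by rewrite exprn_ge0// invr_ge0.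
have p4 k : 0 < 4 ^+ k :> R by rewrite exprn_gt0.
pose w k l : R := 2^-1 ^+ k * (C * (4 ^+ k) ^- m.+1 * 2^-1 ^+ (l * m.+2)).
have w0 k l : 0 <= w k l.
  by rewrite mulr_ge0// mulr_ge0// mulr_ge0// invr_ge0 exprn_ge0// ltW.
pose rad k l : R := 4 * r * 4 ^+ k * 2 ^+ l.
have rad0 k l : 0 <= rad k l.
  by rewrite mulr_ge0 ?exprn_ge0// mulr_ge0 ?exprn_ge0// mulr_ge0// ltW.
pose b k l (x : Rn) : R := w k l * \1_(cball (0 : Rn) (rad k l)) x.
have b0 k l x : 0 <= b k l x by rewrite mulr_ge0.
have mind k l : measurable_fun setT (\1_(cball (0 : Rn) (rad k l)) : Rn -> R).
  by apply: measurable_indic; exact: measurable_cball.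
have mb k l : measurable_fun setT (fun x => (b k l x)%:E).
  by apply/measurable_EFinP; exact: measurable_funM.
(* The index given by [dipole_kernel_bound] varies with [t]; summing over all [l] yields a majorant
   independent of [t]. *)
pose Phi x : \bar R := (\sum_(k <oo) \sum_(l <oo) (b k l x)%:E)%E.
have inner0 k x : (0 <= \sum_(l <oo) (b k l x)%:E)%E.
  by apply: nneseries_ge0 => l _ _; rewrite lee_fin.
have minner k : measurable_fun setT (fun x => \sum_(l <oo) (b k l x)%:E)%E.
  by apply: ge0_emeasurable_sum => // l x _ _; rewrite lee_fin.
have mPhi : measurable_fun setT Phi by exact: ge0_emeasurable_sum.
have maxPhi x : (maximal_function eta (lacunary eta r) x <= Phi x)%E.
  apply: ge_ereal_sup => _ [t /= t0 <-].
  rewrite -[Defs.conv _ _ x]/(limn (series (dipole_term eta r (kernel_at eta t x)))).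
  have cs := @dipole_series_cvg _ _ _ r teta _ _ (@continuous_kernel_at _ _ _ teta t x)
    (fun y => kernel_at_le x y t0 etaE).
  apply: le_trans (norm_lim_series_le cs) _.
  apply: lee_nneseries => [k _ _|k _]; first by rewrite lee_fin.
  have [l lP] := CP t (4 ^+ k) x t0 (p4 k).
  apply: (@le_trans _ _ (b k l x)%:E).
    rewrite lee_fin /dipole_term normrM (ger0_norm (h0 k)) /b /w -[X in _ <= X]mulrA.
    by rewrite ler_wpM2l.
  by apply: (@nneseries_term_le _ (fun l => (b k l x)%:E)) => i; rewrite lee_fin.
(* With n = m + 1 the cube has volume [(8 r 4^k 2^l)^n]. It cancels [(4^k)^-n] and all but one
   factor [2^-l], so the double series converges. *)
have intb k l : (\int[mu]_x (b k l x)%:E = (C * (8 * r) ^+ m.+1 * 2^-1 ^+ k * 2^-1 ^+ l)%:E)%E.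
  rewrite -[LHS]/(lint mu (b k l)) lintZ// lint_indic; last exact: measurable_cball.
  rewrite lebesgue_cball// -EFinM; congr EFin; rewrite /w /rad.
  have -> : 2 * (4 * r * 4 ^+ k * 2 ^+ l) = 8 * r * 4 ^+ k * 2 ^+ l by ring.
  rewrite !exprMn [2^-1 ^+ (l * m.+2)]exprVn [2^-1 ^+ l]exprVn mulnS exprD [2 ^+ (l * _)]exprM.
  have := expf_neq0 m.+1 (lt0r_neq0 (p4 k)).
  have p2 : (2 : R) ^+ l != 0 by rewrite expf_neq0.
  have := expf_neq0 m.+1 p2; move: p2.
  move: (2 ^+ l) => D D0; move: (D ^+ m.+1) ((4 ^+ k) ^+ m.+1) (8 ^+ m.+1) (r ^+ m.+1) (2^-1 ^+ k).
  by move=> F G P Q S F0 G0; field; rewrite D0 F0 G0.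
apply/integrableP; split; first exact: measurable_maximal_lacunary.
have c0 : 0 <= C * (8 * r) ^+ m.+1 by rewrite mulr_ge0// exprn_ge0// mulr_ge0// ltW.
apply: (@le_lt_trans _ _ (\int[mu]_x Phi x)%E).
  apply: ge0_le_integral => //.
  - by apply: measurableT_comp => //; exact: measurable_maximal_lacunary.
  (* The supremum is nonnegative because it dominates its entry at [t = 1]. *)
  - move=> x _; rewrite gee0_abs//.
    apply: (@le_trans _ _ (`|Defs.conv (lacunary eta r) (dilate eta 1) x|)%:E).
      by rewrite lee_fin.
    by apply: ereal_sup_ubound; exists 1 => //=.
rewrite integral_nneseries//.
rewrite (eq_eseriesr (g := fun k => (C * (8 * r) ^+ m.+1 * 2 * 2^-1 ^+ k)%:E)).
  by rewrite nneseries_half ?ltry// mulr_ge0.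
move=> k _; rewrite integral_nneseries//; last by move=> l x _; rewrite lee_fin.
under eq_eseriesr do rewrite intb.
rewrite nneseries_half; last by rewrite mulr_ge0.
by congr EFin; rewrite mulrAC.
Qed.

End lacunary_hardy.

(** * Each probe sees the dipole of a single scale *)

Section scale_separation.
Context {R : realType} {m : nat}.
Local Notation Rn := 'rV[R]_m.+1.
Local Notation mu := (lebesgue_rV R m.+1).

Variables (eta : Rn -> R) (r : R).
Hypothesis teta : test_function eta.
Hypothesis r0 : 0 < r.
Hypothesis etar : forall x, eta x != 0 -> `|x| <= r.

(** It sits on the positive half of the k-th dipole. *)
Definition probe (k : nat) : Rn -> R :=
  fun x => eta ((4 ^+ k)^-1 *: x - dipole_shift r).

Lemma test_probe k : test_function (probe k).
Proof. by apply: test_affine => //; rewrite invr_neq0// expf_neq0. Qed.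

Lemma eta_coord0 x : eta x != 0 -> - r <= x ord0 ord0 <= r.
Proof. by move=> /etar xr; rewrite -ler_norml (le_trans (rV_coord_le _ _)). Qed.

(** In the first coordinate the probe lives over [4^k [r, 3r]], the halves of the dipole over [4^j
    [r, 3r]] and its negative; for distinct [j] and [k] the probe's interval misses both. *)
Lemma dipole_probe_neq k j : k != j -> dipole eta r (probe k) (4 ^+ j) = 0.
Proof.
move=> kj; rewrite /dipole (_ : (fun y => _) = cst 0) ?Rintegral_cst ?mul0r//.
have p4 i : 0 < 4 ^+ i :> R by rewrite exprn_gt0.
pose q : R := 4 ^+ j / 4 ^+ k.
have q0 : 0 < q by rewrite divr_gt0.
have qE : 4 <= q \/ q * 4 <= 1.
  have [jk|jk] := ltnP k j.
    left; by rewrite /q ler_pdivlMr// -exprS ler_weXn2l// ler1n.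
  right; rewrite /q mulrAC ler_pdivrMr// mul1r -exprSr.
  by rewrite ler_weXn2l ?ler1n// ltn_neqAle eq_sym kj.
have K y (s : R) : eta y != 0 -> s = 1 \/ s = -1 ->
    probe k (4 ^+ j *: y + 4 ^+ j *: (s *: dipole_shift r)) = 0.
  move=> /eta_coord0/andP[y1 y2] s1; apply/eqP/negPn/negP => /eta_coord0.
  rewrite -scalerDr scalerA [_^-1 * _]mulrC -/q.
  rewrite [X in - r <= X <= _](_ : _ = q * (y ord0 ord0 + s * (2 * r)) - 2 * r); last first.
    by rewrite !mxE eqxx /=; ring.
  move/andP; move: (y ord0 ord0) y1 y2 => z z1 z2 [p1 p2].
  (* The contradiction is linear once the products of [q] with [z] and [r] count as unknowns; [h1]
     to [h4] supply the sign information about them. *)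
  have h1 : 0 <= q * (z + r) by apply: mulr_ge0; [exact: ltW|lra].
  have h2 : 0 <= q * (r - z) by apply: mulr_ge0; [exact: ltW|lra].
  have h3 : 0 < q * r by exact: mulr_gt0.
  case: s1 => s1; rewrite s1 in p1 p2; case: qE => qE; try by lra.
    have h4 : 0 <= (q - 4) * r by apply: mulr_ge0; [lra|exact: ltW].
    by lra.
  have h4 : 0 <= (1 - q * 4) * r by apply: mulr_ge0; [lra|exact: ltW].
  by lra.
apply/funext => y; have [->|ey] := eqVneq (eta y) 0; first by rewrite mul0r.
have := K y 1 ey (or_introl erefl); have := K y (-1) ey (or_intror erefl).
by rewrite scale1r scaleN1r scalerN => -> ->; rewrite subrr mulr0.
Qed.

Lemma dipole_probe k : dipole eta r (probe k) (4 ^+ k) = \int[mu]_y (eta y * eta y).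
Proof.
have p4 : (4 : R) ^+ k != 0 by rewrite expf_neq0.
apply: eq_Rintegral => y _.
have [->|ey] := eqVneq (eta y) 0; first by rewrite !mul0r.
congr (_ * _); rewrite /probe -scalerDr -scalerBr !scalerA mulVf// !scale1r addrK.
(* On the negative half the probe evaluates [eta] at a point moved by [4 r] along the first axis,
   which is too far to stay in its support. *)
rewrite (_ : eta (y - _ - _) = 0) ?subr0//.
apply/eqP/negPn/negP => /eta_coord0; have := eta_coord0 ey.
rewrite [X in _ -> - r <= X <= _ -> _](_ : _ = y ord0 ord0 - 4 * r).
  move: (y ord0 ord0) (r0) => z rp /andP[z1 z2] /andP[z3 z4]; lra.
by rewrite !mxE eqxx /=; ring.
Qed.

(** Only one term of the series is nonzero, so its partial sums are constant past [k]. *)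
Lemma lacunary_probe k :
  lacunary eta r (probe k) = 2^-1 ^+ k * \int[mu]_y (eta y * eta y).
Proof.
rewrite /lacunary; apply/cvg_lim => //.
apply: cvg_near_cst; exists k.+1 => // N /= kN; rewrite /series /=.
rewrite (bigD1_seq k) ?mem_index_iota ?iota_uniq//=.
rewrite big1 ?addr0 /dipole_term ?dipole_probe// => j jk.
by rewrite dipole_probe_neq ?mulr0// eq_sym.
Qed.

Lemma partial_probe k j x :
  partial j (probe k) x = (4 ^+ k)^-1 * partial j eta ((4 ^+ k)^-1 *: x - dipole_shift r).
Proof.
have [seta _] := (test_functionP _).1 teta.
by rewrite /probe partial_affine//; exact: smooth_has_partials.
Qed.

Lemma Rintegral_sqr_gt0 : \int[mu]_x eta x != 0 -> 0 < \int[mu]_y (eta y * eta y).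
Proof.
move=> eta0; have [x0 x00] : exists x0, eta x0 != 0.
  apply: contrapT => /forallNP eta00; move/eqP: eta0; apply.
  rewrite (_ : eta = cst 0) ?Rintegral_cst ?mul0r//.
  by apply/funext => x; apply/eqP/negPn/negP; exact: eta00.
have [seta beta] := (test_functionP _).1 teta.
have ceta : continuous eta by exact: smooth_continuous.
have c2 : continuous (fun y => eta y * eta y) by exact: (@CkM _ _ 0%N).
have b2 : bsupp (fun y => eta y * eta y) by apply: bsuppW beta => y ->; rewrite mul0r.
have s0 y : 0 <= eta y * eta y by rewrite -expr2 sqr_ge0.
rewrite /Rintegral fine_gt0//; apply/andP; split.
  apply: (@lint_gt0 _ _ (fun y => eta y * eta y) x0) => //.
  by rewrite -expr2 lt_neqAle sqr_ge0 eq_sym sqrf_eq0 x00.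
have := integrable_fin_num measurableT (bsupp_integrable c2 b2).
by rewrite fin_numE => /andP[_]; rewrite ltey.
Qed.

End scale_separation.

(** * Conclusion: the lacunary functional is not a Jacobian *)

Unset Implicit Arguments.

Theorem corollary1p3 (R : realType) (n : nat) (hn : (2 <= n)%N)
    (eta : 'rV[R]_n -> R) (heta : test_function eta)
    (heta0 : \int[lebesgue_rV R n]_x eta x != 0) :
  ~ (forall h : ('rV[R]_n -> R) -> R, hardy1 eta h ->
       exists u : 'rV[R]_n -> 'rV[R]_n,
         sobolev1n u /\
         distribution_eq (distribution_of (jacobian_operator u)) h).
Proof.
(* The dimension becomes [m.+2], so the positive parameter of the Jacobian estimate is [m.+1]. *)
case: n hn eta heta heta0 => [//|[//|m]] _ {}eta {}heta {}heta0 surj.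
have [_ [r' etar']] := (test_functionP eta).1 heta.
pose r := `|r'| + 1.
have r0 : 0 < r by rewrite ltr_pwDr.
have etar x : eta x != 0 -> `|x| <= r.
  by move=> /etar' xr; rewrite (le_trans xr)// (le_trans (ler_norm r'))// lerDl.
have [u [su uE]] := surj _ (hardy1_lacunary heta r0 etar).
have [C CP] := jacobian_lipschitz_bound (ltn0Sn m) heta heta0 su.
have [L L0 etaL] := test_partials_bounded heta.
have := Rintegral_sqr_gt0 heta heta0; set I := Rintegral _ _ _ => I0.
(* The estimate on the k-th probe reads [2^-k I <= C (L 4^-k)]; multiplying by [4^k] leaves growth
   [2^k] on the left. *)
have IC k : I * 2 ^+ k <= C * L.
  have p4 : 0 < (4 ^+ k)^-1 :> R by rewrite invr_gt0 exprn_gt0.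
  have tk := test_probe r heta k.
  have Lk : 0 <= L * (4 ^+ k)^-1 by rewrite mulr_ge0// ltW.
  have dk j x : `|partial j (probe eta r k) x| <= L * (4 ^+ k)^-1.
    by rewrite partial_probe// normrM (gtr0_norm p4) mulrC ler_wpM2r// ltW.
  have := CP _ _ tk Lk dk; rewrite (uE _ (test_schwartz tk)) lacunary_probe// -/I.
  have p2 : 0 < 2 ^+ k :> R by rewrite exprn_gt0.
  rewrite exprVn ger0_norm; last by rewrite mulr_ge0 ?invr_ge0// ltW.
  rewrite (_ : 4 = 2 * 2 :> R); last by ring.
  rewrite exprMn mulrA ler_pdivlMr ?mulr_gt0//.
  by rewrite mulrA [_ * I * _]mulrAC mulVf ?mul1r// gt_eqF.
have [k Ik] : exists k : nat, C * L < I * 2 ^+ k.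
  exists (Num.truncn (C * L / I)).+1; rewrite [I * _]mulrC -ltr_pdivrMr//.
  apply: lt_le_trans (truncnS_gt _) _.
  by rewrite -natrX ler_nat ltnW// ltn_expl.
by have := IC k; rewrite leNgt Ik.
Qed.
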